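(* Let $(V_1,V_2)\in Q$, where $Q$ is the set of unordered pairs of maximal totally isotropic subspaces $V_1,V_2$ of $\mathbf F_3^5$ such that $V_1\cap V_2$ is a one-dimensional $\mathbf F_3$-subspace. Choose sets of representatives $S_{V_1}$ and $S_{V_2}$ in $S$ of $\mathbf P(V_1)-\mathbf P(V_1\cap V_2)$ and $\mathbf P(V_2)-\mathbf P(V_1\cap V_2)$ respectively. Then for all $\tau\in\mathbf B_4$ $$\prod_{v_1\in S_{V_1}}\Theta_{v_1}^3(\tau)=\tilde\epsilon(S_{V_1},S_{V_2})\prod_{v_2\in S_{V_2}}\Theta_{v_2}^3(\tau),$$ where $\tilde\epsilon(S_{V_1},S_{V_2})\in\{\pm1\}$ is the lifting to $\{\pm1\}\subset\mathbf Z$ of $\prod_{v_1\in S_{V_1},\,v_2\in S_{V_2}}(v_1\cdot v_2)\in\mathbf F_3^\times$.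
   Context: $\mathbf F_3^5$ carries the bilinear form $v\cdot w=\sum_iv^{(i)}w^{(i)}$ and $q(v)=v\cdot v$; $S=\{v\in\mathbf F_3^5\setminus\{0\}:q(v)=0\}$; totally isotropic refers to this form. $H=\mathrm{diag}(1,1,1,1,-1)$, $\mathbf 1=(1,1,1,1,1)$, $\mathbf e(x)=\exp(2\pi\sqrt{-1}x)$. $\mathfrak H_5$ is the Siegel upper half space of degree 5 and $\mathbf B_4=\{\tau\in\mathfrak H_5:(H\tau)^2+H\tau+I=0\}$. For $m=(m',m'')\in\mathbf R^{10}$ let $\Theta_m(\tau)=\sum_{p\in\mathbf Z^5}\mathbf e(\frac12(p+m')\tau\,{}^t(p+m')+(p+m')\,{}^tm'')$. Let $r_1=(1,1,1,1,1)$, $r_2=(1,-1,-1,-1,-1)$, $r_3=(0,1,-1,0,0)$, $r_4=(0,0,0,1,-1)$, $r_5=(0,1,1,-1,-1)$. For $v\in S$ choose a lift $\tilde v\in\mathbf Z^5$ of $v$, put $\tilde\beta=(r_1\cdot\tilde v,\dots,r_5\cdot\tilde v)$, $\tilde m=\frac12(\mathbf 1,\mathbf 1)+\frac13(-\tilde\beta H,\tilde\beta)$ and $\Theta_v^3(\tau):=\Theta_{\tilde m}(\tau)^3$, which is independent of the lift. *)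

(* Defs.v *)
From HB Require Import structures.
From mathcomp Require Import all_boot all_order all_algebra.
From mathcomp Require Import all_classical all_reals all_analysis.
From mathcomp.analysis.showcase Require summability.
From mathcomp.real_closed Require Import complex.

Set Implicit Arguments.
Unset Strict Implicit.
Unset Printing Implicit Defensive.

Import Order.TTheory GRing.Theory Num.Theory.
Import numFieldNormedType.Exports.

Local Open Scope ring_scope.
Local Open Scope complex_scope.

Definition dot (A : comNzRingType) (n : nat) (v w : 'rV[A]_n) : A :=
  (v *m w^T) 0 0.

Definition quad (v : 'rV['F_3]_5) : 'F_3 := dot v v.

Definition isotropic_vectors : {set 'rV['F_3]_5} :=
  [set v : 'rV['F_3]_5 | (v != 0) && (quad v == 0)].

Definition totally_isotropic (V : {vspace 'rV['F_3]_5}) : Prop :=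
  forall v w, v \in V -> w \in V -> dot v w = 0.

Definition maximal_totally_isotropic (V : {vspace 'rV['F_3]_5}) : Prop :=
  totally_isotropic V /\
  forall W : {vspace 'rV['F_3]_5}, totally_isotropic W -> (V <= W)%VS -> W = V.

(* An unordered pair is encoded by a symmetric relation, see [in_Q_sym];
   its two members are automatically distinct. *)
Definition in_Q (V1 V2 : {vspace 'rV['F_3]_5}) : Prop :=
  [/\ maximal_totally_isotropic V1, maximal_totally_isotropic V2
    & (\dim (V1 :&: V2) = 1)%N].

Lemma in_Q_sym V1 V2 : in_Q V1 V2 -> in_Q V2 V1.
Proof. by case=> h1 h2 h; split=> //; rewrite capvC. Qed.

(* A point of a projective space P(V) is a one-dimensional subspace of V. *)
Definition proj_space (V : {vspace 'rV['F_3]_5}) : pred {vspace 'rV['F_3]_5} :=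
  [pred L | (\dim L == 1)%N && (L <= V)%VS].

Definition representatives (T : {set 'rV['F_3]_5})
    (X : pred {vspace 'rV['F_3]_5}) : Prop :=
  [/\ {subset T <= isotropic_vectors},
      forall v, v \in T -> X <[v]>%VS
    & forall L, X L -> exists! v, v \in T /\ <[v]>%VS = L].

(* The lift of {0, 1, -1} = F_3 to {0, 1, -1} in Z. *)
Definition lift_F3 (x : 'F_3) : int :=
  if x == 0 then 0 else if x == 1 then 1 else - 1.

Lemma lift_F3K (x : 'F_3) : (lift_F3 x)%:~R = x.
Proof. by apply/eqP; case: x => [[|[|[|]]]]. Qed.

Definition eps_tilde (T1 T2 : {set 'rV['F_3]_5}) : int :=
  lift_F3 (\prod_(v1 in T1) \prod_(v2 in T2) dot v1 v2).

Definition Hmx (A : nzRingType) : 'M[A]_5 :=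
  diag_mx (\row_i [:: 1; 1; 1; 1; - 1]`_i).

Definition siegel_half_space (R : realType) (tau : 'M[R[i]]_5) : Prop :=
  tau^T = tau /\
  forall x : 'rV[R]_5, x != 0 ->
    0 < (x *m map_mx (@complex.Im R) tau *m x^T) 0 0.

Definition ball4 (R : realType) (tau : 'M[R[i]]_5) : Prop :=
  siegel_half_space tau /\
  (Hmx _ *m tau) ^+ 2 + Hmx _ *m tau + 1%:M = 0.

Definition cexp (R : realType) (z : R[i]) : R[i] :=
  (expR (complex.Re z))%:C * (cos (complex.Im z) +i* sin (complex.Im z)).

Definition ee (R : realType) (z : R[i]) : R[i] :=
  cexp ((0 +i* (2 * pi)) * z).

(* [summability.sum] is the limit of the finite partial sums along the directed
   set of finite subsets of the index type (unconditional summation);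
   [R[i]^o] is the complex field as a normed space over itself. *)
Definition Theta (R : realType) (m' m'' : 'rV[R]_5) (tau : 'M[R[i]]_5) : R[i] :=
  let c (u : 'rV[R]_5) : 'rV[R[i]]_5 := map_mx (real_complex R) u in
  summability.sum (fun p : 'rV[int]_5 =>
    let q := map_mx intr p + c m' in
    ee (2^-1 * (q *m tau *m q^T) 0 0 + (q *m (c m'')^T) 0 0) : R[i]^o).

Definition rvec (i : 'I_5) : 'rV[int]_5 :=
  \row_j (nth [::] [:: [:: 1;  1;   1;   1;   1];
                       [:: 1; - 1; - 1; - 1; - 1];
                       [:: 0;  1; - 1;   0;   0];
                       [:: 0;  0;   0;   1; - 1];
                       [:: 0;  1;   1; - 1; - 1]] i)`_j.

Definition beta_tilde (vt : 'rV[int]_5) : 'rV[int]_5 := \row_i dot (rvec i) vt.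

(* [Theta3 vt] is the cubed theta function attached to the reduction modulo 3
   of the integral vector [vt]. *)
Definition Theta3 (R : realType) (vt : 'rV[int]_5) (tau : 'M[R[i]]_5) : R[i] :=
  let b := beta_tilde vt in
  let m' : 'rV[R]_5 := const_mx 2^-1 + 3^-1 *: map_mx intr (- b *m Hmx int) in
  let m'' : 'rV[R]_5 := const_mx 2^-1 + 3^-1 *: map_mx intr b in
  Theta m' m'' tau ^+ 3.

Definition is_lift (lift : 'rV['F_3]_5 -> 'rV[int]_5) : Prop :=
  forall v, v \in isotropic_vectors -> map_mx intr (lift v) = v.

(* Main.v *)
(* For tau in the ball, -tau^-1 = H + H tau H, so the inversion formula relates
   theta constants at tau to theta constants at the same tau.  Only the weak
   form of inversion is needed: sum_p e(1/2 (p+z) S (p+z)) is a constant, not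
   depending on z, times sum_n e(-1/2 n S^-1 n + n z).  It is proved by
   comparing averages over the torsion points of order N with Fejer means.

   Write theta_v for the theta constant of a vector v over F_3, q(v) = v.v and
   chi for a nontrivial character of F_3.  Inversion for tau gives
   theta_v = K chi(q(v)) theta_v, so either all theta_v with q(v) = 0 vanish, or
   all those with q(v) <> 0 do.  Let v0 span V1 /\ V2.  A change of lattice
   writes f(v) = theta_v theta_(v+v0) theta_(v-v0) through theta functions of
   3 tau, and inversion for 3 tau then gives
   f(v) = K sum_w chi(q(v) - v.w) f(w).  In the second case f is supported on
   isotropic vectors orthogonal to v0; iterating the transform and using that f
   is odd gives 3^5 K^2 = -1 unless f = 0.  Take a in V1, b in V2 with a.b = 1.
   The Gram determinant of v0, u, a, b, w with u.v0 = 1 shows that (a.w)(b.w) is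
   a square, so only w in V1 or V2 contribute to
   f(a) - f(b) = K sum_w (chi(-a.w) - chi(-b.w)) f(w); the right-hand side is
   l (f(a) - f(b)) with l = 3 K (chi(1) - chi(-1)), l^2 = 1/9.  Hence
   f(a) = f(b), and the cubes are the two products up to the signs of the
   representatives. *)
Require Import Defs.
From HB Require Import structures.
From mathcomp Require Import all_boot all_order all_algebra.
From mathcomp Require Import all_classical all_reals all_analysis.
From mathcomp.analysis.showcase Require summability.
From mathcomp.real_closed Require Import complex.
From mathcomp Require Import finmap zify ring lra.

Set Implicit Arguments.
Unset Strict Implicit.
Unset Printing Implicit Defensive.

Import Order.TTheory GRing.Theory Num.Theory.
Import numFieldNormedType.Exports.
Import Normc.

Local Open Scope ring_scope.
Local Open Scope complex_scope.

(** No integral and no holomorphy enter the inversion formula. The Riemann sums [gavg S N v] play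
    the role of the Gaussian integral, and its invariance under complex shifts, usually a change of
    contour, becomes an O(1/N) estimate: in a shift by w/N the first-order Taylor term cancels
    against shifts by lattice vectors, which change nothing. These sums are never shown to converge;
    comparing two values of z eliminates them. The unknown constant K is harmless: in the dichotomy
    it is compared with 1, and in the second transform iteration determines its square. A single
    theta constant is attached to an integral vector and changes by a cube root of unity when that
    vector moves by 3 p, p of even coordinate sum. Cubing removes the ambiguity, and so does the
    product over v, v + v0, v - v0, whose three phases multiply to 1; this is what makes f a
    function on F_3^5. Evenness holds for all vectors beta and removes the signs e(1/2 sum b_i).
    Modulo 3 the map from v to beta carries the standard form to minus the form of H, which turns
    the phases coming from H into characters of v.w. *)

Section Modulus.
Variable R : realType.
Implicit Types z w : R[i].

Lemma normc_ge0 z : 0 <= normc z.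
Proof. by case: z => a b; exact: sqrtr_ge0. Qed.

Lemma ler_normcD z w : normc (z + w) <= normc z + normc w.
Proof. exact: (@le_normcD R). Qed.

Lemma normc_opp z : normc (- z) = normc z.
Proof. exact: (@normcN R). Qed.

Lemma normc_distC z w : normc (z - w) = normc (w - z).
Proof. by rewrite -normc_opp opprB. Qed.

Lemma ler_normcB z w : normc (z - w) <= normc z + normc w.
Proof. by rewrite (le_trans (ler_normcD _ _)) // normc_opp. Qed.

Lemma normc_eq0P z : normc z = 0 -> z = 0.
Proof. exact: eq0_normc. Qed.

Lemma normc_real (x : R) : normc x%:C = `|x|.
Proof. by rewrite /= expr0n /= addr0 sqrtr_sqr. Qed.

Lemma normE z : `|z| = (normc z)%:C.
Proof. by case: z. Qed.

Lemma normc_sq z : normc z ^+ 2 = complex.Re z ^+ 2 + complex.Im z ^+ 2.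
Proof. by case: z => a b; rewrite /normc sqr_sqrtr // addr_ge0 // sqr_ge0. Qed.

Lemma ler_Re_normc z : `|complex.Re z| <= normc z.
Proof.
rewrite -(@ler_pXn2r _ 2) // ?nnegrE ?normr_ge0 ?normc_ge0 //.
by rewrite normc_sq real_normK ?num_real // lerDl sqr_ge0.
Qed.

Lemma ler_Im_normc z : `|complex.Im z| <= normc z.
Proof.
rewrite -(@ler_pXn2r _ 2) // ?nnegrE ?normr_ge0 ?normc_ge0 //.
by rewrite normc_sq real_normK ?num_real // lerDr sqr_ge0.
Qed.

Lemma ler_normc_ReIm z : normc z <= `|complex.Re z| + `|complex.Im z|.
Proof.
case: z => a b /=.
rewrite -(@ler_pXn2r _ 2) // ?nnegrE ?sqrtr_ge0 ?addr_ge0 ?normr_ge0 //.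
rewrite sqr_sqrtr ?addr_ge0 ?sqr_ge0 // sqrrD !real_normK ?num_real //.
by rewrite -addrA [_ *+ 2 + _]addrC addrA lerDl mulrn_wge0 // mulr_ge0 ?normr_ge0.
Qed.

Lemma normc_sum (I : Type) (r : seq I) (P : pred I) (F : I -> R[i]) :
  normc (\sum_(i <- r | P i) F i) <= \sum_(i <- r | P i) normc (F i).
Proof.
elim/big_rec2: _ => [|i y1 y2 _ h]; first by rewrite normc0.
by rewrite (le_trans (ler_normcD _ _)) // lerD2l.
Qed.

Lemma normcX z n : normc (z ^+ n) = normc z ^+ n.
Proof. by elim: n => [|n IH]; rewrite ?normc1 // !exprS normcM IH. Qed.

Lemma normc_le0_eps z : (forall e, 0 < e -> normc z <= e) -> z = 0.
Proof.
move=> h; apply: normc_eq0P; apply/eqP; rewrite eq_le normc_ge0 andbT.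
by apply/ler_addgt0Pl => e e0; rewrite addr0 h.
Qed.

End Modulus.

(** * Unconditional sums *)

Section HasSum.
Variable R : realType.
Local Notation C := R[i].
Implicit Type I J : choiceType.

(** An elementary form of the limit in [summability.sum], with a real tolerance; [summability_sumE]
    leads back to the definition of [Theta]. *)
Definition has_sum I (f : I -> C) (s : C) := forall e : R, 0 < e ->
  exists A : {fset I}, forall B : {fset I}, (A `<=` B)%fset ->
    normc (\sum_(i <- B) f i - s) <= e.

(** The bound is a parameter because later estimates need its growth in N. *)
Definition asum_le I (f : I -> C) (K : R) :=
  forall A : {fset I}, \sum_(i <- A) normc (f i) <= K.

Definition asummable I (f : I -> C) := exists K, asum_le f K.

Lemma has_sum_uniq I (f : I -> C) s t : has_sum f s -> has_sum f t -> s = t.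
Proof.
move=> hs ht; apply/eqP; rewrite -subr_eq0; apply/eqP/normc_le0_eps => e e0.
have e2 : 0 < e / 2 by rewrite divr_gt0.
have [A hA] := hs _ e2; have [B hB] := ht _ e2.
have /hA h1 : (A `<=` A `|` B)%fset by rewrite fsubsetUl.
have /hB h2 : (B `<=` A `|` B)%fset by rewrite fsubsetUr.
set S := \sum_(i <- _) _ in h1 h2.
have -> : s - t = (S - t) - (S - s) by ring.
by rewrite (le_trans (ler_normcB _ _)) // [e]splitr lerD.
Qed.

Lemma has_sumD I (f g : I -> C) s t : has_sum f s -> has_sum g t ->
  has_sum (fun i => f i + g i) (s + t).
Proof.
move=> hs ht e e0; have e2 : 0 < e / 2 by rewrite divr_gt0.
have [A hA] := hs _ e2; have [B hB] := ht _ e2.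
exists (A `|` B)%fset => D; rewrite fsubUset => /andP[/hA h1 /hB h2].
rewrite big_split /= opprD addrACA.
by rewrite (le_trans (ler_normcD _ _)) // [e]splitr lerD.
Qed.

Lemma has_sumZ I (f : I -> C) s a : has_sum f s -> has_sum (fun i => a * f i) (a * s).
Proof.
move=> hs e e0; have p : 0 < normc a + 1 by rewrite ltr_wpDl ?normc_ge0.
have [A hA] := hs _ (divr_gt0 e0 p).
exists A => D /hA h; rewrite -mulr_sumr -mulrBr normcM.
apply: (@le_trans _ _ ((normc a + 1) * (e / (normc a + 1)))).
  by rewrite ler_pM ?normc_ge0 ?lerDl.
by rewrite mulrCA divff ?mulr1 // gt_eqF.
Qed.

Lemma has_sum0 I : has_sum (fun _ : I => 0) 0.
Proof.
by move=> e e0; exists fset0 => B _; rewrite big1 // subrr normc0 ltW.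
Qed.

Lemma eq_has_sum I (f g : I -> C) s : f =1 g -> has_sum f s -> has_sum g s.
Proof. by move=> /funext ->. Qed.

Lemma has_sum_finsum I (T : finType) (f : T -> I -> C) (s : T -> C) :
  (forall c, has_sum (f c) (s c)) ->
  has_sum (fun i => \sum_c f c i) (\sum_c s c).
Proof.
move=> h; rewrite -big_enum.
have -> : (fun i => \sum_c f c i) = (fun i => \sum_(c <- enum T) f c i).
  by apply/funext => i; rewrite big_enum.
elim: (enum T) => [|c r IH].
  rewrite big_nil; apply: eq_has_sum (@has_sum0 I) => i; by rewrite big_nil.
rewrite big_cons; apply: eq_has_sum (has_sumD (h c) IH) => i.
by rewrite big_cons.
Qed.

Lemma has_sum_norm I (f : I -> C) s K : asum_le f K -> has_sum f s -> normc s <= K.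
Proof.
move=> hK hs; apply/ler_addgt0Pl => e e0; have [A hA] := hs _ e0.
have := hA A (fsubset_refl _); rewrite normc_distC => h.
rewrite -[s](subrK (\sum_(i <- A) f i)) (le_trans (ler_normcD _ _)) // lerD //.
by rewrite (le_trans (normc_sum _ _ _)).
Qed.

Lemma ler_fsum_sub I (f : I -> R) (A B : {fset I}) : (forall i, 0 <= f i) ->
  (A `<=` B)%fset -> \sum_(i <- A) f i <= \sum_(i <- B) f i.
Proof.
move=> f0 AB; rewrite [X in _ <= X](big_fsetID _ (mem A)) /=.
have -> : [fset x in B | (x \in A)]%fset = A.
  apply/fsetP => x; rewrite !inE /=; case xA: (x \in A); rewrite ?andbT ?andbF //.
  by move/fsubsetP: AB => ->.
by rewrite lerDl sumr_ge0.
Qed.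

Lemma has_sum_real_nneg I (f : I -> R) K : (forall i, 0 <= f i) ->
  (forall A : {fset I}, \sum_(i <- A) f i <= K) ->
  exists s : R, has_sum (fun i => (f i)%:C) s%:C.
Proof.
move=> f0 hK.
pose E : set R := [set x | exists A : {fset I}, x = \sum_(i <- A) f i]%classic.
have hE : has_sup E.
  split; first by exists (\sum_(i <- fset0 : {fset I}) f i), fset0.
  by exists K => x [A ->].
exists (sup E) => e e0.
have [_ [A ->] hA] := sup_adherent e0 hE.
exists A => B AB; rewrite -rmorph_sum -rmorphB normc_real.
have hB : \sum_(i <- B) f i <= sup E by apply: sup_upper_bound => //; exists B.
have hAB := ler_fsum_sub f0 AB.
rewrite ler_norml; apply/andP; split; lra.
Qed.

Lemma has_sum_real I (f : I -> R) K :
  (forall A : {fset I}, \sum_(i <- A) `|f i| <= K) ->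
  exists s : R, has_sum (fun i => (f i)%:C) s%:C.
Proof.
move=> hK.
(* f = (|f| + f) - |f| is a difference of nonnegative families. *)
have [i|A|s hs] := @has_sum_real_nneg I (fun i => `|f i| + f i) (K + K).
- by rewrite -lerBlDr sub0r -normrN ler_norm.
- rewrite big_split lerD // (le_trans _ (hK A)) // ler_sum // => i _.
  exact: ler_norm.
have [i|A|t ht] := @has_sum_real_nneg I (fun i => `|f i|) K => //.
exists (s - t); rewrite rmorphB /= -[- _]mulN1r.
apply: eq_has_sum (has_sumD hs (has_sumZ (-1) ht)) => i.
by rewrite mulN1r -rmorphB addrAC subrr add0r.
Qed.

Lemma asummable_has_sum I (f : I -> C) : asummable f -> exists s, has_sum f s.
Proof.
case=> K hK.
have [A|s hs] := @has_sum_real I (fun i => complex.Re (f i)) K.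
  rewrite (le_trans _ (hK A)) // ler_sum // => i _; exact: ler_Re_normc.
have [A|t ht] := @has_sum_real I (fun i => complex.Im (f i)) K.
  rewrite (le_trans _ (hK A)) // ler_sum // => i _; exact: ler_Im_normc.
exists (s%:C + 'i * t%:C).
by apply: eq_has_sum (has_sumD hs (has_sumZ 'i ht)) => i; rewrite -complexE.
Qed.

Definition csum I (f : I -> C) : C := xget 0 [set s | has_sum f s]%classic.

Lemma csumP I (f : I -> C) : asummable f -> has_sum f (csum f).
Proof.
by move=> /asummable_has_sum[s hs]; apply: (@xgetPex _ 0 [set s | has_sum f s]%classic); exists s.
Qed.

Lemma csumE I (f : I -> C) s : has_sum f s -> csum f = s.
Proof.
move=> h; apply: (has_sum_uniq _ h).
by apply: (@xgetPex _ 0 [set s | has_sum f s]%classic); exists s.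
Qed.

Lemma csumZ I (f : I -> C) a : asummable f -> csum (fun i => a * f i) = a * csum f.
Proof. by move=> h; apply: csumE; apply: has_sumZ; apply: csumP. Qed.

Lemma summability_sumE I (f : I -> C) s :
  has_sum f s -> summability.sum (f : I -> C^o) = s.
Proof.
move=> hs; apply: (@cvg_lim C^o); first exact: norm_hausdorff.
  exact: summability.totally_filter.
move=> S /nbhs_ballP[e /= e0 hS].
suff [A hA] : exists A : {fset I}, forall B : {fset I}, (A `<=` B)%fset ->
    ball (s : C^o) e (summability.partial_sum (f : I -> C^o) B).
  by exists A => // B AB; apply: hS; exact: hA.
(* The radius of a ball in [C^o] is a complex number; being positive, it is real. *)
have -> : e = (complex.Re e)%:C.
  by move: e0; rewrite ltcE /= => /andP[/eqP h _]; clear -h; case: e h => a b /= ->.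
have r0 : 0 < complex.Re e by move: e0; rewrite ltcE /= => /andP[].
have [A hA] := hs (complex.Re e / 2) (divr_gt0 r0 (ltr0n _ 2)).
exists A => B AB; rewrite /ball /= normE ltcR normc_distC.
apply: (@le_lt_trans _ _ (complex.Re e / 2)); last lra.
rewrite /summability.partial_sum -(big_seq_fsetE _ _ xpredT f).
exact: hA.
Qed.

Lemma asummableZ I (f : I -> C) a : asummable f -> asummable (fun i => a * f i).
Proof.
case=> K hK; exists (normc a * K) => A.
under eq_bigr do rewrite normcM.
by rewrite -mulr_sumr ler_wpM2l ?normc_ge0.
Qed.

Lemma asum_le_ge0 I (f : I -> C) K : asum_le f K -> 0 <= K.
Proof. by move/(_ fset0); rewrite big_seq_fset0. Qed.

Lemma asum_le_inj I J (f : I -> C) K (h : J -> I) : injective h ->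
  asum_le f K -> asum_le (fun j => f (h j)) K.
Proof.
move=> hinj hK A; rewrite (le_trans _ (hK (h @` A)%fset)) //.
by rewrite big_imfset //= => x y _ _; exact: hinj.
Qed.

Lemma has_sum_bij I J (f : I -> C) s (h : J -> I) : bijective h ->
  has_sum f s -> has_sum (fun j => f (h j)) s.
Proof.
move=> [g hK gK] hs e e0; have [A hA] := hs _ e0.
exists (g @` A)%fset => B /fsubsetP AB.
have /hA : (A `<=` h @` B)%fset.
  apply/fsubsetP => x xA; rewrite -[x]gK; apply: in_imfset.
  by apply: AB; apply: in_imfset.
by rewrite big_imfset //= => x y _ _; exact: (can_inj hK).
Qed.

Lemma csum_bij I J (f : I -> C) (h : J -> I) : bijective h -> asummable f ->
  csum (fun j => f (h j)) = csum f.
Proof. by move=> hb hf; apply: csumE; apply: has_sum_bij => //; apply: csumP. Qed.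

Lemma sum_fsetM I J (V : nmodType) (F : I -> J -> V) (A : {fset I}) (B : {fset J}) :
  \sum_(u <- (A `*` B)%fset) F u.1 u.2 = \sum_(i <- A) \sum_(j <- B) F i j.
Proof.
rewrite -(big_allpairs (r1 := A) (r2 := B) (F := fun u => F u.1 u.2)) /=.
apply: perm_big; apply: uniq_perm.
- exact: fset_uniq.
- by rewrite allpairs_uniq ?fset_uniq // => -[? ?] [? ?] _ _.
move=> [x y]; rewrite in_fsetM /=.
by apply/andP/allpairsP => [[h1 h2]|[[? ?] /= [h1 h2 [-> ->]]]] //; exists (x, y).
Qed.

(** For a finite set [P] of rows, one common finite set of columns brings every row within [d] of
    its sum, and can be enlarged until the rectangle contains the set [A] on which the double sum is
    already close to S. The successor in [d] covers an empty [P]. *)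
Lemma has_sum_pair I J (F : I -> J -> C) (s : I -> C) S :
  (forall i, has_sum (F i) (s i)) ->
  has_sum (fun u : I * J => F u.1 u.2) S -> has_sum s S.
Proof.
move=> hF hS e e0; have e2 : 0 < e / 2 by rewrite divr_gt0.
have [A hA] := hS _ e2.
exists (fst @` A)%fset => P hP.
pose d := e / 2 / (size P).+1%:R.
have d0 : 0 < d by rewrite divr_gt0.
have /boolp.choice[Q hQ] : forall i, exists Q : {fset J}, forall B : {fset J},
    (Q `<=` B)%fset -> normc (\sum_(j <- B) F i j - s i) <= d.
  by move=> i; exact: (hF i _ d0).
pose B := ((snd @` A) `|` \bigcup_(i <- P) Q i)%fset.
have hAB : (A `<=` P `*` B)%fset.
  apply/fsubsetP => -[x y] xyA; rewrite in_fsetM /=; apply/andP; split.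
    by apply: (fsubsetP hP); apply/imfsetP; exists (x, y).
  by rewrite in_fsetU; apply/orP; left; apply/imfsetP; exists (x, y).
have := hA _ hAB; rewrite (sum_fsetM (fun i j => F i j)) => h1.
have h2 : normc (\sum_(i <- P) (\sum_(j <- B) F i j - s i)) <= e / 2.
  rewrite (le_trans (normc_sum _ _ _)) //.
  apply: (@le_trans _ _ (\sum_(i <- P) d)).
    rewrite big_seq [X in _ <= X]big_seq ler_sum // => i iP; apply: hQ.
    rewrite (fsubset_trans _ (fsubsetUr _ _)) //.
    by apply/fsubsetP => x xQ; apply/bigfcupP; exists i; rewrite ?iP.
  rewrite big_const_seq count_predT iter_addr_0 -[d *+ _]mulr_natr /d.
  by rewrite mulrAC ler_pdivrMr ?ltr0n // ler_pM2l // ler_nat.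
move: h1 h2; rewrite sumrB; set X := \sum_(i <- _) \sum_(j <- _) _.
set Y := \sum_(i <- _) _ => h1 h2.
have -> : Y - S = (X - S) - (X - Y) by ring.
by rewrite (le_trans (ler_normcB _ _)) // [e]splitr lerD.
Qed.

Lemma asummable_section I J (F : I -> J -> C) i :
  asummable (fun u : I * J => F u.1 u.2) -> asummable (F i).
Proof.
case=> K hK; exists K; apply: (@asum_le_inj _ _ _ _ (fun j => (i, j))) hK.
by move=> x y [].
Qed.

Lemma csum_pair I J (F : I -> J -> C) :
  asummable (fun u : I * J => F u.1 u.2) ->
  csum (fun u : I * J => F u.1 u.2) = csum (fun i => csum (F i)).
Proof.
move=> h; apply/esym/csumE; apply: (@has_sum_pair _ _ F); last exact: csumP.
by move=> i; apply: csumP; apply: asummable_section h.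
Qed.

Lemma asum_le_prod I J (f : I -> C) (g : J -> C) K L : asum_le f K -> asum_le g L ->
  asum_le (fun u : I * J => f u.1 * g u.2) (K * L).
Proof.
move=> hf hg A.
have AB : (A `<=` (fst @` A) `*` (snd @` A))%fset.
  apply/fsubsetP => -[x y] h; rewrite in_fsetM /=.
  by apply/andP; split; apply/imfsetP; exists (x, y).
apply: le_trans (ler_fsum_sub _ AB) _ => [i|]; first exact: normc_ge0.
rewrite (sum_fsetM (fun i j => normc (f i * g j))).
under eq_bigr do (under eq_bigr do rewrite normcM; rewrite -mulr_sumr).
rewrite -mulr_suml ler_pM ?sumr_ge0 // => *; exact: normc_ge0.
Qed.

Lemma csum_prod I J (f : I -> C) (g : J -> C) : asummable f -> asummable g ->
  csum (fun u : I * J => f u.1 * g u.2) = csum f * csum g.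
Proof.
move=> hf hg; rewrite (csum_pair (F := fun i j => f i * g j)).
  under eq_fun do rewrite csumZ // mulrC.
  by rewrite csumZ // mulrC.
by case: hf hg => K hK [L hL]; exists (K * L); apply: asum_le_prod.
Qed.

End HasSum.

(** * Quadratic estimates for the exponential *)

Section CircleExp.
Variable R : realType.
Local Notation C := R[i].
Implicit Types (x y : R) (z w : C).

Lemma sin_le x : 0 <= x -> sin x <= x /\ x - sin x <= x ^+ 2.
Proof.
move=> x0.
have cosx (c : R) : 0 <= c -> 1 - cos c <= c.
  move=> c0; have [d] := @MVT_segment _ cos (fun t => - sin t) 0 c c0
    (fun t _ => is_derive_cos t) (continuous_subspaceT (@continuous_cos R)).
  rewrite in_itv /= => /andP[d0 dc]; rewrite cos0 subr0 => h.
  have hs : sin d <= 1 := sin_le1 d.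
  have : sin d * c <= 1 * c by rewrite ler_wpM2r.
  lra.
have [d] := @MVT_segment _ sin cos 0 x x0
    (fun t _ => is_derive_sin t) (continuous_subspaceT (@continuous_sin R)).
rewrite in_itv /= => /andP[d0 dx]; rewrite sin0 !subr0 => ->.
have h1 := cos_le1 d; have h2 := cosx d d0.
split; first by rewrite ler_piMl.
nra.
Qed.

Lemma sin_normle x : `|sin x| <= `|x| /\ `|sin x - x| <= x ^+ 2.
Proof.
wlog x0 : x / 0 <= x => [hw|].
  have [/hw //|x0] := leP 0 x.
  have [|h1 h2] := hw (- x); first by rewrite oppr_ge0 ltW.
  move: h1 h2; rewrite sinN !normrN sqrrN => h1 h2; split => //.
  by rewrite -normrN opprD.
have [h1 h2] := sin_le x0.
split; last by rewrite distrC ger0_norm // subr_ge0.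
rewrite (ger0_norm x0) ler_norml h1 andbT.
have [x1|x1] := leP x 1; first nra.
have := sin_geN1 x; lra.
Qed.

Lemma cos_dist1 x : `|cos x - 1| <= x ^+ 2.
Proof.
have -> : x = (x / 2) *+ 2 by rewrite -mulr_natr mulfVK ?pnatr_eq0.
set y := x / 2; rewrite cos_mulr2n cos2sin2.
have [h _] := sin_normle y.
have -> : (1 - sin y ^+ 2) *+ 2 - 1 - 1 = - (sin y ^+ 2 *+ 2) by ring.
rewrite normrN ger0_norm ?mulrn_wge0 ?sqr_ge0 //.
have : sin y ^+ 2 <= y ^+ 2 by rewrite -(real_normK (num_real (sin y))) -(real_normK (num_real y)) lerXn2r ?nnegrE.
have -> : (y *+ 2) ^+ 2 = 2 * y ^+ 2 + 2 * y ^+ 2 by ring.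
have := sqr_ge0 y; lra.
Qed.

Lemma expR_dist x : `|expR x - 1| <= expR `|x| * `|x| /\
  `|expR x - 1 - x| <= expR `|x| * `|x| ^+ 2.
Proof.
have h1 := expR_ge1Dx x; have h2 := expR_ge1Dx (- x).
have p := expR_gt0 x; have hx : expR x * expR (- x) = 1 by rewrite -expRD subrr expR0.
have h3 : expR x - 1 <= x * expR x by nra.
have [x0|x0] := leP 0 x.
  rewrite !ger0_norm //; [|lra|lra]; split; first lra.
  rewrite expr2; nra.
rewrite (ltr0_norm x0) (@ler0_norm _ (expR x - 1)); last nra.
rewrite (@ger0_norm _ (expR x - 1 - x)); last lra.
have p1 : 1 <= expR (- x) by rewrite -expR0 ler_expR; lra.
split; first nra.
rewrite sqrrN; apply: (@le_trans _ _ (x ^+ 2)); nra.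
Qed.

Lemma cexpD z w : cexp (z + w) = cexp z * cexp w.
Proof.
case: z => a b; case: w => c d; rewrite /cexp /= expRD cosD sinD.
apply/eqP; rewrite eq_complex /=; apply/andP; split; apply/eqP; ring.
Qed.

(** The real and the imaginary part of the remainder split into two terms each, and each of the four
    is at most e^N N^2 with N = |z|. *)
Lemma cexp_dist z : normc (cexp z - 1 - z) <= 4 * expR (normc z) * normc z ^+ 2.
Proof.
case: z => x y; set N := normc (x +i* y).
have hx : `|x| <= N := ler_Re_normc (x +i* y).
have hy : `|y| <= N := ler_Im_normc (x +i* y).
have N0 : 0 <= N by exact: normc_ge0.
apply: (le_trans (ler_normc_ReIm _)); rewrite /cexp /= !mul0r subr0 addr0.
have [e1 e2] := expR_dist x; have [s1 s2] := sin_normle y; have c1 := cos_dist1 y.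
have E1 : expR x <= expR N by rewrite ler_expR (le_trans (ler_norm _)).
have E2 : expR `|x| <= expR N by rewrite ler_expR.
have E0 := expR_ge0 x.
have x2 : `|x| ^+ 2 <= N ^+ 2 by rewrite lerXn2r ?nnegrE.
have y2 : y ^+ 2 <= N ^+ 2 by rewrite -(real_normK (num_real y)) lerXn2r ?nnegrE.
have EN := expR_ge0 N.
have a1 : `|expR x - 1 - x| <= expR N * N ^+ 2.
  by rewrite (le_trans e2) // ler_pM ?expR_ge0 ?exprn_ge0.
have a2 : `|expR x * (cos y - 1)| <= expR N * N ^+ 2.
  by rewrite normrM (ger0_norm E0) ler_pM // (le_trans c1).
have a3 : `|expR x * (sin y - y)| <= expR N * N ^+ 2.
  by rewrite normrM (ger0_norm E0) ler_pM // (le_trans s2).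
have a4 : `|(expR x - 1) * y| <= expR N * N ^+ 2.
  rewrite normrM (le_trans (ler_pM _ _ e1 hy)) // ?mulr_ge0 ?expR_ge0 //.
  by rewrite expr2 mulrA ler_wpM2r // ler_pM ?expR_ge0.
have -> : expR x * cos y - 1 - x = (expR x - 1 - x) + expR x * (cos y - 1) by ring.
have -> : expR x * sin y - 0 - y =
  expR x * (sin y - y) + (expR x - 1) * y by ring.
have b1 := ler_normD (expR x - 1 - x) (expR x * (cos y - 1)).
have b2 := ler_normD (expR x * (sin y - y)) ((expR x - 1) * y).
lra.
Qed.

Definition twopii : C := 0 +i* (2 * pi).

Lemma eeD z w : ee (z + w) = ee z * ee w.
Proof. by rewrite /ee mulrDr cexpD. Qed.

Lemma eeE z : ee z = (expR (- (2 * pi * complex.Im z)))%:C *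
  (cos (2 * pi * complex.Re z) +i* sin (2 * pi * complex.Re z)).
Proof. by case: z => a b; rewrite /ee /cexp /= !mul0r sub0r add0r. Qed.

Lemma ee0 : ee 0 = 1 :> C.
Proof. by rewrite eeE /= !mulr0 oppr0 expR0 cos0 sin0 mul1r. Qed.

Lemma eeMNK z : ee z * ee (- z) = 1.
Proof. by rewrite -eeD subrr ee0. Qed.

Lemma ee_neq0 z : ee z != 0.
Proof. by apply/eqP => h; have := eeMNK z; rewrite h mul0r => /esym/eqP; rewrite oner_eq0. Qed.

Lemma eeN z : ee (- z) = (ee z)^-1.
Proof. by rewrite -[RHS]mul1r -(eeMNK z) mulrC mulKf ?ee_neq0. Qed.

Lemma eeX z n : ee z ^+ n = ee (z *+ n).
Proof. by elim: n => [|n IH]; rewrite ?mulr0n ?ee0 // exprS mulrS eeD IH. Qed.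

Lemma ee_nat n : ee n%:R = 1 :> C.
Proof.
rewrite -[n%:R]/(1 *+ n) -eeX eeE /= mulr0 oppr0 expR0 mulr1 mul1r.
by rewrite mulr_natl cos2pi sin2pi expr1n.
Qed.

Lemma ee_int (m : int) : ee m%:~R = 1 :> C.
Proof.
by case: (intP m) => [|n|n]; rewrite ?rmorphN /= ?eeN -?pmulrn ?ee_nat ?invr1.
Qed.

Lemma ee_congr z w (m : int) : z = w + m%:~R -> ee z = ee w.
Proof. by move=> ->; rewrite eeD ee_int mulr1. Qed.

Lemma normc_ee z : normc (ee z) = expR (- (2 * pi * complex.Im z)).
Proof.
rewrite eeE normcM normc_real ger0_norm ?expR_ge0 //.
by rewrite /= cos2Dsin2 sqrtr1 mulr1.
Qed.

Lemma ee_real_conj x : (ee x%:C)^* = ee (- x%:C).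
Proof.
rewrite !eeE /= oppr0 mulr0 oppr0 expR0 mulrN cosN sinN.
by apply/eqP; rewrite eq_complex /= !mul1r !mul0r !subr0 !addr0 !eqxx.
Qed.

Lemma normc_twopii : normc twopii = 2 * pi.
Proof.
rewrite /normc /= expr0n /= add0r sqrtr_sqr ger0_norm //.
by rewrite mulr_ge0 // pi_ge0.
Qed.

Lemma ee_dist2 : exists2 K : R, 0 < K &
  forall z, normc (ee z - 1 - twopii * z) <= K * expR (K * normc z) * normc z ^+ 2.
Proof.
have p : 2 <= pi :> R := pi_ge2 R.
(* The factor in front is the larger demand; it also dominates the exponent 2 pi, because pi >=
   2. *)
exists (4 * (2 * pi) ^+ 2); first by rewrite mulr_gt0 ?exprn_gt0; lra.
move=> z; rewrite (le_trans (cexp_dist _)) // normcM normc_twopii exprMn.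
have E : expR (2 * pi * normc z) <= expR (4 * (2 * pi) ^+ 2 * normc z).
  rewrite ler_expR ler_wpM2r ?normc_ge0 // expr2; nra.
have -> : 4 * expR (2 * pi * normc z) * ((2 * pi) ^+ 2 * normc z ^+ 2) =
  4 * (2 * pi) ^+ 2 * expR (2 * pi * normc z) * normc z ^+ 2 by ring.
rewrite ler_wpM2r ?exprn_ge0 ?normc_ge0 // ler_wpM2l // mulr_ge0 // exprn_ge0 //; lra.
Qed.

Lemma ee_period1 x : normc (1 - ee x%:C) ^+ 2 = 2 * (1 - cos (2 * pi * x)).
Proof.
rewrite normc_sq eeE /= mulr0 oppr0 expR0 !mul1r !mul0r addr0 subr0 sub0r sqrrN.
have := cos2Dsin2 (2 * pi * x); lra.
Qed.

End CircleExp.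

Opaque ee twopii.

(** * Bilinear forms *)

Section Dot.
Variables (A : comNzRingType) (d : nat).
Implicit Types (u v w : 'rV[A]_d) (S : 'M[A]_d).

Lemma dotE v w : dot v w = \sum_i v 0 i * w 0 i.
Proof. by rewrite /dot mxE; apply: eq_bigr => i _; rewrite mxE. Qed.

Lemma dotC v w : dot v w = dot w v.
Proof. by rewrite !dotE; apply: eq_bigr => i _; rewrite mulrC. Qed.

Lemma dotDl u v w : dot (u + v) w = dot u w + dot v w.
Proof. by rewrite /dot mulmxDl mxE. Qed.

Lemma dotDr u v w : dot w (u + v) = dot w u + dot w v.
Proof. by rewrite dotC dotDl !(dotC w). Qed.

Lemma dotZl a u w : dot (a *: u) w = a * dot u w.
Proof. by rewrite /dot -scalemxAl mxE. Qed.

Lemma dotZr a u w : dot w (a *: u) = a * dot w u.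
Proof. by rewrite dotC dotZl dotC. Qed.

Lemma dotNl u w : dot (- u) w = - dot u w.
Proof. by rewrite -scaleN1r dotZl mulN1r. Qed.

Lemma dotNr u w : dot w (- u) = - dot w u.
Proof. by rewrite dotC dotNl dotC. Qed.

Lemma dotBl u v w : dot (u - v) w = dot u w - dot v w.
Proof. by rewrite dotDl dotNl. Qed.

Lemma dotBr u v w : dot w (u - v) = dot w u - dot w v.
Proof. by rewrite dotDr dotNr. Qed.

Lemma dot0l w : dot 0 w = 0.
Proof. by rewrite /dot mul0mx mxE. Qed.

Lemma dot0r w : dot w 0 = 0.
Proof. by rewrite dotC dot0l. Qed.

Lemma dot_mxl S v w : dot (v *m S) w = dot v (w *m S^T).
Proof. by rewrite /dot trmx_mul trmxK mulmxA. Qed.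

Lemma dot_sym S v w : S^T = S -> dot (v *m S) w = dot (w *m S) v.
Proof. by move=> h; rewrite dot_mxl h dotC. Qed.

Definition qform S v := dot (v *m S) v.

Lemma qformD S u v : S^T = S ->
  qform S (u + v) = qform S u + dot (u *m S) v *+ 2 + qform S v.
Proof.
move=> h; rewrite /qform mulmxDl dotDl !dotDr (dot_sym v u h).
by rewrite mulr2n; ring.
Qed.

End Dot.

Lemma dot_map (A B : comNzRingType) (f : {rmorphism A -> B}) (d : nat) (v w : 'rV[A]_d) :
  dot (map_mx f v) (map_mx f w) = f (dot v w).
Proof.
by rewrite !dotE rmorph_sum; apply: eq_bigr => i _; rewrite !mxE rmorphM.
Qed.

Lemma ler_sum_uniq (R : numDomainType) (T : eqType) (f : T -> R) (s t : seq T) :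
  (forall x, 0 <= f x) -> uniq s -> {subset s <= t} ->
  \sum_(x <- s) f x <= \sum_(x <- t) f x.
Proof.
move=> f0; elim: s t => [|x s IH] t /=; first by rewrite big_nil sumr_ge0.
move=> /andP[xs us] st.
have xt : x \in t by apply: st; rewrite mem_head.
rewrite big_cons (perm_big _ (perm_to_rem xt)) big_cons lerD2l; apply: IH => // y ys.
have : y \in t by apply: st; rewrite inE ys orbT.
rewrite (perm_mem (perm_to_rem xt)) inE => /orP[/eqP yx|//].
by move: xs; rewrite -yx ys.
Qed.

(** * A product majorant and its lattice sums *)

Section Domination.
Variables (R : realType) (d : nat).
Local Notation C := R[i].
Implicit Types (u : 'rV[R]_d) (v w : 'rV[C]_d) (p j : 'rV[int]_d).

Definition cvec u : 'rV[C]_d := map_mx (real_complex R) u.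

Definition ivec p : 'rV[C]_d := map_mx intr p.

Definition lattice_pt (N : nat) j : 'rV[R]_d := N%:R^-1 *: map_mx intr j.

Definition norm1 v : R := \sum_i normc (v 0 i).

(** The majorant that replaces the Gaussian in all summability arguments: rational, and a product
    over coordinates, so that its lattice sums reduce to dimension one. *)
Definition decay u : R := \prod_i (1 + u 0 i ^+ 2)^-1.

Lemma norm1_ge0 v : 0 <= norm1 v.
Proof. by rewrite sumr_ge0 // => i _; exact: normc_ge0. Qed.

Lemma norm1D v w : norm1 (v + w) <= norm1 v + norm1 w.
Proof. by rewrite -big_split ler_sum // => i _; rewrite mxE ler_normcD. Qed.

Lemma norm1Z a v : norm1 (a *: v) = normc a * norm1 v.
Proof. by rewrite mulr_sumr; apply: eq_bigr => i _; rewrite mxE normcM. Qed.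

Lemma decay_ge0 u : 0 <= decay u.
Proof. by rewrite prodr_ge0 // => i _; rewrite invr_ge0 addr_ge0 ?sqr_ge0. Qed.

Definition mxnorm (S : 'M[C]_d) : R := \sum_i \sum_j normc (S i j).

Lemma mxnorm_ge0 S : 0 <= mxnorm S.
Proof. by rewrite sumr_ge0 // => i _; rewrite sumr_ge0 // => j _; exact: normc_ge0. Qed.

Lemma dot_mx_le S v w : normc (dot (v *m S) w) <= mxnorm S * norm1 v * norm1 w.
Proof.
have le1 (x : 'rV[C]_d) i : normc (x 0 i) <= norm1 x.
  rewrite /norm1 (bigD1 i) //= lerDl sumr_ge0 // => k _; exact: normc_ge0.
rewrite dotE (le_trans (normc_sum _ _ _)) // -mulrA.
apply: (@le_trans _ _ (\sum_i \sum_j normc (S j i) * (norm1 v * norm1 w))).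
  apply: ler_sum => i _; rewrite normcM mxE.
  rewrite (le_trans (ler_wpM2r (normc_ge0 _) (normc_sum _ _ _))) // mulr_suml.
  apply: ler_sum => j _; rewrite normcM.
  have -> : normc (v 0 j) * normc (S j i) * normc (w 0 i) =
    normc (S j i) * (normc (v 0 j) * normc (w 0 i)) by ring.
  by rewrite ler_wpM2l ?normc_ge0 // ler_pM ?normc_ge0.
rewrite exchange_big /= [leRHS]mulr_suml; apply: ler_sum => i _.
by rewrite [leRHS]mulr_suml lexx.
Qed.

(** Completing the square absorbs the linear term at the price of half of the Gaussian; the other
    half pays for 1 + t^2 <= (1 + 2/a) e^(a t^2 / 2). *)
Lemma gauss_decay1 (a b : R) : 0 < a -> 0 <= b ->
  exists2 M : R, 0 < M &
    forall t, expR (- a * t ^+ 2 + b * `|t|) <= M * (1 + t ^+ 2)^-1.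
Proof.
move=> a0 b0; exists ((1 + 2 / a) * expR (b ^+ 2 / (2 * a))).
  by rewrite mulr_gt0 ?expR_gt0 // addr_gt0 // divr_gt0.
move=> t; have t2 : 0 < 1 + t ^+ 2 by rewrite ltr_pwDl ?sqr_ge0.
rewrite ler_pdivlMr //.
have h1 : - a * t ^+ 2 + b * `|t| <= b ^+ 2 / (2 * a) - a / 2 * t ^+ 2.
  have e : b ^+ 2 / (2 * a) - a / 2 * t ^+ 2 - (- a * t ^+ 2 + b * `|t|) =
    (a * `|t| - b) ^+ 2 / (2 * a).
    by rewrite -[t ^+ 2]real_normK ?num_real //; field; rewrite gt_eqF.
  by rewrite -subr_ge0 e divr_ge0 ?sqr_ge0 // mulr_ge0 // ltW.
have h2 : 1 + t ^+ 2 <= (1 + 2 / a) * expR (a / 2 * t ^+ 2).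
  apply: (@le_trans _ _ ((1 + 2 / a) * (1 + a / 2 * t ^+ 2))); last first.
    by rewrite ler_wpM2l ?expR_ge1Dx // addr_ge0 // divr_ge0 // ltW.
  have -> : (1 + 2 / a) * (1 + a / 2 * t ^+ 2) = 1 + t ^+ 2 + a / 2 * t ^+ 2 + 2 / a.
    by field; rewrite gt_eqF.
  have : 0 <= a / 2 * t ^+ 2 by rewrite mulr_ge0 ?sqr_ge0 // divr_ge0 // ltW.
  have : 0 <= 2 / a by rewrite divr_ge0 // ltW.
  lra.
apply: (@le_trans _ _ (expR (b ^+ 2 / (2 * a) - a / 2 * t ^+ 2) *
   ((1 + 2 / a) * expR (a / 2 * t ^+ 2)))).
  by rewrite ler_pM ?expR_ge0 ?(ltW t2) // ler_expR.
by rewrite mulrCA -expRD subrK.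
Qed.

Lemma sum_decay_nat (N L : nat) : (0 < N)%N ->
  \sum_(0 <= n < L) (1 + (n%:R / N%:R) ^+ 2)^-1 <= 4 * N%:R :> R.
Proof.
move=> N0; have n0 : 0 < N%:R :> R by rewrite ltr0n.
(* Telescoping: each term is at most 4 N^2 (1/(N + n) - 1/(N + n + 1)), since (N + n)(N + n + 1) <=
   4 (N^2 + n^2) for N >= 1. *)
apply: (@le_trans _ _ (4 * N%:R ^+ 2 * (N%:R^-1 - (N + L)%:R^-1))); last first.
  rewrite mulrBr lerBlDr expr2 -!mulrA mulfV ?gt_eqF // mulr1.
  by rewrite lerDl !mulr_ge0 // invr_ge0.
elim: L => [|L IH]; first by rewrite big_nil addn0 subrr mulr0.
rewrite big_nat_recr //=; apply: (le_trans (lerD IH (lexx _))).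
have -> : (N + L.+1)%:R = N%:R + L%:R + 1 :> R by rewrite addnS -natr1 natrD.
rewrite natrD; move: n0; set a : R := N%:R; set b : R := L%:R => n0.
have b0 : 0 <= b by rewrite ler0n.
have m1 : 1 <= a by rewrite ler1n.
have ab : 0 < a + b by lra.
have -> : (1 + (b / a) ^+ 2)^-1 = a ^+ 2 / (a ^+ 2 + b ^+ 2).
  by field; rewrite !gt_eqF //; nra.
have e : 4 * a ^+ 2 * (a^-1 - (a + b + 1)^-1) - 4 * a ^+ 2 * (a^-1 - (a + b)^-1)
  - a ^+ 2 / (a ^+ 2 + b ^+ 2) =
  a ^+ 2 * (4 * (a ^+ 2 + b ^+ 2) - (a + b) * (a + b + 1)) /
    ((a + b) * (a + b + 1) * (a ^+ 2 + b ^+ 2)).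
  by field; rewrite !gt_eqF //; nra.
rewrite -lerBrDl -subr_ge0 e divr_ge0 //.
  rewrite mulr_ge0 ?sqr_ge0 //; have := sqr_ge0 (a - b); nra.
by rewrite !mulr_ge0 ?addr_ge0 ?sqr_ge0 // ltW.
Qed.

Lemma sum_decay_int (N : nat) (B : {fset int}) : (0 < N)%N ->
  \sum_(k <- B) (1 + ((k%:~R : R) / N%:R) ^+ 2)^-1 <= 8 * N%:R.
Proof.
move=> N0; pose f (n : nat) : R := (1 + (n%:R / N%:R) ^+ 2)^-1.
have f0 n : 0 <= f n by rewrite invr_ge0 addr_ge0 ?sqr_ge0.
have fE (k : int) : (1 + ((k%:~R : R) / N%:R) ^+ 2)^-1 = f (absz k).
  rewrite /f !exprMn; congr (_^-1); congr (_ + _ * _).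
  by rewrite -[_%:R]/((absz k)%:Z%:~R) abszE intr_norm real_normK ?num_real.
(* The absolute value is injective on each of the two half-lines, so each contributes at most 4
   N. *)
have key (P : pred int) : {in P &, injective absz} ->
    \sum_(k <- B | P k) f (absz k) <= 4 * N%:R.
  move=> Pinj; rewrite -big_filter -(big_map absz xpredT f).
  pose s := [seq absz i | i <- B & P i].
  apply: (le_trans _ (sum_decay_nat (\max_(n <- s) n).+1 N0)).
  rewrite /index_iota subn0; apply: ler_sum_uniq => //.
    rewrite map_inj_in_uniq ?filter_uniq ?fset_uniq // => x y.
    by rewrite !mem_filter => /andP[xP _] /andP[yP _]; exact: Pinj.
  by move=> n ns; rewrite mem_iota /= add0n ltnS; apply: leq_bigmax_seq.
under eq_bigr do rewrite fE.
rewrite (bigID (fun k : int => 0 <= k)) /=.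
have -> : 8 * N%:R = 4 * N%:R + 4 * N%:R :> R by ring.
apply: lerD; apply: key => x y; rewrite -!topredE /=; lia.
Qed.

(** The finite set A is enclosed in the cube over the set of all its coordinates, where a sum of
    products is a product of sums. The growth N^d is that of a Riemann sum of mesh 1/N before
    normalisation. *)
Lemma sum_decay : exists2 S : R, 0 < S & forall (N : nat) (A : {fset 'rV[int]_d}),
  (0 < N)%N -> \sum_(j <- A) decay (lattice_pt N j) <= S * N%:R ^+ d.
Proof.
exists (8 ^+ d); first by rewrite exprn_gt0.
move=> N A N0; pose f (k : int) : R := (1 + ((k%:~R : R) / N%:R) ^+ 2)^-1.
have f0 k : 0 <= f k by rewrite invr_ge0 addr_ge0 ?sqr_ge0.
have fE j : decay (lattice_pt N j) = \prod_i f (j 0 i).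
  by apply: eq_bigr => i _; rewrite !mxE mulrC.
pose B := (\bigcup_(j <- A) [fset j 0 i | i : 'I_d])%fset.
have AB j i : j \in A -> j 0 i \in B.
  by move=> jA; apply/bigfcupP; exists j; rewrite ?jA //; apply/imfsetP; exists i.
rewrite -exprMn.
pose r (g : {ffun 'I_d -> B}) : 'rV[int]_d := \row_i val (g i).
apply: (@le_trans _ _ (\sum_(j <- map r (enum {ffun 'I_d -> B})) decay (lattice_pt N j))).
  apply: ler_sum_uniq; [by move=> j; exact: decay_ge0|exact: fset_uniq|].
  move=> j jA; apply/mapP; exists [ffun i => [` AB j i jA]%fset].
    by rewrite mem_enum.
  by apply/rowP => i; rewrite mxE ffunE.
rewrite big_map big_enum /=.
have -> : \sum_(g : {ffun 'I_d -> B}) decay (lattice_pt N (r g)) =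
    \sum_(g : {ffun 'I_d -> B}) \prod_i f (val (g i)).
  by apply: eq_bigr => g _; rewrite fE; apply: eq_bigr => i _; rewrite mxE.
rewrite -(bigA_distr_bigA (fun _ (b : B) => f (val b))) /=.
rewrite prodr_const card_ord -(big_seq_fsetE _ _ xpredT f).
by rewrite lerXn2r ?nnegrE ?sumr_ge0 ?mulr_ge0 // sum_decay_int.
Qed.

End Domination.

Ltac nneg := by repeat first
  [ done | exact: ltW | apply: addr_ge0 | apply: mulr_ge0 | apply: exprn_ge0
  | exact: expR_ge0 | exact: decay_ge0 | exact: norm1_ge0 | exact: normc_ge0 ].

(** * Gaussian estimates *)

Section Gauss.
Variables (R : realType) (d : nat).
Local Notation C := R[i].
Implicit Types (u : 'rV[R]_d) (v w x y : 'rV[C]_d) (p j : 'rV[int]_d) (S : 'M[C]_d).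

Definition gauss S x : C := ee (2^-1 * qform S x).

Lemma gaussD S x y : S^T = S ->
  gauss S (x + y) = gauss S x * ee (dot (x *m S) y + 2^-1 * qform S y).
Proof.
move=> h; rewrite /gauss -eeD qformD // -mulr_natr; congr ee; by field.
Qed.

Definition Im_coercive S (c : R) :=
  0 < c /\ forall u, c * \sum_i u 0 i ^+ 2 <= complex.Im (qform S (cvec u)).

Lemma ImD (z1 z2 : C) : complex.Im (z1 + z2) = complex.Im z1 + complex.Im z2.
Proof. by case: z1; case: z2. Qed.

Lemma Im_realM (a : R) (z : C) : complex.Im (a%:C * z) = a * complex.Im z.
Proof. by case: z => x y; rewrite /= mul0r addr0. Qed.

Lemma half_real : (2^-1 : C) = (2^-1 : R)%:C.
Proof. by rewrite rmorphV ?unitfE ?pnatr_eq0 // rmorph_nat. Qed.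

Lemma normc_gauss S x : normc (gauss S x) = expR (- (pi * complex.Im (qform S x))).
Proof.
rewrite /gauss normc_ee half_real Im_realM; congr (expR (- _)); by field.
Qed.

Opaque gauss.

Variables (S : 'M[C]_d) (c : R).
Hypotheses (symS : S^T = S) (coeS : Im_coercive S c).

Lemma norm1_cvec u : norm1 (cvec u) = \sum_i `|u 0 i|.
Proof. by apply: eq_bigr => i _; rewrite mxE normc_real. Qed.

(** The weight [expR (L * norm1 (cvec u))] is a reserve: in the Taylor estimate the increment of the
    exponent grows linearly in u and is then exponentiated. *)
Lemma gauss_decay (B L : R) : 0 <= B -> 0 <= L -> exists2 K, 0 < K &
  forall u v, norm1 v <= B ->
    normc (gauss S (cvec u + v)) * expR (L * norm1 (cvec u)) <= K * decay u.
Proof.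
move=> B0 L0; have [c0 hc] := coeS.
have p0 : 0 < pi :> R := pi_gt0 R.
pose s := mxnorm S; have s0 : 0 <= s := mxnorm_ge0 S.
have a0 : 0 < pi * c by rewrite mulr_gt0.
have b0 : 0 <= 2 * pi * s * B + L by rewrite addr_ge0 // !mulr_ge0 // ltW.
have [M M0 hM] := gauss_decay1 a0 b0.
exists (expR (pi * s * B ^+ 2) * M ^+ d); first by rewrite mulr_gt0 ?expR_gt0 ?exprn_gt0.
move=> u v vB; set n := norm1 (cvec u).
have n0 : 0 <= n := norm1_ge0 _.
have v0 : 0 <= norm1 v := norm1_ge0 _.
have h1 : complex.Im (qform S (cvec u)) - 2 * s * n * B - s * B ^+ 2 <=
   complex.Im (qform S (cvec u + v)).
  rewrite qformD // mulr2n !ImD.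
  have := ler_Im_normc (dot (cvec u *m S) v); rewrite ler_norml => /andP[i1 _].
  have := ler_Im_normc (qform S v); rewrite ler_norml => /andP[i2 _].
  have k1 : normc (dot (cvec u *m S) v) <= s * n * B.
    by rewrite (le_trans (dot_mx_le _ _ _)) // ler_wpM2l // mulr_ge0.
  have k2 : normc (qform S v) <= s * B ^+ 2.
    rewrite (le_trans (dot_mx_le _ _ _)) // expr2 mulrA ler_pM //.
      by rewrite mulr_ge0.
    by rewrite ler_wpM2l.
  have -> : 2 * s * n * B = s * n * B + s * n * B by ring.
  have aux (m1 m2 n1 n2 a1 a2 f : R) : - n1 <= m1 -> - n2 <= m2 -> n1 <= a1 ->
    n2 <= a2 -> f - (a1 + a1) - a2 <= f + (m1 + m1) + m2 by clear; move=> *; lra.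
  exact: (aux _ _ _ _ _ _ _ i1 i2 k1 k2).
rewrite normc_gauss -expRD.
have h2 := hc u.
have -> : expR (pi * s * B ^+ 2) * M ^+ d * decay u =
   expR (pi * s * B ^+ 2) * \prod_i (M * (1 + u 0 i ^+ 2)^-1).
  by rewrite big_split /= prodr_const card_ord -[LHS]mulrA.
apply: (@le_trans _ _ (expR (pi * s * B ^+ 2) *
   \prod_i expR (- (pi * c) * u 0 i ^+ 2 + (2 * pi * s * B + L) * `|u 0 i|))); last first.
  rewrite ler_wpM2l ?expR_ge0 // ler_prod // => i _.
  by rewrite expR_ge0 hM.
rewrite -expR_sum -expRD ler_expR big_split /= -!mulr_sumr.
rewrite -norm1_cvec -/n.
have h3 : pi * (c * \sum_i u 0 i ^+ 2 - 2 * s * n * B - s * B ^+ 2) <=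
   pi * complex.Im (qform S (cvec u + v)).
  by rewrite ler_wpM2l ?(ltW p0) // (le_trans _ h1) // !lerD2r.
set Q := complex.Im _ in h3 *.
set W := \sum_i _ in h3 *.
rewrite -subr_ge0.
have -> : pi * s * B ^+ 2 + (- (pi * c) * W + (2 * pi * s * B + L) * n) -
  (- (pi * Q) + L * n) = pi * Q - pi * (c * W - 2 * s * n * B - s * B ^+ 2).
  by ring.
by rewrite subr_ge0.
Qed.

Lemma gauss_decay0 (B : R) : 0 <= B -> exists2 K, 0 < K &
  forall u v, norm1 v <= B -> normc (gauss S (cvec u + v)) <= K * decay u.
Proof.
move=> B0; have [K K0 hK] := gauss_decay B0 (lexx 0).
by exists K => // u v /(hK u); rewrite mul0r expR0 mulr1.
Qed.

(* Second order Taylor bound, uniform in the real part [u] of the base point. *)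
Lemma gauss_taylor (B r : R) : 0 <= B -> 0 <= r -> exists2 K, 0 < K &
  forall u v w, norm1 v <= B -> norm1 w <= r ->
    normc (gauss S (cvec u + v + w) - gauss S (cvec u + v)
       - gauss S (cvec u + v) * (twopii R * dot ((cvec u + v) *m S) w))
    <= K * norm1 w ^+ 2 * decay u.
Proof.
move=> B0 r0; have [K1 K10 hK1] := ee_dist2 R.
pose s := mxnorm S; have s0 : 0 <= s := mxnorm_ge0 S.
pose T := s * (B + r).
have T0 : 0 <= T by rewrite mulr_ge0 ?addr_ge0.
(* With |z| <= (s n + T) q, the summand [K1 * s * r] pays for [expR (K1 * normc z)] and [2 * s] for
   [normc z ^+ 2]. *)
pose L := K1 * s * r + 2 * s + 1.
have L0 : 0 <= L by rewrite !addr_ge0 ?mulr_ge0 // ltW.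
have [K K0 hK] := gauss_decay B0 L0.
have p0 : 0 < pi :> R := pi_gt0 R.
exists ((K1 * expR (K1 * T * r) * (1 + T) ^+ 2 + 2 * pi * s) * K).
  rewrite mulr_gt0 // ltr_pwDl //; last nneg.
  by rewrite mulr_gt0 ?exprn_gt0 ?mulr_gt0 ?expR_gt0 // ltr_pwDl.
move=> u v w vB wr; set x := cvec u + v.
have nx : norm1 x <= norm1 (cvec u) + B.
  by rewrite (le_trans (norm1D _ _)) // lerD2l.
set n := norm1 (cvec u) in nx; have n0 : 0 <= n := norm1_ge0 _.
set q := norm1 w in wr *; have q0 : 0 <= q := norm1_ge0 _.
have x0 : 0 <= norm1 x := norm1_ge0 _.
pose z := dot (x *m S) w + 2^-1 * qform S w.
have nQ : normc (2^-1 * qform S w) <= s * q ^+ 2.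
  have hQ : normc (qform S w) <= s * q ^+ 2.
    by rewrite (le_trans (dot_mx_le _ _ _)) // expr2 mulrA.
  rewrite normcM normcV.
  have -> : normc (2 : C) = 2 by rewrite -(rmorph_nat (real_complex R)) normc_real ger0_norm.
  have := normc_ge0 (qform S w); lra.
have nz : normc z <= (s * n + T) * q.
  rewrite (le_trans (ler_normcD _ _)) //.
  have h1 : normc (dot (x *m S) w) <= s * (n + B) * q.
    by rewrite (le_trans (dot_mx_le _ _ _)) // -/q ler_wpM2r // ler_wpM2l.
  have h2 : s * q ^+ 2 <= s * r * q.
    by rewrite expr2 mulrA ler_wpM2r // ler_wpM2l.
  rewrite /T; lra.
have z0 : 0 <= normc z := normc_ge0 _.
have sn : 0 <= s * n by rewrite mulr_ge0.
have -> : gauss S (x + w) - gauss S x - gauss S x * (twopii R * dot (x *m S) w) =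
   gauss S x * ((ee z - 1 - twopii R * z) + twopii R * (2^-1 * qform S w)).
  by rewrite gaussD // -/z /z; ring.
rewrite normcM.
have e1 : normc (ee z - 1 - twopii R * z) <=
   K1 * expR (K1 * T * r) * (1 + T) ^+ 2 * q ^+ 2 * expR (L * n).
  apply: (le_trans (hK1 z)).
  have -> : L * n = K1 * s * r * n + (2 * (s * n) + n) by rewrite /L; ring.
  rewrite expRD.
  have g1 : expR (K1 * normc z) <= expR (K1 * T * r) * expR (K1 * s * r * n).
    rewrite -expRD ler_expR -!mulrA -mulrDr ler_wpM2l ?(ltW K10) //.
    have -> : s * ((B + r) * r) + s * (r * n) = (s * n + T) * r by rewrite /T; ring.
    by rewrite (le_trans nz) // ler_wpM2l // addr_ge0.
  have g2 : normc z ^+ 2 <= (1 + T) ^+ 2 * q ^+ 2 * expR (2 * (s * n) + n).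
    have g3 : s * n + T <= (1 + T) * expR (s * n).
      have := expR_ge1Dx (s * n) => g.
      have : T * 1 <= T * expR (s * n) by rewrite ler_wpM2l //; lra.
      lra.
    apply: (@le_trans _ _ (((1 + T) * expR (s * n) * q) ^+ 2)).
      rewrite lerXn2r ?nnegrE ?mulr_ge0 ?expR_ge0 ?addr_ge0 //.
      by rewrite (le_trans nz) // ler_wpM2r.
    have -> : ((1 + T) * expR (s * n) * q) ^+ 2 = (1 + T) ^+ 2 * q ^+ 2 * expR (2 * (s * n)).
      by rewrite expRM_natl; ring.
    by rewrite ler_wpM2l ?mulr_ge0 ?exprn_ge0 ?addr_ge0 // ler_expR lerDl.
  have := ler_pM (expR_ge0 _) (exprn_ge0 2 z0) g1 g2.
  rewrite -(ler_pM2l K10); lra.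
have e2 : normc (twopii R * (2^-1 * qform S w)) <= 2 * pi * s * q ^+ 2 * expR (L * n).
  have -> : 2 * pi * s * q ^+ 2 * expR (L * n) = 2 * pi * (s * q ^+ 2 * expR (L * n)).
    by ring.
  rewrite normcM normc_twopii ler_wpM2l ?mulr_ge0 ?(ltW p0) //.
  rewrite (le_trans nQ) // ler_peMr ?mulr_ge0 ?exprn_ge0 //.
  by rewrite -[leLHS]expR0 ler_expR mulr_ge0.
have e3 := hK u v vB; rewrite -/x -/n in e3.
set A := K1 * expR (K1 * T * r) * (1 + T) ^+ 2 in e1 *.
set g := normc (gauss S x) in e3 *.
have g0 : 0 <= g := normc_ge0 _.
apply: (@le_trans _ _ (g * ((A + 2 * pi * s) * q ^+ 2 * expR (L * n)))).
  rewrite ler_wpM2l // (le_trans (ler_normcD _ _)) //; lra.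
have A0 : 0 <= A by rewrite /A; nneg.
have -> : (A + 2 * pi * s) * K * q ^+ 2 * decay u = (A + 2 * pi * s) * q ^+ 2 * (K * decay u) by ring.
have -> : g * ((A + 2 * pi * s) * q ^+ 2 * expR (L * n)) =
  (A + 2 * pi * s) * q ^+ 2 * (g * expR (L * n)) by ring.
by rewrite ler_wpM2l //; nneg.
Qed.

Lemma gauss_lipschitz (B r : R) : 0 <= B -> 0 <= r -> exists2 K, 0 < K &
  forall u v w, norm1 v <= B -> norm1 w <= r ->
    normc (gauss S (cvec u + v + w) - gauss S (cvec u + v)) <= K * norm1 w * decay u.
Proof.
move=> B0 r0; have [K1 K10 hK1] := gauss_taylor B0 r0.
pose s := mxnorm S; have s0 : 0 <= s := mxnorm_ge0 S.
have [K K0 hK] := gauss_decay B0 (ler01 : 0 <= (1 : R)).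
have p0 : 0 < pi :> R := pi_gt0 R.
exists (K1 * r + 2 * pi * s * (1 + B) * K + 1).
  by rewrite ltr_wpDl //; nneg.
move=> u v w vB wr; have := hK1 u v w vB wr; have := hK u v vB.
set x := cvec u + v.
have nx : norm1 x <= norm1 (cvec u) + B.
  by rewrite (le_trans (norm1D _ _)) // lerD2l.
set n := norm1 (cvec u) in nx *; have n0 : 0 <= n := norm1_ge0 _.
set q := norm1 w in wr *; have q0 : 0 <= q := norm1_ge0 _.
rewrite mul1r => h1 h2.
have -> : gauss S (x + w) - gauss S x = (gauss S (x + w) - gauss S x -
   gauss S x * (twopii R * dot (x *m S) w)) + gauss S x * (twopii R * dot (x *m S) w).
  by rewrite subrK.
rewrite (le_trans (ler_normcD _ _)) // !mulrDl.
have D0 := decay_ge0 u.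
have e1 : K1 * q ^+ 2 * decay u <= K1 * r * q * decay u.
  by rewrite ler_wpM2r // expr2 mulrA ler_wpM2r // ler_wpM2l // ltW.
have e2 : normc (gauss S x * (twopii R * dot (x *m S) w)) <=
   2 * pi * s * (1 + B) * K * q * decay u.
  rewrite normcM [normc (twopii R * _)]normcM normc_twopii.
  have f1 : normc (dot (x *m S) w) <= s * ((1 + B) * expR n) * q.
    rewrite (le_trans (dot_mx_le _ _ _)) // -/q ler_wpM2r // ler_wpM2l //.
    rewrite (le_trans nx) //; have := expR_ge1Dx n => g.
    have : B * 1 <= B * expR n by rewrite ler_wpM2l //; lra.
    lra.
  set g := normc (gauss S x) in h1 *.
  have g0 : 0 <= g := normc_ge0 _.
  apply: (@le_trans _ _ (g * (2 * pi * (s * ((1 + B) * expR n) * q)))).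
    by rewrite ler_wpM2l // ler_wpM2l // mulr_ge0 // ltW.
  have -> : g * (2 * pi * (s * ((1 + B) * expR n) * q)) =
    2 * pi * s * (1 + B) * q * (g * expR n) by ring.
  have -> : 2 * pi * s * (1 + B) * K * q * decay u = 2 * pi * s * (1 + B) * q * (K * decay u) by ring.
  by rewrite ler_wpM2l //; nneg.
have : 0 <= q * decay u by rewrite mulr_ge0.
lra.
Qed.

End Gauss.

(** * Riemann sums of the Gaussian *)

Section GaussLattice.
Variables (R : realType) (d : nat).
Local Notation C := R[i].
Implicit Types (u : 'rV[R]_d) (v w x y z : 'rV[C]_d) (p j m n : 'rV[int]_d).
Variables (S : 'M[C]_d) (c : R).
Hypotheses (symS : S^T = S) (coeS : Im_coercive S c).

Lemma ivecD p j : ivec R (p + j) = ivec R p + ivec R j.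
Proof. exact: map_mxD. Qed.

Lemma ivecB p j : ivec R (p - j) = ivec R p - ivec R j.
Proof. exact: map_mxB. Qed.

Lemma ivecZ k p : ivec R (k *: p) = k%:~R *: ivec R p.
Proof. exact: map_mxZ. Qed.

Lemma cvec_lattice_pt N j : (0 < N)%N -> cvec (lattice_pt R N j) = N%:R^-1 *: ivec R j.
Proof.
move=> N0; apply/rowP => i; rewrite !mxE rmorphM rmorphV ?rmorph_nat ?rmorph_int //.
by rewrite unitfE pnatr_eq0 -lt0n.
Qed.

Definition gpt N v j := gauss S (N%:R^-1 *: ivec R j + v).

Definition gsum N v : C := csum (gpt N v).

Lemma asum_le_decay : exists2 D : R, 0 < D & forall N (f : 'rV[int]_d -> C) K,
  (0 < N)%N -> 0 <= K ->
  (forall j, normc (f j) <= K * decay (lattice_pt R N j)) ->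
  asum_le f (K * (D * N%:R ^+ d)).
Proof.
have [D D0 hD] := sum_decay R d; exists D => // N f K N0 K0 h A.
apply: (@le_trans _ _ (\sum_(j <- A) K * decay (lattice_pt R N j))).
  by apply: ler_sum => j _; exact: h.
by rewrite -mulr_sumr ler_wpM2l // hD.
Qed.

Lemma gpt_asum_le (B : R) : 0 <= B -> exists2 K, 0 < K &
  forall N v, (0 < N)%N -> norm1 v <= B -> asum_le (gpt N v) (K * N%:R ^+ d).
Proof.
move=> B0; have [D D0 hD] := asum_le_decay.
have [K K0 hK] := gauss_decay0 symS coeS B0.
exists (K * D); first by rewrite mulr_gt0.
move=> N v N0 vB; rewrite -mulrA; apply: hD => //; first exact: ltW.
by move=> j; rewrite /gpt -cvec_lattice_pt // hK.
Qed.

Lemma gpt_asummable N v : (0 < N)%N -> asummable (gpt N v).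
Proof.
move=> N0; have [K K0 hK] := gpt_asum_le (norm1_ge0 v).
by exists (K * N%:R ^+ d); exact: hK.
Qed.

Lemma gsumP N v : (0 < N)%N -> has_sum (gpt N v) (gsum N v).
Proof. by move=> N0; apply: csumP; exact: gpt_asummable. Qed.

Lemma has_sumB (I : choiceType) (f g : I -> C) s t : has_sum f s -> has_sum g t ->
  has_sum (fun i => f i - g i) (s - t).
Proof.
move=> hs ht; rewrite -mulN1r; apply: eq_has_sum (has_sumD hs (has_sumZ (-1) ht)) => i.
by rewrite mulN1r.
Qed.

Lemma bij_addr m : bijective (fun j : 'rV[int]_d => j + m).
Proof. by exists (fun j => j - m) => j; rewrite ?addrK ?subrK. Qed.

Lemma gsum_period N v m : (0 < N)%N -> gsum N (v + N%:R^-1 *: ivec R m) = gsum N v.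
Proof.
move=> N0; have E : gpt N (v + N%:R^-1 *: ivec R m) = fun j => gpt N v (j + m).
  apply/funext => j; rewrite /gpt ivecD scalerDr; congr (gauss S _).
  by rewrite -[RHS]addrA; congr (_ + _); exact: addrC.
by rewrite /gsum E; apply: csum_bij; [exact: bij_addr|exact: gpt_asummable].
Qed.

Lemma normc_natV N : (0 < N)%N -> normc (N%:R^-1 : C) = N%:R^-1.
Proof.
move=> N0; rewrite normcV -(rmorph_nat (real_complex R)) normc_real ger0_norm //.
Qed.

Lemma gsum_lipschitz (B r : R) : 0 <= B -> 0 <= r -> exists2 K, 0 < K &
  forall v w, norm1 v <= B -> norm1 w <= r ->
    normc (gsum 1 (v + w) - gsum 1 v) <= K * norm1 w.
Proof.
move=> B0 r0; have [D D0 hD] := asum_le_decay.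
have [K K0 hK] := gauss_lipschitz symS coeS B0 r0.
exists (K * D); first by rewrite mulr_gt0.
move=> v w vB wr.
apply: (@has_sum_norm _ _ _ _ _ _ (has_sumB (gsumP (v + w) _) (gsumP v _))) => //.
rewrite mulrAC -[D]mulr1 -(expr1n _ d).
apply: (hD 1%N) => //; first by rewrite mulr_ge0 ?norm1_ge0 // ltW.
by move=> j; rewrite /gpt -cvec_lattice_pt // addrA hK.
Qed.

(** A shift by w/N costs one order less than expected. The linear Taylor term in w is the
    combination, with coefficients w_i, of the linear terms in the basis vectors e_i; the shifts by
    e_i/N merely permute the lattice, so their linear terms sum to something of second order. This
    works for complex w, although only real lattice shifts are symmetries. *)
Lemma gsum_step w (B : R) : 0 <= B -> exists2 K, 0 < K &
  forall N v, (0 < N)%N -> norm1 v <= B ->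
    normc (gsum N (v + N%:R^-1 *: w) - gsum N v) <= K * N%:R ^- 2 * N%:R ^+ d.
Proof.
move=> B0; have [D D0 hD] := asum_le_decay.
pose e i : 'rV[int]_d := delta_mx 0 i.
pose r := norm1 w + \sum_i norm1 (ivec R (e i)).
have r0 : 0 <= r by rewrite addr_ge0 ?norm1_ge0 // sumr_ge0 // => i _; exact: norm1_ge0.
have re i : norm1 (ivec R (e i)) <= r.
  rewrite /r (bigD1 i) //= addrCA lerDl addr_ge0 ?norm1_ge0 // sumr_ge0 // => k _.
  exact: norm1_ge0.
have rw_ : norm1 w <= r by rewrite lerDl sumr_ge0 // => i _; exact: norm1_ge0.
have [K K0 hK] := gauss_taylor symS coeS B0 r0.
pose W := 1 + \sum_i normc (w 0 i).
have W0 : 0 < W by rewrite ltr_pwDl // sumr_ge0 // => i _; exact: normc_ge0.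
exists (W * K * r ^+ 2 * D + 1); first by rewrite ltr_wpDl //; nneg.
move=> N v N0 vB; pose h : C := N%:R^-1.
have nh : normc h = N%:R^-1 by exact: normc_natV.
have h1 : N%:R^-1 <= 1 :> R by rewrite invf_le1 ?ler1n ?ltr0n.
have T1 w' : norm1 w' <= r -> forall j,
   normc (gpt N (v + h *: w') j - gpt N v j -
     gpt N v j * (twopii R * (h * dot ((N%:R^-1 *: ivec R j + v) *m S) w')))
   <= K * (N%:R ^- 2 * r ^+ 2) * decay (lattice_pt R N j).
  move=> wr j; have hw : norm1 (h *: w') <= r.
    by rewrite norm1Z nh (le_trans _ wr) // ler_piMl ?norm1_ge0.
  have := hK (lattice_pt R N j) v (h *: w') vB hw.
  rewrite cvec_lattice_pt // dotZr /gpt addrA => g.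
  apply: (le_trans g); rewrite ler_wpM2r ?decay_ge0 // ler_wpM2l ?(ltW K0) //.
  rewrite norm1Z nh exprMn exprVn ler_wpM2l ?invr_ge0 ?exprn_ge0 //.
  by rewrite lerXn2r ?nnegrE ?norm1_ge0.
have dotw y : dot y w = \sum_i w 0 i * dot y (ivec R (e i)).
  rewrite dotE; apply: eq_bigr => i _; rewrite mulrC; congr (_ * _).
  rewrite dotE (bigD1 i) //= big1 ?addr0 => [|k ki].
    by rewrite !mxE !eqxx mulr1.
  by rewrite !mxE (negbTE ki) andbF mulr0.
pose F j := (gpt N (v + h *: w) j - gpt N v j) -
   \sum_i w 0 i * (gpt N (v + h *: ivec R (e i)) j - gpt N v j).
have hF : has_sum F (gsum N (v + h *: w) - gsum N v -
   \sum_i w 0 i * (gsum N (v + h *: ivec R (e i)) - gsum N v)).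
  apply: has_sumB; first by apply: has_sumB; exact: gsumP.
  by apply: has_sum_finsum => i; apply: has_sumZ; apply: has_sumB; exact: gsumP.
have FE : gsum N (v + h *: w) - gsum N v -
   \sum_i w 0 i * (gsum N (v + h *: ivec R (e i)) - gsum N v) =
   gsum N (v + h *: w) - gsum N v.
  by rewrite big1 ?subr0 // => i _; rewrite /h gsum_period // subrr mulr0.
rewrite FE in hF.
have bF : asum_le F (W * (K * (N%:R ^- 2 * r ^+ 2)) * (D * N%:R ^+ d)).
  apply: hD => //.
    by rewrite mulr_ge0 ?(ltW W0) // mulr_ge0 ?(ltW K0) // mulr_ge0 ?invr_ge0 ?exprn_ge0.
  move=> j; set M := K * _ in T1 *; set de := decay _.
  pose L w' : C := gpt N v j * (twopii R * (h * dot ((N%:R^-1 *: ivec R j + v) *m S) w')).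
  have -> : F j = (gpt N (v + h *: w) j - gpt N v j - L w) -
     \sum_i w 0 i * (gpt N (v + h *: ivec R (e i)) j - gpt N v j - L (ivec R (e i))).
    have -> : L w = \sum_i w 0 i * L (ivec R (e i)).
      rewrite /L dotw !mulr_sumr; apply: eq_bigr => i _.
      by rewrite [RHS]mulrCA; congr (_ * _); rewrite [RHS]mulrCA; congr (_ * _); rewrite [RHS]mulrCA.
    rewrite /F -[in RHS]addrA; congr (_ + _).
    rewrite -opprD -big_split /=; congr (- _); apply: eq_bigr => i _.
    by rewrite -mulrDr [L _ + _]addrC subrK.
  rewrite (le_trans (ler_normcB _ _)) // /W !mulrDl mul1r lerD //; first exact: T1.
  rewrite (le_trans (normc_sum _ _ _)) // !mulr_suml ler_sum // => i _.
  by rewrite normcM -mulrA ler_wpM2l ?normc_ge0 // T1.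
apply: (le_trans (has_sum_norm bF hF)).
have -> : W * (K * (N%:R ^- 2 * r ^+ 2)) * (D * N%:R ^+ d) =
   W * K * r ^+ 2 * D * N%:R ^- 2 * N%:R ^+ d by ring.
rewrite ler_wpM2r ?exprn_ge0 // ler_wpM2r ?invr_ge0 ?exprn_ge0 //.
by rewrite lerDl.
Qed.

(** The Riemann sum of mesh 1/N that stands for the integral of the Gaussian over v + R^d. *)
Definition gavg N v : C := gsum N v * N%:R ^- d.

(** The point w is reached in N steps of w/N, each of which costs O(1/N^2) after normalisation,
    uniformly because the intermediate points stay within [norm1 w]. This is the substitute for
    moving a contour. *)
Lemma gavg_shift w : exists2 K, 0 < K &
  forall N, (0 < N)%N -> normc (gavg N w - gavg N 0) <= K * N%:R^-1.
Proof.
have [K K0 hK] := gsum_step w (norm1_ge0 w).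
exists K => // N N0; pose h : C := N%:R^-1.
have nN : (N%:R : R) != 0 by rewrite pnatr_eq0 -lt0n.
have nNC : (N%:R : C) != 0 by rewrite pnatr_eq0 -lt0n.
have nh : normc h = N%:R^-1 by exact: normc_natV.
have step (s : nat) : (s <= N)%N ->
   normc (gsum N ((s%:R * h) *: w) - gsum N 0) <= s%:R * (K * N%:R ^- 2 * N%:R ^+ d).
  elim: s => [|s IH] sN; first by rewrite !mul0r scale0r subrr normc0.
  rewrite -natr1 -[in leRHS]natr1 !mulrDl !mul1r scalerDl.
  rewrite -[X in normc X](subrKA (gsum N ((s%:R * h) *: w))).
  rewrite (le_trans (ler_normcD _ _)) // [leRHS]addrC.
  apply: lerD; last exact: IH (ltnW sN).
  apply: hK => //; rewrite norm1Z normcM nh -(rmorph_nat (real_complex R)) normc_real.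
  rewrite ger0_norm // ler_piMl ?norm1_ge0 //.
  by rewrite ler_pdivrMr ?ltr0n // mul1r ler_nat ltnW.
have := step N (leqnn N); rewrite mulfV // scale1r => H.
rewrite /gavg -mulrBl normcM normcV normcX -(rmorph_nat (real_complex R)) normc_real ger0_norm //.
rewrite ler_pdivrMr ?exprn_gt0 ?ltr0n // (le_trans H) //.
rewrite le_eqVlt; apply/orP; left; apply/eqP; by field.
Qed.

Lemma gavg0_bounded : exists2 K, 0 < K & forall N, (0 < N)%N -> normc (gavg N 0) <= K.
Proof.
have [K K0 hK] := gpt_asum_le (lexx 0); exists K => // N N0.
rewrite /gavg normcM normcV normcX -(rmorph_nat (real_complex R)) normc_real ger0_norm //.
rewrite ler_pdivrMr ?exprn_gt0 ?ltr0n //.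
apply: has_sum_norm (gsumP _ N0); apply: hK => //.
by rewrite /norm1 big1 // => i _; rewrite mxE normc0.
Qed.

End GaussLattice.

(** * Residue classes and boxes *)

Section Residues.
Variable R : realType.
Local Notation C := R[i].

Lemma has_sum_fin (T : finType) (s : T -> C) S : has_sum s S -> S = \sum_t s t.
Proof.
move=> h; apply: has_sum_uniq h _ => e e0; exists [fset t | t : T]%fset => B hB.
rewrite (_ : \sum_(i <- B) s i = \sum_t s t) ?subrr ?normc0 ?ltW //.
rewrite -[RHS]big_enum; apply: perm_big; apply: uniq_perm; rewrite ?fset_uniq ?enum_uniq //.
move=> t; rewrite mem_enum; apply: (fsubsetP hB); by apply/imfsetP; exists t.
Qed.

Lemma csum_residues (T : finType) (I J : choiceType) (h : T * J -> I) (f : I -> C) :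
  bijective h -> asummable f -> csum f = \sum_t csum (fun j => f (h (t, j))).
Proof.
move=> hb hf; apply: has_sum_fin; apply: (@has_sum_pair _ _ _ (fun t j => f (h (t, j)))).
  move=> t; apply: csumP; case: hf => K hK; exists K.
  apply: (asum_le_inj (h := fun j => h (t, j))) hK => x y /(bij_inj hb).
  by case.
apply: (@eq_has_sum _ _ (fun u => f (h u))); first by case.
exact: has_sum_bij hb (csumP hf).
Qed.

End Residues.

Section Box.
Variable d : nat.

Definition box_pt M (a : {ffun 'I_d -> 'I_M}) : 'rV[int]_d := \row_i (a i : nat)%:Z.

Lemma box_residues N : bijective
  (fun u : {ffun 'I_d -> 'I_N.+1} * 'rV[int]_d => box_pt u.1 + N.+1%:Z *: u.2).
Proof.
pose g (j : 'rV[int]_d) : {ffun 'I_d -> 'I_N.+1} * 'rV[int]_d :=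
  ([ffun i => inord `|modz (j ord0 i) N.+1|%N], \row_i divz (j ord0 i) N.+1).
have modE (x : int) : (`|(x %% N.+1)%Z|%N)%:Z = (x %% N.+1)%Z.
  by rewrite gez0_abs // modz_ge0.
have modlt (x : int) : (`|(x %% N.+1)%Z| < N.+1)%N.
  by rewrite -ltz_nat modE ltz_pmod.
exists g => [[a p]|j].
  congr pair; first apply/ffunP => i; last apply/rowP => i.
    rewrite ffunE; apply: val_inj; rewrite /= inordK; last exact: modlt.
    rewrite !mxE addrC mulrC modzMDl modz_small //.
    by rewrite lez_nat ltz_nat ltn_ord.
  by rewrite !mxE addrC mulrC divzMDl // divz_small ?addr0 // lez_nat ltz_nat ltn_ord.
apply/rowP => i; rewrite !mxE ffunE inordK ?modlt // modE mulrC.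
by rewrite addrC -divz_eq.
Qed.

(** The factor M on the left avoids the exponent d - 1. *)
Lemma card_coord M (P : pred 'I_M) (i : 'I_d) :
  (#|[set a : {ffun 'I_d -> 'I_M} | P (a i)]| * M = #|P| * M ^ d)%N.
Proof.
pose Q (j : 'I_d) : pred 'I_M := if j == i then P else predT.
have -> : #|[set a : {ffun 'I_d -> 'I_M} | P (a i)]| = #|family Q|.
  apply: eq_card => a; rewrite inE; apply/idP/familyP => [h j|/(_ i)].
    by rewrite /Q; case: eqP => [->|_].
  by rewrite /Q eqxx.
rewrite card_family foldrE big_image /= (bigD1 i) //= {1}/Q eqxx.
rewrite (eq_bigr (fun _ => M)) => [|j ji]; last first.
  by rewrite /Q (negbTE ji) card_ord.
rewrite prod_nat_const cardC1 card_ord -mulnA -expnSr prednK //.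
exact: leq_ltn_trans (leq0n i) (ltn_ord i).
Qed.

End Box.

(** * Fejer means *)

Section Fejer.
Variables (R : realType) (d : nat).
Local Notation C := R[i].
Implicit Types (n m : 'rV[int]_d) (z : 'rV[C]_d).

Lemma dot_ivec n m : dot (ivec R n) (ivec R m) = (dot n m)%:~R.
Proof. exact: (dot_map (@intmul C 1)). Qed.

Lemma ee_unit_neq1 (x : R) : 0 < `|x| < 1 -> ee x%:C != 1.
Proof.
move=> /andP[x0 x1]; apply/eqP => h.
have := ee_period1 x; rewrite h subrr normc0 expr0n /= => /eqP.
rewrite eq_sym mulf_eq0 pnatr_eq0 /= subr_eq0 => /eqP hc.
have p0 : 0 < pi :> R := pi_gt0 R.
have : 0 < sin (pi * `|x|) by apply: sin_gt0_pi; rewrite mulr_gt0 //= gtr_pMr.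
have := cos_mulr2n (pi * `|x|).
have -> : cos (pi * `|x| *+ 2) = cos (2 * pi * x).
  rewrite -cos_norm -[RHS]cos_norm; congr cos.
  by rewrite -mulr_natl mulrA !normrM normr_id.
rewrite -hc cos2sin2 => e s0.
have : sin (pi * `|x|) ^+ 2 = 0 by lra.
by move/eqP; rewrite expf_eq0 /= gt_eqF.
Qed.

Lemma natX_complex (k N e : nat) : (k%:R * N%:R ^+ e : R)%:C = k%:R * N%:R ^+ e :> C.
Proof.
have h (n : nat) : (n%:R : R)%:C = n%:R :> C by rewrite rmorph_nat.
by rewrite -natrX -natrM (h (k * N ^ e)%N) natrM natrX.
Qed.

Lemma natV_complex N : (0 < N)%N -> (N%:R^-1 : C) = (N%:R^-1 : R)%:C.
Proof. by move=> N0; rewrite rmorphV ?rmorph_nat // unitfE pnatr_eq0 -lt0n. Qed.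

Lemma sum_roots N (m : int) : (0 < N)%N -> (`|m| < N)%N ->
  \sum_(t < N) ee ((N%:R^-1 : C) * (m * t)%:~R) = if m == 0 then N%:R else 0.
Proof.
move=> N0 mN; have nN : (N%:R : C) != 0 by rewrite pnatr_eq0 -lt0n.
pose w : C := ee (N%:R^-1 * m%:~R).
have wE (t : nat) : ee ((N%:R^-1 : C) * (m * t)%:~R) = w ^+ t.
  by rewrite /w eeX -[_ *+ t]mulr_natr rmorphM /= mulrA.
under eq_bigr do rewrite wE.
have [m0|m0] := eqVneq m 0.
  have -> : w = 1 by rewrite /w m0 mulr0 ee0.
  by under eq_bigr do rewrite expr1n; rewrite sumr_const card_ord.
have w1 : w != 1.
  have m1 : 0 < `|m%:~R : R| by rewrite normr_gt0 intr_eq0.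
  rewrite /w natV_complex // -(rmorph_int (real_complex R)) -rmorphM; apply: ee_unit_neq1.
  rewrite normrM normfV !normr_nat mulrC divr_gt0 ?ltr0n //=.
  by rewrite ltr_pdivrMr ?ltr0n // mul1r -intr_norm -abszE -pmulrn ltr_nat.
have : (w - 1) * \sum_(t < N) w ^+ t = 0.
  rewrite -subrX1 /w eeX -[_ *+ N]mulr_natr mulrAC mulVf // mul1r ee_int subrr //.
by move/eqP; rewrite mulf_eq0 subr_eq0 (negbTE w1) => /eqP.
Qed.

Lemma sum_characters N n : (0 < N)%N -> (forall i, (`|n ord0 i| < N)%N) ->
  \sum_(k : {ffun 'I_d -> 'I_N}) ee ((N%:R^-1 : C) * (dot n (box_pt k))%:~R) =
  if n == 0 then N%:R ^+ d else 0.
Proof.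
move=> N0 nN.
have E (k : {ffun 'I_d -> 'I_N}) : ee ((N%:R^-1 : C) * (dot n (box_pt k))%:~R) =
   \prod_i ee ((N%:R^-1 : C) * (n ord0 i * (k i : nat))%:~R).
  have -> : (dot n (box_pt k))%:~R = \sum_i (n ord0 i * (k i : nat))%:~R :> C.
    by rewrite dotE rmorph_sum; apply: eq_bigr => i _; rewrite mxE.
  rewrite mulr_sumr (big_morph _ (@eeD R) (ee0 R)) //.
under eq_bigr do rewrite E.
rewrite -(bigA_distr_bigA (fun i (t : 'I_N) => ee ((N%:R^-1 : C) * (n ord0 i * (t : nat))%:~R))) /=.
rewrite (eq_bigr (fun i => if n ord0 i == 0 then N%:R else 0)) => [|i _]; last first.
  exact: sum_roots.
have [->|/eqP n0] := eqVneq n 0.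
  rewrite (eq_bigr (fun _ => N%:R)) => [|i _]; last by rewrite mxE eqxx.
  by rewrite prodr_const card_ord.
have [i ni] : exists i, n ord0 i != 0.
  apply/existsP; rewrite -negb_forall; apply/negP => /forallP h; apply: n0.
  by apply/rowP => i; rewrite mxE; apply/eqP.
by rewrite (bigD1 i) //= (negbTE ni) mul0r.
Qed.

Variables (M N : nat).
Hypotheses (M0 : (0 < M)%N) (MN : (M < N)%N).
Local Notation boxM := {ffun 'I_d -> 'I_M}.
Local Notation boxN := {ffun 'I_d -> 'I_N}.

Definition char (n : 'rV[int]_d) (k : boxN) : C :=
  ee (- ((N%:R^-1 : C) * (dot n (box_pt k))%:~R)).

(** Squared modulus of a Dirichlet kernel with M frequencies per coordinate, sampled at the torsion
    point k/N. As M < N, the differences of frequencies stay below N and orthogonality of characters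
    is exact. *)
Definition fejer (k : boxN) : R := normc (\sum_(a : boxM) char (box_pt a) k) ^+ 2.

Lemma fejer_ge0 k : 0 <= fejer k.
Proof. by rewrite exprn_ge0 // normc_ge0. Qed.

Lemma charE n k : char n k = ee ((- (N%:R^-1 * (dot n (box_pt k))%:~R : R))%:C).
Proof.
rewrite /char natV_complex ?(leq_ltn_trans _ MN) // -(rmorph_int (real_complex R)).
by rewrite -rmorphM -rmorphN.
Qed.

Lemma charB n m k : char (n - m) k = char n k * conjc (char m k).
Proof.
rewrite !charE. rewrite (ee_real_conj (- _)) -rmorphN -eeD -rmorphD; congr (ee _%:C).
rewrite dotBl rmorphB; ring.
Qed.

Lemma charD n m k : char (n + m) k = char n k * char m k.
Proof. by rewrite /char -eeD dotDl rmorphD mulrDr opprD. Qed.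

Lemma fejerE k : (fejer k)%:C = \sum_(a : boxM) \sum_(b : boxM) char (box_pt a - box_pt b) k.
Proof.
have -> : (fejer k)%:C = (\sum_(a : boxM) char (box_pt a) k) * conjc (\sum_(a : boxM) char (box_pt a) k).
  by rewrite -[RHS]sqr_normc normE /fejer rmorphXn.
rewrite mulr_suml; apply: eq_bigr => a _; rewrite rmorph_sum mulr_sumr.
by apply: eq_bigr => b _; rewrite charB.
Qed.

Lemma box_pt_inj : injective (@box_pt d M).
Proof.
move=> a b /rowP h; apply/ffunP => i; apply: val_inj.
by have := h i; rewrite !mxE => -[].
Qed.

Lemma box_diff_lt (a b : boxM) (i : 'I_d) : (`|((box_pt a - box_pt b)%R ord0 i)| < M)%N.
Proof.
rewrite !mxE; have := ltn_ord (a i); have := ltn_ord (b i); lia.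
Qed.

Lemma sum_char n : (forall i, (`|n ord0 i| < N)%N) ->
  \sum_k char n k = if n == 0 then N%:R ^+ d else 0.
Proof.
move=> nN; rewrite -(oppr_eq0 n) -sum_characters ?(leq_ltn_trans _ MN) //.
  by apply: eq_bigr => k _; rewrite /char dotNl rmorphN mulrN.
by move=> i; rewrite mxE abszN.
Qed.

Lemma card_box : #|{: boxM}| = (M ^ d)%N.
Proof. by rewrite card_ffun !card_ord. Qed.

Lemma fejer_sum : \sum_k fejer k = (M ^ d)%:R * N%:R ^+ d.
Proof.
suff : (\sum_k fejer k)%:C = ((M ^ d)%:R * N%:R ^+ d : R)%:C by case.
rewrite rmorph_sum /=; under eq_bigr do rewrite fejerE.
rewrite exchange_big /= (eq_bigr (fun _ => N%:R ^+ d)) => [|a _].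
  by rewrite natX_complex sumr_const card_box mulr_natl.
rewrite exchange_big /= (bigD1 a) //= [X in _ + X]big1 => [|b ba].
  by rewrite subrr addr0 sum_char ?eqxx // => i; rewrite mxE (leq_ltn_trans _ MN).
rewrite sum_char => [|i]; last by rewrite (ltn_trans _ MN) ?box_diff_lt.
by rewrite subr_eq0 (inj_eq box_pt_inj) eq_sym (negbTE ba).
Qed.

(** The cosine is the real part of the character of the basis vector e_i. Orthogonality leaves the
    pairs with b = a + e_i, and only the a with a_i = M - 1, a fraction 1/M of the box, have no
    partner. *)
Lemma fejer_conc (i : 'I_d) :
  M%:R * \sum_k fejer k * (1 - cos (2 * pi * (N%:R^-1 * (k i : nat)%:R))) <=
  (M ^ d)%:R * N%:R ^+ d.
Proof.
pose e : 'rV[int]_d := delta_mx 0 i.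
have N0 : (0 < N)%N := leq_ltn_trans (leq0n _) MN.
have cosE (k : boxN) : cos (2 * pi * (N%:R^-1 * (k i : nat)%:R)) = complex.Re (char e k).
  rewrite charE eeE /= mulr0 oppr0 expR0 mul1r mul0r subr0 mulrN cosN.
  have -> : dot e (box_pt k) = (k i : nat)%:Z.
    rewrite dotE (bigD1 i) //= big1 ?addr0 => [|j ji].
      by rewrite !mxE !eqxx mul1r.
    by rewrite !mxE (negbTE ji) andbF mul0r.
  by [].
pose shift_ok := [set a : boxM | (a i).+1 < M]%N.
pose c (a b : boxM) : nat := (box_pt a - box_pt b + e == 0).
have key : \sum_k fejer k * cos (2 * pi * (N%:R^-1 * (k i : nat)%:R)) =
    (\sum_a \sum_b c a b)%N%:R * N%:R ^+ d.
  suff : (\sum_k fejer k * cos (2 * pi * (N%:R^-1 * (k i : nat)%:R)))%:C =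
     ((\sum_a \sum_b c a b)%N%:R * N%:R ^+ d : R)%:C by case.
  have -> : (\sum_k fejer k * cos (2 * pi * (N%:R^-1 * (k i : nat)%:R)))%:C =
     (complex.Re (\sum_k (fejer k)%:C * char e k))%:C.
    congr (_%:C); rewrite raddf_sum; apply: eq_bigr => k _.
    by rewrite cosE; case: (char e k) => x y /=; rewrite mul0r subr0.
  have -> : \sum_k (fejer k)%:C * char e k = ((\sum_a \sum_b c a b)%N%:R * N%:R ^+ d : R)%:C.
    rewrite natX_complex.
    have -> : \sum_k (fejer k)%:C * char e k =
      \sum_k \sum_(a : boxM) (\sum_(b : boxM) char (box_pt a - box_pt b) k) * char e k.
      by apply: eq_bigr => k _; rewrite -mulr_suml; congr (_ * _); exact: fejerE.
    rewrite exchange_big natr_sum mulr_suml; apply: eq_bigr => a _.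
    under eq_bigr do rewrite mulr_suml.
    rewrite exchange_big natr_sum mulr_suml; apply: eq_bigr => b _.
    under eq_bigr do rewrite -charD.
    rewrite sum_char => [|j]; first by rewrite /c; case: eqP; rewrite ?mul1r ?mul0r.
    have := box_diff_lt a b j; rewrite !mxE; case: eqP => /= _; lia.
  by [].
have cnt : (#|shift_ok| <= \sum_a \sum_b c a b)%N.
  rewrite -sum1_card big_mkcond /=; apply: leq_sum => a _; case: ifP => //.
  rewrite inE => ai.
  pose b : boxM := [ffun j => if j == i then Ordinal ai else a j].
  rewrite (bigD1 b) //= (_ : c a b = 1%N) ?leq_addr // /c.
  rewrite (_ : _ == 0) //; apply/eqP/rowP => j; rewrite !mxE ffunE.
  by case: (eqVneq j i) => [->|ji] /=; [rewrite -addn1 PoszD; lia|lia].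
have bad1 : (#|[pred t : 'I_M | M <= t.+1]| <= 1)%N.
  apply/card_le1_eqP => s t; rewrite !inE => hs ht; apply: val_inj => /=.
  have := ltn_ord s; have := ltn_ord t; lia.
have cntM : (M * M ^ d <= M * (\sum_a \sum_b c a b) + M ^ d)%N.
  have hc := cardsC shift_ok; rewrite card_box in hc; rewrite -{1}hc mulnDr leq_add ?leq_mul2l ?cnt ?orbT //.
  have -> : ~: shift_ok = [set a : boxM | [pred t : 'I_M | M <= t.+1]%N (a i)].
    by apply/setP => a; rewrite !inE -leqNgt.
  by rewrite mulnC card_coord -[leqRHS]mul1n leq_mul2r bad1 orbT.
under eq_bigr do rewrite mulrBr mulr1.
rewrite sumrB key fejer_sum -mulrBl mulrA ler_wpM2r ?exprn_ge0 //.
rewrite mulrBr -!natrM lerBlDl -natrD ler_nat //.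
Qed.

End Fejer.

(** This turns the concentration of the kernel, which is measured by 1 - cos, into closeness to 0.
    Small t are covered by e; for the others 1 - cos is bounded below, cos being decreasing on
    [0, pi]. *)
Lemma le_dist_cos (R : realType) (e : R) : 0 < e -> exists2 K : R, 0 < K &
  forall t : R, `|t| <= 2^-1 -> `|t| <= e + K * (1 - cos (2 * pi * t)).
Proof.
move=> e0; pose h := Num.min e 2^-1.
have p0 : 0 < pi :> R := pi_gt0 R.
have h0 : 0 < h by rewrite lt_min e0 invr_gt0 ltr0n.
have hE : h <= e by rewrite ge_min lexx.
have h2 : h <= 2^-1 by rewrite ge_min lexx orbT.
have inpi (s : R) : 0 <= s -> s <= 2^-1 -> 2 * pi * s \in `[0, pi].
  move=> s0 s2; rewrite in_itv /= !mulr_ge0 ?(ltW p0) //=.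
  have -> : 2 * pi * s = pi * (2 * s) by ring.
  by rewrite ger_pMr //; lra.
have c0 : 0 < 1 - cos (2 * pi * h).
  have i0 : (0 : R) \in `[0, pi] by rewrite in_itv /= lexx ltW.
  rewrite subr_gt0 -[ltRHS]cos0 (ltr_cos i0 (inpi _ (ltW h0) h2)).
  by rewrite !mulr_gt0.
exists (1 - cos (2 * pi * h))^-1; first by rewrite invr_gt0.
move=> t t2; have [th|th] := leP `|t| h.
  rewrite (le_trans th) // (le_trans hE) // lerDl.
  by apply: mulr_ge0; rewrite ?invr_ge0 ?(ltW c0) // subr_ge0 cos_le1.
have ct : cos (2 * pi * `|t|) = cos (2 * pi * t).
  rewrite -[RHS]cos_norm; congr cos.
  by rewrite normrM [Num.norm (2 * pi)]ger0_norm // mulr_ge0 // ltW.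
have : cos (2 * pi * `|t|) < cos (2 * pi * h).
  rewrite (ltr_cos (inpi _ (ltW h0) h2) (inpi _ (normr_ge0 t) t2)).
  by rewrite ltr_pM2l // mulr_gt0.
rewrite ct => hc; apply: (le_trans t2).
have : 1 <= (1 - cos (2 * pi * h))^-1 * (1 - cos (2 * pi * t)).
  by rewrite ler_pdivlMl // mulr1 lerB // ltW.
lra.
Qed.

Lemma cos_period_int (R : realType) (t : R) (m : int) :
  cos (2 * pi * (t + m%:~R)) = cos (2 * pi * t).
Proof.
have h (s : R) : cos (2 * pi * s) = complex.Re (ee s%:C).
  by rewrite eeE /= mulr0 oppr0 expR0 mul1r mul0r subr0.
rewrite !h; congr complex.Re; apply: (@ee_congr _ _ _ m).
by rewrite rmorphD /= rmorph_int.
Qed.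

Lemma card_ord_sub M (A : {set 'I_M}) p r :
  (forall t : 'I_M, t \in A -> (p <= t < p + r)%N) -> (#|A| <= r)%N.
Proof.
move=> h; rewrite cardE -(size_map val) -[leqRHS](size_iota p).
apply: uniq_leq_size; first by rewrite map_inj_uniq ?enum_uniq //; exact: val_inj.
by move=> x /mapP[t]; rewrite mem_enum => /h ht ->; rewrite mem_iota.
Qed.

Section BoxAverage.
Variables (R : realType) (d : nat).
Local Notation C := R[i].

(** If a stays at distance r from the faces of the box, the differences a - b run through a set
    containing all indices that matter, and the inner sum is close to s. The other a are at most a
    fraction 2 r d / M, and there the error is bounded by 2 K. *)
Lemma box_average (f : 'rV[int]_d -> C) s : asummable f -> has_sum f s ->
  forall e : R, 0 < e -> exists M0 : nat, forall M, (M0 < M)%N ->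
  normc ((\sum_(a : {ffun 'I_d -> 'I_M}) \sum_(b : {ffun 'I_d -> 'I_M})
     f (box_pt a - box_pt b)) / (M ^ d)%:R - s) <= e.
Proof.
move=> [K hK] hs e e0; have e2 : 0 < e / 2 by rewrite divr_gt0.
have K0 : 0 <= K := asum_le_ge0 hK.
have [A hA] := hs _ e2.
pose r := (\max_(n <- A) \max_i `|n ord0 i|)%N.
have hr n i : n \in A -> (`|n ord0 i| <= r)%N.
  move=> nA; apply: (@leq_trans (\max_i `|n ord0 i|)); first exact: leq_bigmax.
  by rewrite /r; apply: leq_bigmax_seq.
pose Q := 8 * K * d%:R * r.+1%:R / e.
have Q0 : 0 <= Q by rewrite divr_ge0 ?mulr_ge0 // ltW.
exists (Num.bound Q) => M MQ.
have M0 : (0 < M)%N by exact: leq_ltn_trans MQ.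
have QM : Q <= M%:R.
  have := archi_boundP Q0 => h; apply: (le_trans (ltW h)); rewrite ler_nat; exact: ltnW.
pose bad (t : 'I_M) := ((t < r) || (M - r <= t))%N.
pose g (a : {ffun 'I_d -> 'I_M}) := \sum_(b : {ffun 'I_d -> 'I_M}) f (box_pt a - box_pt b) - s.
have gT (a : {ffun 'I_d -> 'I_M}) : exists T : {fset 'rV[int]_d}, g a = \sum_(n <- T) f n - s /\
    forall n, (exists b : {ffun 'I_d -> 'I_M}, n = box_pt a - box_pt b) -> n \in T.
  pose h (b : {ffun 'I_d -> 'I_M}) := box_pt a - box_pt b.
  have hinj : injective h by move=> b b' /addrI /oppr_inj; exact: box_pt_inj.
  exists [fset h b | b : {ffun 'I_d -> 'I_M}]%fset; split.
    rewrite /g big_imfset /=; last by move=> b b' _ _; exact: hinj.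
    by rewrite big_enum.
  by move=> n [b ->]; apply/imfsetP; exists b.
have gbad (a : {ffun 'I_d -> 'I_M}) : normc (g a) <= 2 * K.
  have [T [-> _]] := gT a; rewrite (le_trans (ler_normcB _ _)) //.
  have := has_sum_norm hK hs; have := le_trans (normc_sum T xpredT f) (hK T).
  lra.
have ggood (a : {ffun 'I_d -> 'I_M}) : (forall i, ~~ bad (a i)) -> normc (g a) <= e / 2.
  move=> ha; have [T [-> hT]] := gT a; apply: hA; apply/fsubsetP => n nA; apply: hT.
  have hb i : (`|(a i : nat)%:Z - n ord0 i| < M)%N.
    have := ha i; rewrite /bad negb_or -!ltnNge => /andP[]; have := hr n i nA.
    have := ltn_ord (a i); lia.
  exists [ffun i => Ordinal (hb i)]; apply/rowP => i; rewrite !mxE ffunE /= -[n 0 i]/(n ord0 i).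
  have := ha i; rewrite /bad negb_or -!ltnNge => /andP[]; have := hr n i nA.
  have := ltn_ord (a i); lia.
have gle (a : {ffun 'I_d -> 'I_M}) : normc (g a) <= e / 2 + \sum_i (bad (a i))%:R * (2 * K).
  have [/existsP[i hi]|] := boolP [exists i, bad (a i)].
    rewrite (bigD1 i) //= hi mul1r (le_trans (gbad a)) // addrCA lerDl.
    by rewrite addr_ge0 ?(ltW e2) // sumr_ge0 // => j _; rewrite !mulr_ge0.
  rewrite negb_exists => /forallP h; rewrite (le_trans (ggood a h)) // lerDl.
  by rewrite sumr_ge0 // => j _; rewrite !mulr_ge0.
have Md0 : 0 < (M ^ d)%:R :> R by rewrite ltr0n expn_gt0 M0.
have -> : (\sum_(a : {ffun 'I_d -> 'I_M}) \sum_(b : {ffun 'I_d -> 'I_M})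
    f (box_pt a - box_pt b)) / (M ^ d)%:R - s = (\sum_a g a) / (M ^ d)%:R.
  rewrite /g sumrB sumr_const card_ffun !card_ord mulrBl -[s *+ _]mulr_natr mulfK //.
  by rewrite pnatr_eq0 -lt0n expn_gt0 M0.
rewrite normcM normcV -(rmorph_nat (real_complex R)) normc_real (ger0_norm (ltW Md0)).
rewrite ler_pdivrMr // (le_trans (normc_sum _ _ _)) //.
apply: (le_trans (ler_sum _ (fun a _ => gle a))).
rewrite big_split /= sumr_const card_ffun !card_ord exchange_big /=.
have cb i : \sum_(a : {ffun 'I_d -> 'I_M}) (bad (a i))%:R * (2 * K) <=
   (2 * r)%:R / M%:R * (M ^ d)%:R * (2 * K).
  rewrite -mulr_suml ler_wpM2r ?mulr_ge0 // -natr_sum.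
  have -> : (\sum_(a : {ffun 'I_d -> 'I_M}) bad (a i) = #|[set a : {ffun 'I_d -> 'I_M} | bad (a i)]|)%N.
    rewrite -sum1_card [RHS]big_mkcond /=; apply: eq_bigr => a _; rewrite inE; by case: (bad _).
  rewrite mulrAC ler_pdivlMr ?ltr0n // -!natrM ler_nat card_coord leq_mul2r.
  apply/orP; right.
  have -> : #|bad| = #|[set t | bad t]| by apply: eq_card => t; rewrite inE.
  have sub : [set t | bad t] \subset [set t : 'I_M | t < r]%N :|: [set t : 'I_M | M - r <= t]%N.
    by apply/fintype.subsetP => t; rewrite !inE.
  apply: (leq_trans (subset_leq_card sub)); apply: (leq_trans (leq_card_setU _ _)).
  rewrite mul2n -addnn leq_add //.
    apply: (@card_ord_sub _ _ 0) => t; rewrite inE; lia.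
  apply: (@card_ord_sub _ _ (M - r)) => t; rewrite inE; have := ltn_ord t; lia.
apply: (@le_trans _ _ (e / 2 *+ M ^ d + \sum_(i < d) (2 * r)%:R / M%:R * (M ^ d)%:R * (2 * K))).
  by rewrite lerD2l; apply: ler_sum => i _; exact: cb.
rewrite sumr_const card_ord -mulr_natr -[X in _ + X]mulr_natr.
have -> : (2 * r)%:R / M%:R * (M ^ d)%:R * (2 * K) * d%:R =
  (4 * K * d%:R * r%:R / M%:R) * (M ^ d)%:R :> R.
  by rewrite natrM; ring.
rewrite -mulrDl ler_wpM2r ?(ltW Md0) //.
have Mr0 : 0 < M%:R :> R by rewrite ltr0n.
suff : 4 * K * d%:R * r%:R / M%:R <= e / 2 by lra.
rewrite ler_pdivrMr //; move: QM; rewrite /Q ler_pdivrMr // -natr1.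
have : 0 <= K * d%:R by rewrite mulr_ge0.
lra.
Qed.

End BoxAverage.

Lemma qformE (A : comNzRingType) (d : nat) (S : 'M[A]_d) v : qform S v = dot (v *m S) v.
Proof. by []. Qed.

Lemma gsumE (R : realType) (d : nat) (S : 'M[R[i]]_d) N v : gsum S N v = csum (gpt S N v).
Proof. by []. Qed.

Lemma gavgE (R : realType) (d : nat) (S : 'M[R[i]]_d) N v :
  gavg S N v = gsum S N v * N%:R ^- d.
Proof. by []. Qed.

Opaque dot qform csum gsum gavg.

(** Elimination of [I0], a Riemann sum that varies with N and has no known limit: only the cross
    product of two approximations survives. *)
Lemma cross_le (R : realType) (F B F1 B1 I0 : R[i]) (e : R) : 0 <= e ->
  normc (F - I0 * B) <= e / (normc B1 + normc B + 1) ->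
  normc (F1 - I0 * B1) <= e / (normc B1 + normc B + 1) ->
  normc (F * B1 - F1 * B) <= e.
Proof.
move=> e0; set D := _ + 1 => h1 h2.
have D0 : 0 < D by rewrite ltr_wpDl // addr_ge0 // normc_ge0.
have -> : F * B1 - F1 * B = (F - I0 * B) * B1 - (F1 - I0 * B1) * B by ring.
rewrite (le_trans (ler_normcB _ _)) // !normcM.
have k1 : normc (F - I0 * B) * normc B1 <= e / D * normc B1 by rewrite ler_wpM2r ?normc_ge0.
have k2 : normc (F1 - I0 * B1) * normc B <= e / D * normc B by rewrite ler_wpM2r ?normc_ge0.
rewrite (le_trans (lerD k1 k2)) // -mulrDr mulrAC ler_pdivrMr //.
by rewrite ler_wpM2l // /D lerDl.
Qed.

(** * Inversion formula *)

Section Inversion.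
Variables (R : realType) (d : nat).
Local Notation C := R[i].
Implicit Types (u x : 'rV[R]_d) (v w z : 'rV[C]_d) (p j m n : 'rV[int]_d).
Variables (S P : 'M[C]_d) (c c' : R).
Hypotheses (symS : S^T = S) (symP : P^T = P) (SP : S *m P = 1%:M).
Hypotheses (coeS : Im_coercive S c) (coeP : Im_coercive (- P) c').

Let PS : P *m S = 1%:M.
Proof. by rewrite -symS -symP -trmx_mul SP trmx1. Qed.

Definition fterm z n : C := ee (- (2^-1 * qform P (ivec R n)) + dot (ivec R n) z).

Lemma fterm_asummable z : asummable (fterm z).
Proof.
pose v := - (z *m S).
have symNP : (- P)^T = - P by rewrite linearN /= symP.
have E n : fterm z n = ee (- (2^-1 * qform (- P) v)) * gpt (- P) 1 v n.
  rewrite /gpt invr1 scale1r gaussD //.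
  have -> : dot (ivec R n *m - P) v = dot (ivec R n) z.
    rewrite /v mulmxN dotNl dotNr opprK dot_mxl symP -mulmxA SP mulmx1 //.
  have -> : gauss (- P) (ivec R n) = ee (- (2^-1 * qform P (ivec R n))).
    by rewrite /gauss !qformE mulmxN dotNl mulrN.
  rewrite /fterm -!eeD; congr ee.
  by move: (qform P _) (qform (- P) v) (dot _ z) => X1 X2 X3; ring.
have -> : fterm z = fun n => ee (- (2^-1 * qform (- P) v)) * gpt (- P) 1 v n.
  by apply/funext.
apply: asummableZ; exact: (gpt_asummable symNP coeP v (ltn0Sn 0)).
Qed.

Lemma gauss_shift v n : gauss S (v - ivec R n *m P) =
  ee (2^-1 * qform P (ivec R n) - dot (ivec R n) v) * gauss S v.
Proof.
rewrite gaussD // mulrC; congr (ee _ * _).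
rewrite dotNr dot_mxl symS -mulmxA PS mulmx1 (dotC v) [LHS]addrC; congr (_ - _).
by rewrite !qformE mulNmx dotNl dotNr opprK -mulmxA PS mulmx1 dotC.
Qed.

(** The sums over Z^d at the N-torsion points unfold to one sum over (1/N) Z^d. There the character
    of n completes the square, because S P = 1, and becomes the shift by - n P. *)
Lemma fourier_coef N n z : (0 < N)%N ->
  \sum_(k : {ffun 'I_d -> 'I_N}) gsum S 1 (z + N%:R^-1 *: ivec R (box_pt k)) * char R n k =
  fterm z n * gsum S N (z - ivec R n *m P).
Proof.
case: N => // N _; set h : C := N.+1%:R^-1.
have hN : h * N.+1%:R = 1 by rewrite mulVf // pnatr_eq0.
pose f j : C := gauss S (h *: ivec R j + z) * ee (- (h * (dot n j)%:~R)).
have fE j : f j = fterm z n * gpt S N.+1 (z - ivec R n *m P) j.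
  rewrite /gpt addrA gauss_shift /fterm /f mulrA -eeD mulrC; congr (ee _ * _).
  by rewrite -/h dotDr dotZr -dot_ivec; ring.
have sf : asummable f.
  have -> : f = fun j => fterm z n * gpt S N.+1 (z - ivec R n *m P) j by apply/funext.
  by apply: asummableZ; exact: (gpt_asummable symS coeS).
have -> : fterm z n * gsum S N.+1 (z - ivec R n *m P) = csum f.
  rewrite gsumE -csumZ; last exact: (gpt_asummable symS coeS).
  by congr csum; apply/funext => j; rewrite fE.
rewrite (csum_residues (box_residues d N) sf); apply: eq_bigr => k _.
rewrite mulrC gsumE -csumZ; last exact: (gpt_asummable symS coeS).
congr csum; apply/funext => p /=.
rewrite /f /gpt /char mulrC invr1 scale1r; congr (gauss S _ * _).
  rewrite ivecD ivecZ scalerDr scalerA -[N.+1%:Z%:~R]/(N.+1%:R) hN scale1r.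
  by rewrite [z + _]addrC addrCA addrA.
have -> : (dot n (box_pt k + N.+1%:Z *: p))%:~R =
    (dot n (box_pt k))%:~R + N.+1%:R * (dot n p)%:~R :> C.
  by rewrite dotDr dotZr rmorphD rmorphM.
rewrite mulrDr opprD eeD.
by rewrite [h * (_ * _)]mulrA hN mul1r -rmorphN ee_int mulr1.
Qed.

Lemma fejer_fourier M N z : (0 < M)%N -> (M < N)%N ->
  \sum_(k : {ffun 'I_d -> 'I_N}) (fejer R M k)%:C * gsum S 1 (z + N%:R^-1 *: ivec R (box_pt k)) =
  \sum_(a : {ffun 'I_d -> 'I_M}) \sum_(b : {ffun 'I_d -> 'I_M})
    fterm z (box_pt a - box_pt b) * gsum S N (z - ivec R (box_pt a - box_pt b) *m P).
Proof.
move=> M0 MN; have N0 := leq_ltn_trans (leq0n _) MN.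
have -> : \sum_(k : {ffun 'I_d -> 'I_N}) (fejer R M k)%:C * gsum S 1 (z + N%:R^-1 *: ivec R (box_pt k)) =
  \sum_(k : {ffun 'I_d -> 'I_N}) \sum_(a : {ffun 'I_d -> 'I_M}) \sum_(b : {ffun 'I_d -> 'I_M})
    gsum S 1 (z + N%:R^-1 *: ivec R (box_pt k)) * char R (box_pt a - box_pt b) k.
  apply: eq_bigr => k _; under eq_bigr do rewrite -mulr_sumr.
  rewrite -mulr_sumr mulrC; congr (_ * _); exact: fejerE.
rewrite exchange_big; apply: eq_bigr => a _; rewrite exchange_big; apply: eq_bigr => b _.
exact: fourier_coef.
Qed.

(** By periodicity x may be replaced by its representative with coordinates in [-1/2, 1/2], to which
    the Lipschitz bound and [le_dist_cos] apply. *)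
Lemma gsum1_near_periodic z (e : R) : 0 < e -> exists2 K, 0 < K & forall x,
  normc (gsum S 1 (z + cvec x) - gsum S 1 z) <= e + K * \sum_i (1 - cos (2 * pi * x 0 i)).
Proof.
move=> e0.
have [L L0 hL] := gsum_lipschitz symS coeS (norm1_ge0 z) (ler0n R d).
pose h := e / (L * d.+1%:R).
have h0 : 0 < h by rewrite divr_gt0 // mulr_gt0.
have [K K0 hK] := le_dist_cos h0.
exists (L * K) => [|x]; first by rewrite mulr_gt0.
pose m : 'rV[int]_d := \row_i Num.floor (x 0 i + 2^-1).
pose t : 'rV[R]_d := \row_i (x 0 i - (Num.floor (x 0 i + 2^-1))%:~R).
have t2 i : `|t 0 i| <= 2^-1.
  rewrite mxE ler_norml; have := floor_le (x 0 i + 2^-1).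
  have := floorD1_gt (x 0 i + 2^-1); rewrite rmorphD /=; lra.
have -> : gsum S 1 (z + cvec x) = gsum S 1 (z + cvec t).
  rewrite -(gsum_period symS coeS (z + cvec t) m (ltn0Sn 0)); congr (gsum S 1 _).
  rewrite invr1 scale1r -addrA; congr (_ + _); apply/rowP => i.
  by rewrite !mxE rmorphB /= rmorph_int subrK.
have nt : norm1 (cvec t) = \sum_i `|t 0 i| by exact: norm1_cvec.
have tsum : \sum_i `|t 0 i| <= d%:R * h + K * \sum_i (1 - cos (2 * pi * x 0 i)).
  have -> : d%:R * h = \sum_(i < d) h by rewrite sumr_const card_ord mulr_natl.
  rewrite mulr_sumr -big_split; apply: ler_sum => i _ /=.
  rewrite (le_trans (hK _ (t2 i))) // lerD2l ler_wpM2l ?(ltW K0) // lerD2l lerN2.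
  by rewrite -[cos (2 * pi * t 0 i)](cos_period_int _ (Num.floor (x 0 i + 2^-1))) mxE subrK.
apply: (@le_trans _ _ (L * norm1 (cvec t))).
  apply: hL => //; rewrite nt (le_trans (ler_sum _ (fun i _ => t2 i))) //.
  rewrite sumr_const card_ord -mulr_natr; have := ler0n R d; lra.
rewrite nt (le_trans (ler_wpM2l (ltW L0) tsum)) // mulrDr [L * (K * _)]mulrA lerD2r.
rewrite [leLHS](_ : _ = e * (d%:R / d.+1%:R)).
  by rewrite ler_piMr ?(ltW e0) // ler_pdivrMr ?ltr0n // mul1r ler_nat.
have nd : 1 + d%:R != 0 :> R by rewrite addrC natr1 pnatr_eq0.
by rewrite /h; field; rewrite nd lt0r_neq0.
Qed.

(** The threshold for M does not involve N: with M fixed, N can afterwards tend to infinity. *)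
Lemma fejer_approx z (e : R) : 0 < e -> exists M0 : nat, forall M N, (M0 < M)%N -> (M < N)%N ->
  normc ((\sum_(a : {ffun 'I_d -> 'I_M}) \sum_(b : {ffun 'I_d -> 'I_M})
    fterm z (box_pt a - box_pt b) * gavg S N (z - ivec R (box_pt a - box_pt b) *m P))
    / (M ^ d)%:R - gsum S 1 z) <= e.
Proof.
move=> e0; have e2 : 0 < e / 2 by rewrite divr_gt0.
have [K K0 hK] := gsum1_near_periodic z e2.
pose Q := 2 * K * d%:R / e.
have Q0 : 0 <= Q by rewrite divr_ge0 ?(ltW e0) // !mulr_ge0 // ltW.
exists (Num.bound Q) => M N MQ MN.
have M0 : (0 < M)%N by exact: leq_ltn_trans MQ.
have N0 : (0 < N)%N := leq_ltn_trans (leq0n _) MN.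
have QM : Q <= M%:R.
  have := archi_boundP Q0 => h; apply: (le_trans (ltW h)); rewrite ler_nat; exact: ltnW.
pose T : R := (M ^ d)%:R * N%:R ^+ d.
have T0 : 0 < T by rewrite mulr_gt0 ?exprn_gt0 ?ltr0n ?expn_gt0 ?M0.
have nTC : T%:C = (M ^ d)%:R * N%:R ^+ d by exact: natX_complex.
have -> : (\sum_(a : {ffun 'I_d -> 'I_M}) \sum_(b : {ffun 'I_d -> 'I_M})
    fterm z (box_pt a - box_pt b) * gavg S N (z - ivec R (box_pt a - box_pt b) *m P))
    / (M ^ d)%:R - gsum S 1 z =
   (\sum_(k : {ffun 'I_d -> 'I_N}) (fejer R M k)%:C *
     (gsum S 1 (z + N%:R^-1 *: ivec R (box_pt k)) - gsum S 1 z)) / T%:C.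
  have nT : T%:C != 0.
    by rewrite nTC mulf_neq0 ?expf_neq0 ?pnatr_eq0 -?lt0n ?expn_gt0 ?M0.
  have sumT : \sum_(k : {ffun 'I_d -> 'I_N}) (fejer R M k)%:C = T%:C.
    by rewrite /T -(fejer_sum R d M0 MN) rmorph_sum.
  have -> : \sum_(k : {ffun 'I_d -> 'I_N}) (fejer R M k)%:C *
      (gsum S 1 (z + N%:R^-1 *: ivec R (box_pt k)) - gsum S 1 z) =
    \sum_(a : {ffun 'I_d -> 'I_M}) \sum_(b : {ffun 'I_d -> 'I_M})
      fterm z (box_pt a - box_pt b) * gsum S N (z - ivec R (box_pt a - box_pt b) *m P) -
    T%:C * gsum S 1 z.
    rewrite -(fejer_fourier z M0 MN) -sumT mulr_suml -sumrB.
    by apply: eq_bigr => k _; rewrite mulrBr.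
  rewrite [RHS]mulrBl [T%:C * _]mulrC mulfK //; congr (_ - _).
  have -> : \sum_(a : {ffun 'I_d -> 'I_M}) \sum_(b : {ffun 'I_d -> 'I_M})
      fterm z (box_pt a - box_pt b) * gavg S N (z - ivec R (box_pt a - box_pt b) *m P) =
    (\sum_(a : {ffun 'I_d -> 'I_M}) \sum_(b : {ffun 'I_d -> 'I_M})
      fterm z (box_pt a - box_pt b) * gsum S N (z - ivec R (box_pt a - box_pt b) *m P))
    * N%:R ^- d.
    rewrite mulr_suml; apply: eq_bigr => a _; rewrite mulr_suml; apply: eq_bigr => b _.
    by rewrite gavgE mulrA.
  by rewrite nTC invfM -mulrA [N%:R ^- d * _]mulrC.
rewrite normcM normcV normc_real (ger0_norm (ltW T0)) ler_pdivrMr //.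
apply: (le_trans (normc_sum _ _ _)).
apply: (@le_trans _ _ (\sum_(k : {ffun 'I_d -> 'I_N}) fejer R M k *
   (e / 2 + K * \sum_i (1 - cos (2 * pi * (N%:R^-1 * (k i : nat)%:R)))))).
  apply: ler_sum => k _; rewrite normcM normc_real (ger0_norm (fejer_ge0 _ _ _)).
  rewrite ler_wpM2l ?fejer_ge0 // -cvec_lattice_pt // (le_trans (hK _)) // lerD2l.
  rewrite ler_wpM2l ?(ltW K0) // ler_sum // => i _.
  by rewrite !mxE.
have -> : \sum_(k : {ffun 'I_d -> 'I_N}) fejer R M k *
   (e / 2 + K * \sum_i (1 - cos (2 * pi * (N%:R^-1 * (k i : nat)%:R)))) =
   T * (e / 2) + K * \sum_i \sum_(k : {ffun 'I_d -> 'I_N}) fejer R M k *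
     (1 - cos (2 * pi * (N%:R^-1 * (k i : nat)%:R))).
  under eq_bigr do rewrite mulrDr.
  rewrite big_split /= -mulr_suml fejer_sum //; congr (_ + _).
  rewrite exchange_big mulr_sumr; apply: eq_bigr => k _.
  by rewrite mulrCA -mulr_sumr.
have MR : 0 < M%:R :> R by rewrite ltr0n.
have : \sum_i \sum_(k : {ffun 'I_d -> 'I_N}) fejer R M k *
     (1 - cos (2 * pi * (N%:R^-1 * (k i : nat)%:R))) <= d%:R * (T / M%:R).
  have -> : d%:R * (T / M%:R) = \sum_(i < d) (T / M%:R) by rewrite sumr_const card_ord mulr_natl.
  by apply: ler_sum => i _; rewrite ler_pdivlMr // mulrC; exact: fejer_conc.
move=> /(ler_wpM2l (ltW K0)) h.
have h3 : K * (d%:R * (T / M%:R)) <= T * (e / 2).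
  have -> : K * (d%:R * (T / M%:R)) = T * (K * d%:R / M%:R) by ring.
  rewrite ler_wpM2l ?(ltW T0) // ler_pdivrMr //.
  by move: QM; rewrite /Q ler_pdivrMr //; lra.
have -> : e * T = T * (e / 2) + T * (e / 2) by field.
by rewrite lerD2l (le_trans h).
Qed.

(** M is chosen first, for the Fejer mean and for the box average. After that only finitely many
    shifts n P occur, and N is taken so large that each shifted Riemann sum is close to
    [gavg S N 0]. *)
Lemma theta_inversion_approx z (e : R) : 0 < e -> exists N0 : nat, forall N, (N0 < N)%N ->
  normc (gsum S 1 z - gavg S N 0 * csum (fterm z)) <= e.
Proof.
move=> e0; have e3 : 0 < e / 3 by rewrite divr_gt0.
have [A A0 hA] := gavg0_bounded symS coeS.
have [M1 hM1] := fejer_approx z e3.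
have eA : 0 < e / 3 / A by rewrite divr_gt0.
have [M2 hM2] := box_average (fterm_asummable z) (csumP (fterm_asummable z)) eA.
pose M := (maxn M1 M2).+1.
have M1M : (M1 < M)%N by rewrite ltnS leq_maxl.
have M2M : (M2 < M)%N by rewrite ltnS leq_maxr.
have M0 : (0 < M)%N by [].
pose B (a b : {ffun 'I_d -> 'I_M}) := box_pt a - box_pt b.
have /boolp.choice[Kf hKf] : forall ab : {ffun 'I_d -> 'I_M} * {ffun 'I_d -> 'I_M}, exists K, forall N,
   (0 < N)%N -> normc (gavg S N (z - ivec R (B ab.1 ab.2) *m P) - gavg S N 0) <= K * N%:R^-1.
  by move=> ab; have [K _ hK] := gavg_shift symS coeS (z - ivec R (B ab.1 ab.2) *m P); exists K.
pose Q := \sum_(a : {ffun 'I_d -> 'I_M}) \sum_(b : {ffun 'I_d -> 'I_M})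
  normc (fterm z (B a b)) * `|Kf (a, b)|.
have Q0 : 0 <= Q.
  by rewrite sumr_ge0 // => a _; rewrite sumr_ge0 // => b _; rewrite mulr_ge0 ?normc_ge0.
pose X := Q / (e / 3).
have X0 : 0 <= X by rewrite divr_ge0 // ltW.
exists (maxn M (Num.bound X)) => N; rewrite gtn_max => /andP[MN XN].
have N0 : (0 < N)%N := leq_ltn_trans (leq0n _) MN.
have XN' : X <= N%:R.
  have := archi_boundP X0 => h; apply: (le_trans (ltW h)); rewrite ler_nat; exact: ltnW.
have Md0 : 0 < (M ^ d)%:R :> R by rewrite ltr0n expn_gt0 M0.
have nMd : normc ((M ^ d)%:R : C) = (M ^ d)%:R.
  by rewrite -(rmorph_nat (real_complex R)) normc_real ger0_norm // ltW.
have h1 := hM1 M N M1M MN; have h2 := hM2 M M2M.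
set F := gsum S 1 z in h1 *; set Bs := csum _ in h2 *; set I0 := gavg S N 0.
set G := (\sum_a \sum_b _) / _ in h1; set W := (\sum_a \sum_b _) / _ in h2.
have h3 : normc (G - I0 * W) <= e / 3.
  have -> : G - I0 * W = (\sum_(a : {ffun 'I_d -> 'I_M}) \sum_(b : {ffun 'I_d -> 'I_M})
     fterm z (B a b) * (gavg S N (z - ivec R (B a b) *m P) - I0)) / (M ^ d)%:R.
    rewrite /G /W mulrA -mulrBl; congr (_ / _); rewrite mulr_sumr -sumrB.
    apply: eq_bigr => a _; rewrite mulr_sumr -sumrB; apply: eq_bigr => b _.
    by rewrite mulrBr [I0 * _]mulrC.
  rewrite normcM normcV nMd ler_pdivrMr //.
  apply: (@le_trans _ _ (Q / N%:R)).
    rewrite (le_trans (normc_sum _ _ _)) // mulr_suml; apply: ler_sum => a _.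
    rewrite (le_trans (normc_sum _ _ _)) // mulr_suml; apply: ler_sum => b _.
    rewrite normcM -mulrA ler_wpM2l ?normc_ge0 // (le_trans (hKf (a, b) N N0)) //.
    by rewrite ler_wpM2r ?invr_ge0 // ler_norm.
  apply: (@le_trans _ _ (e / 3)); last first.
    by rewrite ler_peMr ?(ltW e3) // ler1n expn_gt0 M0.
  by rewrite ler_pdivrMr ?ltr0n // mulrC -ler_pdivrMr.
have h4 : normc (I0 * W - I0 * Bs) <= e / 3.
  rewrite -mulrBr normcM.
  apply: (@le_trans _ _ (A * (e / 3 / A))); last by rewrite mulrC divfK // gt_eqF.
  by rewrite ler_pM ?normc_ge0 // hA.
have -> : F - I0 * Bs = (G - I0 * W) + (I0 * W - I0 * Bs) - (G - F) by ring.
have g1 := ler_normcB ((G - I0 * W) + (I0 * W - I0 * Bs)) (G - F).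
have g2 := ler_normcD (G - I0 * W) (I0 * W - I0 * Bs).
lra.
Qed.

(* The constant is only asserted to exist: its value [det (- i S) ^ (-1/2)],
   hence a choice of square root, is never needed. *)
Theorem theta_inversion : exists K : C, forall z, gsum S 1 z = K * csum (fterm z).
Proof.
(* If all dual sums vanish, then so do all [gsum S 1 z], and K = 0 serves. *)
have [[z1 hz1]|h] := pselect (exists z1, csum (fterm z1) != 0); last first.
  exists 0 => z; rewrite mul0r; apply: normc_le0_eps => e e0.
  have [N0 hN] := theta_inversion_approx z e0; have := hN _ (ltnSn N0).
  have -> : csum (fterm z) = 0 by apply/eqP; apply: contrapT => /negP hz; apply: h; exists z.
  by rewrite mulr0 subr0.
exists (gsum S 1 z1 / csum (fterm z1)) => z.
set B1 := csum (fterm z1) in hz1 *; set B := csum (fterm z).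
suff E : gsum S 1 z * B1 = gsum S 1 z1 * B by rewrite [RHS]mulrAC -E mulfK.
apply/eqP; rewrite -subr_eq0; apply/eqP/normc_le0_eps => e e0.
pose D := normc B1 + normc B + 1.
have eD : 0 < e / D by rewrite divr_gt0 // ltr_wpDl // addr_ge0 // normc_ge0.
have [N1 h1] := theta_inversion_approx z eD.
have [N2 h2] := theta_inversion_approx z1 eD.
pose N := (maxn N1 N2).+1.
have {}h1 := h1 N (leq_maxl N1 N2); have {}h2 := h2 N (leq_maxr N1 N2).
exact: cross_le (ltW e0) h1 h2.
Qed.

End Inversion.

(** * Coercivity of positive definite forms *)

Section PositiveDefinite.
Variables (R : realType) (d : nat).
Local Notation C := R[i].

Lemma continuous_qform (Y : 'M[R]_d) : continuous (fun u : 'rV[R]_d => dot (u *m Y) u).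
Proof.
have -> : (fun u : 'rV[R]_d => dot (u *m Y) u) =
    fun u => \sum_i (\sum_j u 0 j * Y j i) * u 0 i.
  by apply/funext => u; rewrite dotE; apply: eq_bigr => i _; rewrite mxE.
have cs (F : 'I_d -> 'rV[R]_d -> R) : (forall i, continuous (F i)) ->
    continuous (fun u => \sum_i F i u).
  move=> hF; elim: (index_enum _) => [|i r IH] u.
    have -> : (fun u => \sum_(i <- [::]) F i u) = fun=> 0 by apply/funext => v; rewrite big_nil.
    exact: cst_continuous.
  have -> : (fun u => \sum_(j <- i :: r) F j u) = fun u => F i u + \sum_(j <- r) F j u.
    by apply/funext => v; rewrite big_cons.
  exact: (cvgD (hF i u) (IH u)).
apply: (cs (fun i u => (\sum_j u 0 j * Y j i) * u 0 i)) => i u.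
have h2 : continuous (fun u : 'rV[R]_d => \sum_j u 0 j * Y j i).
  apply: (cs (fun j u => u 0 j * Y j i)) => j {}u.
  exact: (cvgM (@coord_continuous _ _ _ _ _ _) (cvg_cst _)).
exact: (cvgM (h2 u) (@coord_continuous _ _ _ _ _ _)).
Qed.

Lemma positive_definite_coercive (Y : 'M[R]_d) :
  (forall u : 'rV[R]_d, u != 0 -> 0 < dot (u *m Y) u) ->
  exists2 c : R, 0 < c & forall u : 'rV[R]_d, c * \sum_i u 0 i ^+ 2 <= dot (u *m Y) u.
Proof.
move=> pos; pose q (u : 'rV[R]_d) := \sum_i u 0 i ^+ 2.
have qE u : q u = dot (u *m 1%:M) u.
  by rewrite mulmx1 dotE; apply: eq_bigr => i _; rewrite expr2.
have q0 u : 0 <= q u by rewrite sumr_ge0 // => i _; rewrite sqr_ge0.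
have qeq0 u : q u = 0 -> u = 0.
  move/eqP; rewrite psumr_eq0 => [/allP h|i _]; last exact: sqr_ge0.
  apply/rowP => i; rewrite mxE; apply/eqP.
  by rewrite -sqrf_eq0; apply: h; rewrite mem_index_enum.
pose A : set 'rV[R]_d := [set u | q u = 1]%classic.
(* An empty unit sphere means that 0 is the only vector; any constant then works. *)
have [[u1 Au1]|nA] := pselect (A !=set0)%classic; last first.
  exists 1 => // u; have [->|u0] := eqVneq u 0.
    by rewrite dot0r big1 ?mulr0 // => i _; rewrite mxE expr0n.
  have s0 : q u != 0 by apply: contra u0 => /eqP/qeq0 ->.
  exfalso; apply: nA; exists ((Num.sqrt (q u))^-1 *: u); rewrite /A /= qE.
  rewrite -scalemxAl dotZl dotZr -qE mulrA -invfM -expr2 sqr_sqrtr // mulVf //.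
have cA : compact A.
  have h1 : compact [set v : 'rV[R]_d | forall i, `[(-1 : R), 1]%classic (v ord0 i)]%classic.
    by apply: (@rV_compact _ _ (fun=> `[(-1 : R), 1]%classic)) => _; exact: segment_compact.
  apply: (subclosed_compact _ h1).
    have -> : A = ((fun u => dot (u *m 1%:M) u) @^-1` [set 1])%classic.
      by apply/seteqP; split => u; rewrite /A /= qE.
    apply: closed_comp; last exact: closed_eq.
    by move=> u _; exact: continuous_qform.
  move=> u Au i; rewrite /= in_itv /= -ler_norml -(@ler_pXn2r _ 2) ?nnegrE //.
  rewrite expr1n real_normK ?num_real // -Au /q (bigD1 i) //= lerDl sumr_ge0 // => j _.
  exact: sqr_ge0.
have [||u2 Au2 hmin] := @EVT_min_rV _ _ (fun u => dot (u *m Y) u) A _ cA.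
- by exists u1.
- by apply: continuous_subspaceT; exact: continuous_qform.
have A2 : q u2 = 1 by move: Au2; rewrite in_setE.
have u20 : u2 != 0.
  by apply/eqP => h; move: A2 => /eqP; rewrite h qE dot0r eq_sym oner_eq0.
exists (dot (u2 *m Y) u2) => [|u]; first exact: pos.
have [->|u0] := eqVneq u 0.
  by rewrite dot0r big1 ?mulr0 // => i _; rewrite mxE expr0n.
have s0 : q u != 0 by apply: contra u0 => /eqP/qeq0 ->.
have sp : 0 < q u by rewrite lt_neqAle eq_sym s0 q0.
have := hmin ((Num.sqrt (q u))^-1 *: u); rewrite in_setE => h.
have /h : A ((Num.sqrt (q u))^-1 *: u).
  rewrite /A /= qE.
  by rewrite -scalemxAl dotZl dotZr -qE mulrA -invfM -expr2 sqr_sqrtr // mulVf.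
by rewrite -scalemxAl dotZl dotZr mulrA -invfM -expr2 sqr_sqrtr // ler_pdivlMl // mulrC.
Qed.

Lemma qform_cvec_Im (S : 'M[C]_d) u :
  complex.Im (qform S (cvec u)) = dot (u *m map_mx (@complex.Im R) S) u.
Proof.
have Im_sum (I : finType) (F : I -> C) : complex.Im (\sum_i F i) = \sum_i complex.Im (F i).
  by elim/big_rec2: _ => [//|i x y _ <-]; rewrite ImD.
rewrite qformE !dotE Im_sum; apply: eq_bigr => i _.
rewrite mulrC !mxE Im_realM mulrC Im_sum; congr (_ * _).
by apply: eq_bigr => j _; rewrite !mxE Im_realM.
Qed.

End PositiveDefinite.

(** * Theta functions on the ball *)

Section SignMatrix.
Variable A : comNzRingType.

Definition hsign (i : 'I_5) : A := [:: 1; 1; 1; 1; - 1]`_i.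

Lemma HmxE : Hmx A = diag_mx (\row_i hsign i).
Proof. by []. Qed.

Lemma hsignM i : hsign i * hsign i = 1.
Proof. by case: i => -[|[|[|[|[|m]]]]] hm //; rewrite /hsign /= ?mulr1 ?mulrNN ?mulr1. Qed.

Lemma hsign_pm i : hsign i = 1 \/ hsign i = -1.
Proof. by case: i => -[|[|[|[|[|m]]]]] hm //; [left|left|left|left|right]. Qed.

Lemma tr_Hmx : (Hmx A)^T = Hmx A.
Proof. by rewrite HmxE tr_diag_mx. Qed.

Lemma mul_Hmx (v : 'rV[A]_5) i : (v *m Hmx A) 0 i = v 0 i * hsign i.
Proof. by rewrite HmxE mul_mx_diag !mxE. Qed.

Lemma HmxK : Hmx A *m Hmx A = 1%:M.
Proof.
rewrite HmxE; apply/matrixP => i j; rewrite mul_mx_diag !mxE.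
by case: eqP => [->|_]; rewrite ?mulr1n ?hsignM // mulr0n mul0r.
Qed.

Lemma mul_HmxK (v : 'rV[A]_5) : v *m Hmx A *m Hmx A = v.
Proof. by rewrite -mulmxA HmxK mulmx1. Qed.

Lemma dot_Hmx (v w : 'rV[A]_5) : dot (v *m Hmx A) w = dot v (w *m Hmx A).
Proof. by rewrite dot_mxl tr_Hmx. Qed.

End SignMatrix.

Lemma map_Hmx (A B : comNzRingType) (f : {rmorphism A -> B}) : map_mx f (Hmx A) = Hmx B.
Proof.
apply/matrixP => i j; rewrite !HmxE !mxE rmorphMn; congr (_ *+ _).
by case: i => -[|[|[|[|[|m]]]]] hm //; rewrite /hsign /= ?rmorphN ?rmorph1.
Qed.

Section BallInversion.
Variables (R : realType).
Local Notation C := R[i].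
Variable tau : 'M[C]_5.
Hypothesis tau_ball : ball4 tau.
Local Notation H := (Hmx C).

Let tau_sym : tau^T = tau. Proof. by case: tau_ball => [[]]. Qed.

Lemma ball_inverse : tau *m (H + H *m tau *m H) = - 1%:M.
Proof.
case: tau_ball => _; rewrite expr2 -!mulmxE => /(congr1 (fun X => H *m X *m H)).
rewrite mulmx0 mul0mx !mulmxDr !mulmxDl !mulmxA HmxK !mul1mx mulmx1 HmxK => /eqP.
by rewrite addr_eq0 addrC => /eqP.
Qed.

Lemma tau_coercive : exists c, Im_coercive tau c.
Proof.
case: tau_ball => -[_ pos] _.
have [u u0|c c0 hc] := @positive_definite_coercive _ _ (map_mx (@complex.Im R) tau).
  by have := pos u u0; rewrite -/(dot (u *m map_mx (@complex.Im R) tau) u).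
by exists c; split => // u; rewrite qform_cvec_Im.
Qed.

Lemma mul_cvec_Hmx (u : 'rV[R]_5) : cvec u *m H = cvec (u *m Hmx R).
Proof. by rewrite -(map_Hmx (real_complex R)) -map_mxM. Qed.

Lemma ivec_Hmx (p : 'rV[int]_5) : ivec R p *m H = ivec R (p *m Hmx int).
Proof. by rewrite -(map_Hmx (@intmul C 1)) -map_mxM. Qed.

Lemma qform_Hmx (v : 'rV[C]_5) : qform (H *m tau *m H) v = qform tau (v *m H).
Proof. by rewrite !qformE !mulmxA dot_Hmx. Qed.

Variable k : nat.
Hypothesis k0 : (0 < k)%N.
Let kap : R := k%:R.
Let kap0 : 0 < kap. Proof. by rewrite ltr0n. Qed.

(** The case k = 1 leads to the dichotomy, the case k = 3 to the transform of triple products. *)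
Definition theta_mx : 'M[C]_5 := kap%:C *: tau.

(** The inverse of [theta_mx]. Its part H tau H is tau in the variable v H, and its part H
    contributes nothing but a phase at rational points. *)
Definition theta_dual : 'M[C]_5 := - (kap^-1%:C *: (H + H *m tau *m H)).

Lemma theta_mx_sym : theta_mx^T = theta_mx.
Proof. by rewrite /theta_mx linearZ /= tau_sym. Qed.

Lemma theta_dual_sym : theta_dual^T = theta_dual.
Proof.
rewrite /theta_dual linearN linearZ linearD /= tr_Hmx; congr (- (_ *: (_ + _))).
by rewrite !trmx_mul tr_Hmx tau_sym mulmxA.
Qed.

Lemma theta_mxK : theta_mx *m theta_dual = 1%:M.
Proof.
rewrite /theta_dual mulmxN -scalemxAr -scalemxAl ball_inverse !scalerN opprK scalerA.
by rewrite -rmorphM mulVf ?scale1r // gt_eqF.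
Qed.

Lemma theta_mx_coercive : exists c, Im_coercive theta_mx c.
Proof.
have [c [c0 hc]] := tau_coercive; exists (kap * c); split; first by rewrite mulr_gt0.
move=> u; rewrite /theta_mx qformE -scalemxAr dotZl Im_realM -mulrA ler_wpM2l ?(ltW kap0) //.
Qed.

Lemma theta_dual_coercive : exists c, Im_coercive (- theta_dual) c.
Proof.
have [c [c0 hc]] := tau_coercive; exists (kap^-1 * c); split.
  by rewrite mulr_gt0 // invr_gt0.
move=> u; rewrite /theta_dual opprK qformE -scalemxAr dotZl Im_realM -mulrA.
rewrite ler_wpM2l ?invr_ge0 ?(ltW kap0) //.
rewrite mulmxDr dotDl ImD -[dot (_ *m (H *m tau *m H)) _]qformE qform_Hmx.
(* H is real, so the imaginary part is that of tau at u H, a vector of the same Euclidean norm as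
   u. *)
rewrite mul_cvec_Hmx (dot_map (real_complex R)) /= add0r.
apply: le_trans (hc _); rewrite ler_wpM2l ?(ltW c0) // ler_sum // => i _.
by rewrite mul_Hmx exprMn [hsign _ _ ^+ 2]expr2 hsignM mulr1.
Qed.

Definition theta_term (x y : 'rV[C]_5) (p : 'rV[int]_5) : C :=
  ee (2^-1 * qform theta_mx (ivec R p + x) + dot (ivec R p + x) y).

(** The general term of the inverted series after the substitution of n H for n, which changes H tau
    H back into tau. *)
Definition dual_term (x y : 'rV[C]_5) (n : 'rV[int]_5) : C :=
  ee ((2 * kap)^-1%:C * (qform tau (ivec R n - y *m H) + qform H (ivec R n - y *m H))
      + dot (ivec R n) (x *m H)).

Lemma theta_termE x y p : theta_term x y p =
  ee (- (2^-1 * qform theta_dual y)) * gpt theta_mx 1 (x + y *m theta_dual) p.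
Proof.
have DS : theta_dual *m theta_mx = 1%:M := mulmx1C theta_mxK.
rewrite /gpt invr1 scale1r addrA gaussD ?theta_mx_sym // mulrC.
rewrite dot_mxl theta_mx_sym -mulmxA DS mulmx1 [qform theta_mx (y *m _)]qformE.
rewrite -mulmxA DS mulmx1 [dot y _]dotC -[dot (y *m _) y]qformE.
by rewrite /theta_term -mulrA -eeD addrK eeD.
Qed.

Lemma theta_term_asummable x y : asummable (theta_term x y).
Proof.
have -> : theta_term x y = fun p =>
  ee (- (2^-1 * qform theta_dual y)) * gpt theta_mx 1 (x + y *m theta_dual) p.
  by apply/funext => p; rewrite theta_termE.
have [c hc] := theta_mx_coercive.
by apply: asummableZ; exact: (gpt_asummable theta_mx_sym hc).
Qed.

Lemma dual_termE x y n : dual_term x y n =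
  ee (- (2^-1 * qform theta_dual y)) *
  fterm theta_dual (x + y *m theta_dual) (n *m Hmx int).
Proof.
set z := x + y *m theta_dual.
rewrite /fterm -eeD -ivec_Hmx /dual_term; congr (ee _).
set N := ivec R n.
have -> : qform tau (N - y *m H) + qform H (N - y *m H) = - (kap%:C * qform theta_dual (N *m H - y)).
  rewrite /theta_dual !qformE mulmxN -scalemxAr dotNl dotZl mulrN mulrA -rmorphM divff ?gt_eqF //.
  rewrite mul1r opprK mulmxDr dotDl addrC -[dot (_ *m (H *m tau *m H)) _]qformE qform_Hmx.
  have -> : N - y *m H = (N *m H - y) *m H by rewrite mulmxBl mul_HmxK.
  by rewrite [dot (_ *m H *m H) _]dotC mul_HmxK -qformE.
pose a := dot (N *m H *m theta_dual) y.
have -> : qform theta_dual (N *m H - y) =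
    qform theta_dual (N *m H) - a - a + qform theta_dual y.
  rewrite [LHS]qformE mulmxBl !dotBl !dotBr -!qformE.
  rewrite [dot (y *m _) _](dot_sym _ _ theta_dual_sym) -/a; ring.
have -> : dot (N *m H) z = dot N (x *m H) + a.
  rewrite /z dotDr dot_Hmx; congr (_ + _).
  by rewrite /a [RHS]dot_mxl theta_dual_sym.
have hk : (2 * kap)^-1%:C * kap%:C = 2^-1 :> C.
  transitivity ((2 * kap)^-1 * kap)%:C; first by rewrite rmorphM.
  by rewrite half_real; congr (_%:C); field; rewrite gt_eqF.
rewrite mulrN mulrA hk.
move: (qform _ _) (qform _ _) (dot _ _) a => X1 X2 X3 X4; by field.
Qed.

Let bij_Hmx : bijective (fun n : 'rV[int]_5 => n *m Hmx int).
Proof. by exists (fun n => n *m Hmx int) => n; rewrite mul_HmxK. Qed.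

Let fterm_Hmx_asummable z : asummable (fun n => fterm theta_dual z (n *m Hmx int)).
Proof.
have [c' hc'] := theta_dual_coercive.
have [K hK] := fterm_asummable theta_dual_sym theta_mxK hc' z.
by exists K; apply: asum_le_inj hK; exact: bij_inj bij_Hmx.
Qed.

Lemma dual_term_asummable x y : asummable (dual_term x y).
Proof.
by rewrite (funext (dual_termE x y)); apply: asummableZ; exact: fterm_Hmx_asummable.
Qed.

Lemma theta_transform : exists K : C, forall x y,
  csum (theta_term x y) = K * csum (dual_term x y).
Proof.
have [c hc] := theta_mx_coercive; have [c' hc'] := theta_dual_coercive.
have [K hK] := theta_inversion theta_mx_sym theta_dual_sym theta_mxK hc hc'.
exists K => x y; set z := x + y *m theta_dual.
have -> : csum (theta_term x y) = ee (- (2^-1 * qform theta_dual y)) * gsum theta_mx 1 z.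
  rewrite gsumE -csumZ; last exact: (gpt_asummable theta_mx_sym hc).
  by congr csum; apply/funext => p; rewrite theta_termE.
rewrite hK mulrCA (funext (dual_termE x y)) csumZ; last exact: fterm_Hmx_asummable.
have sz := fterm_asummable theta_dual_sym theta_mxK hc' z.
exact: (congr1 (fun s => K * (ee (- (2^-1 * qform theta_dual y)) * s)) (esym (csum_bij bij_Hmx sz))).
Qed.

End BallInversion.

Lemma ee_sum_congr (R : realType) (X Y : 'I_5 -> R[i]) :
  (forall i, exists m : int, X i = Y i + m%:~R) -> ee (\sum_i X i) = ee (\sum_i Y i).
Proof.
move=> /boolp.choice[m hm]; apply: (@ee_congr _ _ _ (\sum_i m i)).
by rewrite rmorph_sum -big_split; apply: eq_bigr => i _; exact: hm.
Qed.

(** In phases of the form e(p^2 / 2) the square may be replaced by p; this linearises what H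
    contributes. *)
Lemma triangular_int (A : numFieldType) (p : int) :
  exists m : int, (m%:~R : A) = 2^-1 * (p%:~R * p%:~R - p%:~R).
Proof.
have [q hq] : exists q : int, p = 2 * q \/ p = 2 * q + 1.
  by exists (divz p 2); lia.
have [m hm] : exists m : int, p * p = p + 2 * m.
  by case: hq => ->; [exists (2 * q * q - q)|exists (2 * q * q + q)]; ring.
exists m; rewrite -rmorphM hm rmorphD rmorphM /= addrAC subrr add0r mulrA mulVf ?mul1r ?pnatr_eq0 //.
Qed.

Section Coordinates.
Variables (A : zmodType) (d : nat).
Implicit Types v w : 'rV[A]_d.

Lemma rVaddE v w i : (v + w) 0 i = v 0 i + w 0 i. Proof. exact: mxE. Qed.

Lemma rVoppE v i : (- v) 0 i = - v 0 i. Proof. exact: mxE. Qed.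

End Coordinates.

Lemma rVscaleE (A : pzRingType) d a (v : 'rV[A]_d) i : (a *: v) 0 i = a * v 0 i.
Proof. exact: mxE. Qed.

Lemma ivecE (R : realType) (p : 'rV[int]_5) i : ivec R p 0 i = (p 0 i)%:~R.
Proof. exact: mxE. Qed.

Lemma hsign_int (A : comNzRingType) i : (hsign int i)%:~R = hsign A i.
Proof. by case: i => -[|[|[|[|[|m]]]]] hm //; rewrite /hsign /= ?rmorphN ?rmorph1. Qed.

Lemma intr_Hmx (A : comNzRingType) (b : 'rV[int]_5) i :
  ((b *m Hmx int) 0 i)%:~R = (b 0 i)%:~R * hsign A i.
Proof. by rewrite mul_Hmx intrM hsign_int. Qed.

(** * Theta constants with characteristics *)

Section Characteristics.
Variables (R : realType) (tau : 'M[R[i]]_5).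
Hypothesis tau_ball : ball4 tau.
Local Notation C := R[i].
Local Notation H := (Hmx C).
Implicit Types (b c d k p : 'rV[int]_5).

Definition chx b : 'rV[C]_5 := const_mx 2^-1 + 3^-1 *: ivec R (- b *m Hmx int).

Definition chy b : 'rV[C]_5 := const_mx 2^-1 + 3^-1 *: ivec R b.

Definition theta_char b : C := csum (theta_term tau 1 (chx b) (chy b)).

(** The condition under which the factor e(1/2 sum b_i) left over by the inversion is 1. *)
Definition even_sum b := exists m : int, \sum_i b 0 i = 2 * m.

Definition hform b c : int := dot (b *m Hmx int) c.

Lemma qform_theta_mx (k : nat) (v : 'rV[C]_5) : qform (theta_mx tau k) v = k%:R * qform tau v.
Proof. by rewrite /theta_mx !qformE -scalemxAr dotZl rmorph_nat. Qed.

Lemma theta_char_summable b : asummable (theta_term tau 1 (chx b) (chy b)).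
Proof. exact: theta_term_asummable. Qed.

Lemma Theta3E vt : Theta3 vt tau = theta_char (beta_tilde vt) ^+ 3.
Proof.
rewrite /Theta3 /Theta; congr (_ ^+ 3); set b := beta_tilde vt.
apply: summability_sumE.
have h3 : real_complex R 3^-1 = 3^-1 by rewrite fmorphV rmorph_nat.
have h2 : real_complex R 2^-1 = 2^-1 by rewrite fmorphV rmorph_nat.
have cx (m : 'rV[int]_5) : map_mx (real_complex R) (const_mx 2^-1 + 3^-1 *: map_mx intr m) =
    const_mx 2^-1 + 3^-1 *: ivec R m.
  by apply/rowP => i; rewrite !mxE rmorphD rmorphM /= h3 h2 rmorph_int.
apply: eq_has_sum (csumP (theta_char_summable b)) => p.
by rewrite /theta_term qform_theta_mx mul1r !cx.
Qed.

Lemma chxE b i : chx b 0 i = 2^-1 - 3^-1 * ((b 0 i)%:~R * hsign C i).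
Proof.
rewrite /chx -ivec_Hmx rVaddE [const_mx _ 0 i]mxE rVscaleE mul_Hmx ivecE rVoppE.
by rewrite rmorphN /= mulNr mulrN.
Qed.

Lemma chyE b i : chy b 0 i = 2^-1 + 3^-1 * (b 0 i)%:~R.
Proof. by rewrite !mxE. Qed.

Opaque chx chy.

Lemma theta_char_shift b d :
  theta_char (b + 3%:Z *: d) = ee (dot (chx b) (ivec R d)) * theta_char b.
Proof.
have n3 : (3 : C) != 0 by rewrite pnatr_eq0.
have hx : chx (b + 3%:Z *: d) = chx b - ivec R (d *m Hmx int).
  apply/rowP => i; rewrite [RHS]rVaddE rVoppE !chxE -ivec_Hmx mul_Hmx ivecE rVaddE.
  by rewrite rVscaleE rmorphD rmorphM /=; field.
have hy : chy (b + 3%:Z *: d) = chy b + ivec R d.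
  apply/rowP => i; rewrite [RHS]rVaddE !chyE ivecE rVaddE rVscaleE.
  by rewrite rmorphD rmorphM /=; field.
rewrite /theta_char -csumZ; last exact: theta_char_summable.
have hb : bijective (fun p : 'rV[int]_5 => p + d *m Hmx int) by exact: bij_addr.
rewrite -(csum_bij hb); last exact: theta_term_asummable.
congr csum; apply/funext => p.
rewrite /theta_term hx hy ivecD.
have -> : ivec R p + ivec R (d *m Hmx int) + (chx b - ivec R (d *m Hmx int)) = ivec R p + chx b.
  by rewrite addrACA subrr addr0.
rewrite -eeD dotDr [in RHS]addrC -[in RHS]addrA; apply: (@ee_congr _ _ _ (dot p d)).
rewrite -dot_ivec [dot (_ + _) (ivec R d)]dotDl; ring.
Qed.

Lemma ee_half : ee (2^-1 : C) = -1.
Proof.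
rewrite half_real eeE /= mulr0 oppr0 expR0 mul1r.
have -> : 2 * pi / 2 = pi :> R by field.
by rewrite cospi sinpi; apply/eqP; rewrite eq_complex /= oppr0 !eqxx.
Qed.

(** The substitution of -p - 1 for p absorbs the halves in the characteristic. The minus sign is
    e(-5/2), from five coordinates with 1/2 each; the oddness of f comes from here. *)
Lemma theta_char_opp b :
  theta_char (- b) = - (ee (3^-1 * (\sum_i (b *m Hmx int) 0 i)%:~R) * theta_char b).
Proof.
pose one : 'rV[int]_5 := const_mx 1.
have hx : chx (- b) = - chx b + ivec R one.
  by apply/rowP => i; rewrite [RHS]rVaddE rVoppE !chxE ivecE rVoppE rmorphN [one 0 i]mxE; field.
have hy : chy (- b) = - chy b + ivec R one.
  by apply/rowP => i; rewrite [RHS]rVaddE rVoppE !chyE ivecE rVoppE rmorphN [one 0 i]mxE; field.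
rewrite /theta_char -mulNr -csumZ; last exact: theta_char_summable.
have hb : bijective (fun p : 'rV[int]_5 => - p - one).
  by exists (fun p => - p - one) => p; rewrite opprD !opprK addrK.
rewrite -(csum_bij hb); last exact: theta_term_asummable.
congr csum; apply/funext => p.
rewrite /theta_term hx hy.
have -> : ivec R (- p - one) + (- chx b + ivec R one) = - (ivec R p + chx b).
  by rewrite ivecB addrCA subrK /ivec map_mxN -opprD addrC.
have -> : qform (theta_mx tau 1) (- (ivec R p + chx b)) = qform (theta_mx tau 1) (ivec R p + chx b).
  by rewrite !qformE mulNmx dotNl dotNr opprK.
set q := ivec R p + chx b.
rewrite dotDr dotNl dotNr opprK [dot (- q) _]dotNl addrA eeD.
have -> : ee (- dot q (ivec R one)) = - ee (3^-1 * (\sum_i (b *m Hmx int) 0 i)%:~R).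
  rewrite -[RHS]mulN1r -ee_half -eeD dotE -sumrN.
  rewrite rmorph_sum mulr_sumr.
  have -> : (2^-1 : C) = (- 5%:R * 2^-1) + 3%:Z%:~R by field.
  rewrite addrAC; symmetry; apply: (@ee_congr _ _ _ (3 + \sum_i p 0 i)).
  have -> : (- 5%:R * 2^-1 : C) = \sum_(i < 5) (- 2^-1) by rewrite sumr_const card_ord -mulr_natr; ring.
  rewrite rmorphD rmorph_sum -[RHS]addrCA addrC; congr (_ + _).
  rewrite -!big_split /=; apply: eq_bigr => i _.
  rewrite intr_Hmx rVaddE chxE !ivecE [one 0 i]mxE rmorph1; ring.
by rewrite mulrC.
Qed.

End Characteristics.

(** * Inversion at levels one and three *)

Section Levels.
Variables (R : realType) (tau : 'M[R[i]]_5).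
Hypothesis tau_ball : ball4 tau.
Local Notation C := R[i].
Local Notation H := (Hmx C).
Implicit Types (b c d k p : 'rV[int]_5).

(* [hvec] is (1 + H 1)/2: it makes the shift between the two sums integral. *)
Let hvec : 'rV[int]_5 := \row_i (if hsign int i == 1 then 1 else 0).

Let hvecE i : (hvec 0 i)%:~R = 2^-1 * (1 + hsign C i).
Proof.
rewrite mxE; case: i => -[|[|[|[|[|m]]]]] hm //; rewrite /hsign /=; by field.
Qed.

Let hformE b c : (hform b c)%:~R = \sum_i (b 0 i)%:~R * hsign C i * (c 0 i)%:~R.
Proof.
rewrite /hform dotE rmorph_sum; apply: eq_bigr => i _.
by rewrite rmorphM /= intr_Hmx.
Qed.

Let even_ee b : even_sum b -> ee (- \sum_i 2^-1 * ((b 0 i)%:~R : C)) = 1.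
Proof.
case=> m hm; rewrite -mulr_sumr -rmorph_sum hm rmorphM /= mulrA mulVf ?pnatr_eq0 //.
by rewrite mul1r -rmorphN ee_int.
Qed.

Let qform_HE (v : 'rV[C]_5) : qform H v = \sum_i v 0 i * hsign C i * v 0 i.
Proof. by rewrite qformE dotE; apply: eq_bigr => i _; rewrite mul_Hmx. Qed.

(** The characteristic (x, y) of b satisfies [hvec] - y H = x, so the inverted series carries the
    same characteristic and the formula becomes an eigenvalue equation for a single theta
    constant. *)
Lemma theta_char_level1 : exists K : C, forall b, even_sum b ->
  theta_char tau b = K * ee (6^-1 * (hform b b)%:~R) * theta_char tau b.
Proof.
have [K hK] := theta_transform tau_ball (ltn0Sn 0).
(* The phase that remains at p = b = 0; it is independent of b and goes into the constant. *)
pose E : C := \sum_i 3 / 8 * hsign C i.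
exists (K * ee E) => b eb; rewrite {1}/theta_char hK.
set Q : C := 6^-1 * _.
rewrite -[K * ee E * ee Q]mulrA -[RHS]mulrA; congr (K * _).
rewrite -eeD /theta_char -csumZ; last exact: theta_char_summable.
rewrite -(csum_bij (bij_addr hvec)); last exact: dual_term_asummable.
congr csum; apply/funext => p; rewrite /dual_term /theta_term -eeD.
set x := chx R b; set y := chy R b; set q := ivec R p + x.
have -> : ivec R (p + hvec) - y *m H = q.
  apply/rowP => i; rewrite rVaddE rVoppE mul_Hmx ivecD [in RHS]rVaddE rVaddE !ivecE hvecE.
  rewrite /x /y chxE chyE.
  by case: (hsign_pm C i) => ->; field.
rewrite qform_theta_mx mul1r.
have -> : ((2 * 1%:R)^-1 : R)%:C = 2^-1 :> C by rewrite half_real mulr1.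
rewrite mulrDr -[X in ee X = _]addrA.
have -> : E + Q + (2^-1 * qform tau q + dot q y) =
  2^-1 * qform tau q + (E + Q + dot q y) by ring.
rewrite [LHS]eeD [RHS]eeD; congr (_ * _).
rewrite -[RHS]mulr1 -[X in _ = _ * X](even_ee eb) -[RHS]eeD /Q.
rewrite qform_HE hformE !dotE /E !mulr_sumr -sumrN -!big_split /=.
apply: ee_sum_congr => i.
have [M hM] := triangular_int C (p 0 i).
have -> : ivec R (p + hvec) 0 i = (p 0 i)%:~R + 2^-1 * (1 + hsign C i).
  by rewrite ivecE rVaddE rmorphD /= hvecE.
have -> : q 0 i = (p 0 i)%:~R + (2^-1 - 3^-1 * ((b 0 i)%:~R * hsign C i)).
  by rewrite /q rVaddE ivecE chxE.
rewrite mul_Hmx [x 0 i]chxE [y 0 i]chyE.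
case: (hsign_pm C i) => ->.
  exists (M + p 0 i - p 0 i * b 0 i).
  by rewrite rmorphB rmorphD rmorphM /= hM; field.
exists (- M - 2 * p 0 i - p 0 i * b 0 i).
by rewrite !rmorphB rmorphN !rmorphM /= hM; field.
Qed.

(** A theta function of 3 tau: it collects the terms of a product of three theta series whose row
    differences add up to k. *)
Definition theta_level3 b k : C :=
  csum (theta_term tau 3 (chx R b + 3^-1 *: ivec R k) (3 *: chy R b)).

Let even_ee' b : even_sum b -> ee (\sum_i 2^-1 * ((b 0 i)%:~R : C)) = 1.
Proof.
case=> m hm; rewrite -mulr_sumr -rmorph_sum hm rmorphM /= mulrA mulVf ?pnatr_eq0 //.
by rewrite mul1r ee_int.
Qed.

(** Inversion for 3 tau produces a sum over all integral n. Sorting n by residue classes modulo 3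
    gives one level three function for each representative [r s]. The constant and the phases are
    independent of k, so the relation can later be summed over k with arbitrary weights. *)
Lemma theta_level3_transform (T : finType) (r : T -> 'rV[int]_5) :
  bijective (fun u : T * 'rV[int]_5 => 3%:Z *: u.2 + r u.1) ->
  (forall s, even_sum (r s)) ->
  exists K : C, forall b k, even_sum b ->
  theta_level3 b k =
    K * \sum_s ee (3^-1 * (hform b (r s) - hform b b)%:~R) * theta_level3 (r s) k.
Proof.
move=> hr er; have [K hK] := theta_transform tau_ball (ltn0Sn 2).
(* Again the phase that remains when t, b, k and [r s] vanish. *)
pose E : C := \sum_i 9 / 8 * hsign C i.
exists (K * ee E) => b k eb; rewrite {1}/theta_level3 hK -[RHS]mulrA; congr (K * _).
set x := chx R b + _; set y := 3 *: chy R b.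
(* Chosen so that n - y H = 3 q, where q is the summation point of [theta_level3 (r s) k]. *)
pose h (u : T * 'rV[int]_5) : 'rV[int]_5 :=
  (3%:Z *: hvec + k + b *m Hmx int) - (3%:Z *: (- (u.2 *m Hmx int)) + r u.1) *m Hmx int.
have bh : bijective h.
  pose A := 3%:Z *: hvec + k + b *m Hmx int.
  have b1 : bijective (fun n : 'rV[int]_5 => A - n *m Hmx int).
    exists (fun n => (A - n) *m Hmx int) => n; first by rewrite subKr mul_HmxK.
    by rewrite mul_HmxK subKr.
  have b2 : bijective (fun u : T * 'rV[int]_5 => (u.1, - (u.2 *m Hmx int))).
    by exists (fun u => (u.1, - (u.2 *m Hmx int))) => -[s n] /=; rewrite mulNmx opprK mul_HmxK.
  exact: bij_comp b1 (bij_comp hr b2).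
rewrite (csum_residues bh); last exact: dual_term_asummable.
rewrite mulr_sumr; apply: eq_bigr => s _.
rewrite mulrA -eeD /theta_level3 -csumZ; last exact: theta_term_asummable.
congr csum; apply/funext => t; rewrite /dual_term /theta_term -eeD /h /=.
set q := ivec R t + (chx R (r s) + 3^-1 *: ivec R k).
set n := ivec R _.
have nE i : n 0 i = 3 * (t 0 i)%:~R + 3 / 2 * (1 + hsign C i) + (k 0 i)%:~R +
   hsign C i * ((b 0 i)%:~R - (r s 0 i)%:~R).
  rewrite /n ivecE rVaddE rVoppE mulmxDl -scalemxAl mulNmx mul_HmxK !rVaddE !rVscaleE rVoppE.
  rewrite !(rmorphD, rmorphN, rmorphM) /= !intr_Hmx hvecE.
  by field.
have qE i : q 0 i = (t 0 i)%:~R + (2^-1 - 3^-1 * ((r s 0 i)%:~R * hsign C i) + 3^-1 * (k 0 i)%:~R).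
  by rewrite /q rVaddE ivecE rVaddE rVscaleE ivecE chxE.
have xE i : x 0 i = 2^-1 - 3^-1 * ((b 0 i)%:~R * hsign C i) + 3^-1 * (k 0 i)%:~R.
  by rewrite /x rVaddE rVscaleE ivecE chxE.
have yE i : y 0 i = 3 * (2^-1 + 3^-1 * (b 0 i)%:~R) by rewrite /y rVscaleE chyE.
clearbody n q x y.
have -> : n - y *m H = 3 *: q.
  apply/rowP => i; rewrite rVaddE rVoppE mul_Hmx !rVscaleE nE qE yE.
  by case: (hsign_pm C i) => ->; field.
rewrite qform_theta_mx.
have c6 : ((2 * 3%:R)^-1 : R)%:C = 6^-1 :> C.
  by rewrite fmorphV rmorphM !rmorph_nat -natrM.
have -> : qform tau (3 *: q) = 9 * qform tau q.
  by rewrite !qformE -scalemxAl dotZl dotZr mulrA -natrM.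
rewrite c6; set Q := 3^-1 * _%:~R.
have -> : E + Q + (2^-1 * (3 * qform tau q) + dot q (3 *: chy R (r s))) =
  6^-1 * (9 * qform tau q) + (E + Q + dot q (3 *: chy R (r s))) by field.
rewrite mulrDr -[X in ee X = _]addrA [LHS]eeD [RHS]eeD; congr (_ * _).
rewrite -[RHS]mulr1 -[X in _ = _ * X](even_ee eb) -[RHS]mulr1 -[X in _ = _ * X](even_ee' (er s)).
rewrite -[X in _ = X * _]eeD -[RHS]eeD.
rewrite /Q rmorphB /= qform_HE !hformE !dotE /E -sumrB !mulr_sumr -sumrN -!big_split /=.
apply: ee_sum_congr => i.
have [M1 hM1] := triangular_int C (t 0 i).
have [M2 hM2] := triangular_int C (k 0 i - (r s 0 i) * hsign int i).
have -> : (3 *: chy R (r s)) 0 i = 3 * (2^-1 + 3^-1 * (r s 0 i)%:~R) by rewrite rVscaleE chyE.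
have -> : (3 *: q) 0 i = 3 * q 0 i by rewrite rVscaleE.
rewrite mul_Hmx nE xE qE.
move: hM2; rewrite rmorphB rmorphM /= hsign_int.
pose w := k 0 i - (r s 0 i) * hsign int i.
have wE : w%:~R = (k 0 i)%:~R - (r s 0 i)%:~R * hsign C i by rewrite rmorphB rmorphM /= hsign_int.
clearbody w; case: (hsign_pm C i) wE => -> wE hM2.
  exists (3 * M1 + 3 * t 0 i + 2 * t 0 i * w + 2 * w + M2 - t 0 i * b 0 i).
  rewrite !(rmorphB, rmorphD, rmorphM) /= wE hM1 hM2; by field.
exists (- 3 * M1 - 6 * t 0 i - 2 * t 0 i * w - 2 * w - M2 - t 0 i * b 0 i + (b 0 i - r s 0 i)).
rewrite !(rmorphB, rmorphD, rmorphM, rmorphN) /= wE hM1 hM2; by field.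
Qed.

End Levels.

(** * Products of three theta constants *)

Section TripleProduct.
Variables (R : realType) (tau : 'M[R[i]]_5).
Hypothesis tau_ball : ball4 tau.
Local Notation C := R[i].
Local Notation H := (Hmx C).
Implicit Types (b d k p : 'rV[int]_5).

Let tau_sym : tau^T = tau. Proof. by case: tau_ball => [[]]. Qed.

Opaque chx chy.

Let triple_exponent (s d1 d2 d3 y e : 'rV[C]_5) : d1 + d2 + d3 = 0 ->
  2^-1 * qform tau (s + d1) + dot (s + d1) y
  + (2^-1 * qform tau (s + d2) + dot (s + d2) (y + e))
  + (2^-1 * qform tau (s + d3) + dot (s + d3) (y - e)) =
  2^-1 * (qform tau d1 + qform tau d2 + qform tau d3) + dot (d2 - d3) e
  + (2^-1 * (3 * qform tau s) + dot s (3 *: y)).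
Proof.
move=> d0.
have d3E : d3 = - (d1 + d2) by apply/eqP; rewrite -addr_eq0 addrC d0.
have d30 (v : 'rV[C]_5) : dot v d3 = - (dot v d1 + dot v d2) by rewrite d3E dotNr dotDr.
have d3y (v : 'rV[C]_5) : dot d3 v = - (dot d1 v + dot d2 v) by rewrite d3E dotNl dotDl.
rewrite !qformD // !dotDl !dotDr !dotNl !dotNr dotZr !mulr2n d30 !d3y.
move: (dot (s *m tau) d1) (dot (s *m tau) d2) => A1 A2.
move: (dot d1 y) (dot d2 y) (qform tau s) => B1 B2 Q.
move: (qform tau d1) (qform tau d2) (qform tau d3) => Q1 Q2 Q3.
move: (dot s y) (dot s e) (dot d2 e) (dot d1 e) => D1 D2 D3 D4.
by field.
Qed.

Definition theta_triple (b0 b : 'rV[int]_5) : C :=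
  theta_char tau b * theta_char tau (b + b0) * theta_char tau (b - b0).

Lemma chxD b d : chx R (b + d) = chx R b - 3^-1 *: ivec R (d *m Hmx int).
Proof.
apply/rowP => i; rewrite [RHS]rVaddE rVoppE !chxE rVscaleE ivecE intr_Hmx rVaddE rmorphD /=; ring.
Qed.

Lemma chyD b d : chy R (b + d) = chy R b + 3^-1 *: ivec R d.
Proof.
apply/rowP => i; rewrite [RHS]rVaddE !chyE rVscaleE ivecE rVaddE rmorphD /=; ring.
Qed.

(* The rows of the product sum are taken as t, t + u.1, t + u.2: their mean is a
   summation point of 3 tau, and the deviations from it sum to zero, so that the
   quadratic form splits and the factor [dev_coef] does not depend on [b]. *)
Let mid (u : 'rV[int]_5 * 'rV[int]_5) : 'rV[C]_5 := 3^-1 *: ivec R (u.1 + u.2).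
Let dev1 u : 'rV[C]_5 := - mid u.
Let dev2 b0 u : 'rV[C]_5 := ivec R u.1 - mid u - 3^-1 *: ivec R (b0 *m Hmx int).
Let dev3 b0 u : 'rV[C]_5 := ivec R u.2 - mid u + 3^-1 *: ivec R (b0 *m Hmx int).
Let dev_coef b0 u : C :=
  ee (2^-1 * (qform tau (dev1 u) + qform tau (dev2 b0 u) + qform tau (dev3 b0 u))
      + dot (dev2 b0 u - dev3 b0 u) (3^-1 *: ivec R b0)).

Let theta_term1 x y p : theta_term tau 1 x y p =
  ee (2^-1 * qform tau (ivec R p + x) + dot (ivec R p + x) y).
Proof. by rewrite /theta_term qform_theta_mx mul1r. Qed.

Let theta_term_triple b0 b u t :
  theta_term tau 1 (chx R b) (chy R b) t *
  theta_term tau 1 (chx R (b + b0)) (chy R (b + b0)) (t + u.1) *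
  theta_term tau 1 (chx R (b - b0)) (chy R (b - b0)) (t + u.2) =
  dev_coef b0 u *
  theta_term tau 3 (chx R b + 3^-1 *: ivec R (u.1 + u.2)) (3 *: chy R b) t.
Proof.
have -> : chy R (b + b0) = chy R b + 3^-1 *: ivec R b0 by exact: chyD.
have -> : chy R (b - b0) = chy R b - 3^-1 *: ivec R b0.
  by rewrite chyD [ivec R (- b0)]map_mxN scalerN.
rewrite [theta_term _ 3 _ _ _]/theta_term qform_theta_mx.
rewrite -/(mid u).
have e1 := theta_term1 (chx R b) (chy R b) t.
have e2 := theta_term1 (chx R (b + b0)) (chy R b + 3^-1 *: ivec R b0) (t + u.1).
have e3 := theta_term1 (chx R (b - b0)) (chy R b - 3^-1 *: ivec R b0) (t + u.2).
rewrite e1 e2 e3 {e1 e2 e3}.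
have -> : ivec R t + chx R b = ivec R t + (chx R b + mid u) + dev1 u.
  by rewrite [in RHS]addrA addrK.
have -> : ivec R (t + u.1) + chx R (b + b0) = ivec R t + (chx R b + mid u) + dev2 b0 u.
  rewrite ivecD chxD /dev2; apply/rowP => j.
  by rewrite 2![in LHS]rVaddE [in RHS]rVaddE; rewrite !(rVaddE, rVoppE); ring.
have -> : ivec R (t + u.2) + chx R (b - b0) = ivec R t + (chx R b + mid u) + dev3 b0 u.
  rewrite chxD mulNmx [ivec R (- _)]map_mxN scalerN opprK /dev3 ivecD.
  by apply/rowP => j; rewrite !(rVaddE, rVoppE); ring.
set s := ivec R t + (chx R b + mid u).
rewrite -[X in X * _ = _]eeD -[LHS]eeD -[RHS]eeD; congr (ee _).
apply: triple_exponent; apply/rowP => j.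
rewrite /dev1 /dev2 /dev3 /mid ivecD !(rVaddE, rVoppE, rVscaleE) [RHS]mxE; by field.
Qed.

(** The weights G depend on b0 but not on b, so every linear relation between the level three
    functions in b, valid for each k, passes to the triple products. *)
Lemma has_sum_theta_triple b0 :
  exists G : 'rV[int]_5 * 'rV[int]_5 -> C, forall b,
    has_sum (fun u => G u * theta_level3 tau b (u.1 + u.2)) (theta_triple b0 b).
Proof.
exists (dev_coef b0) => b.
pose t0 := theta_term tau 1 (chx R b) (chy R b).
pose t1 := theta_term tau 1 (chx R (b + b0)) (chy R (b + b0)).
pose t2 := theta_term tau 1 (chx R (b - b0)) (chy R (b - b0)).
have s0 : asummable t0 by exact: theta_char_summable.
have s1 : asummable t1 by exact: theta_char_summable.
have s2 : asummable t2 by exact: theta_char_summable.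
have s01 : asummable (fun v : 'rV[int]_5 * 'rV[int]_5 => t0 v.1 * t1 v.2).
  case: s0 => K0 h0; case: s1 => K1 h1; exists (K0 * K1); exact: asum_le_prod.
have s012 : asummable (fun v : ('rV[int]_5 * 'rV[int]_5) * 'rV[int]_5 => t0 v.1.1 * t1 v.1.2 * t2 v.2).
  case: s01 => K0 h0; case: s2 => K1 h1; exists (K0 * K1).
  exact: (asum_le_prod h0 h1).
have := csumP s012; rewrite (csum_prod s01 s2) (csum_prod s0 s1) => hs.
pose h (v : ('rV[int]_5 * 'rV[int]_5) * 'rV[int]_5) := ((v.2, v.2 + v.1.1), v.2 + v.1.2).
have bh : bijective h.
  exists (fun w : ('rV[int]_5 * 'rV[int]_5) * 'rV[int]_5 => ((w.1.2 - w.1.1, w.2 - w.1.1), w.1.1)).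
    by move=> [[x y] z]; rewrite /h /= ![z + _]addrC !addrK.
  by move=> [[x y] z]; rewrite /h /= ![x + _]addrC !subrK.
have {hs} := has_sum_bij bh hs; rewrite /theta_triple.
pose F u t := dev_coef b0 u * theta_term tau 3 (chx R b + 3^-1 *: ivec R (u.1 + u.2)) (3 *: chy R b) t.
move=> hs; apply: (@has_sum_pair _ _ _ F) => [u|].
  apply: has_sumZ; apply: csumP; exact: theta_term_asummable.
apply: eq_has_sum hs => -[u t]; exact: theta_term_triple.
Qed.

Lemma theta_triple_transform (T : finType) (r : T -> 'rV[int]_5) :
  bijective (fun u : T * 'rV[int]_5 => 3%:Z *: u.2 + r u.1) ->
  (forall s, even_sum (r s)) ->
  exists K : C, forall b0 b, even_sum b ->
  theta_triple b0 b =
    K * \sum_s ee (3^-1 * (hform b (r s) - hform b b)%:~R) * theta_triple b0 (r s).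
Proof.
move=> hr er; have [K hK] := theta_level3_transform tau_ball hr er.
exists K => b0 b eb; have [G hG] := has_sum_theta_triple b0.
apply: has_sum_uniq (hG b) _.
apply: (@eq_has_sum _ _ (fun u => K * \sum_s ee (3^-1 * (hform b (r s) - hform b b)%:~R) *
  (G u * theta_level3 tau (r s) (u.1 + u.2)))).
  move=> u; rewrite hK // [RHS]mulrCA; congr (K * _); rewrite mulr_sumr.
  by apply: eq_bigr => s _; rewrite mulrCA.
by apply: has_sumZ; apply: has_sum_finsum => s; apply: has_sumZ.
Qed.

End TripleProduct.

Lemma lift_F3M (x y : 'F_3) : lift_F3 (x * y) = lift_F3 x * lift_F3 y.
Proof. by case: x => -[|[|[|]]] //= hx; case: y => -[|[|[|]]]. Qed.

Lemma sum_F3 (A : nmodType) (g : 'F_3 -> A) : \sum_x g x = g 0 + g 1 + g (-1).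
Proof.
rewrite (big_ord_recl 2) (big_ord_recl 1) (big_ord_recl 0) big_ord0 addr0 addrA.
by congr (g _ + g _ + g _); apply: val_inj.
Qed.

Lemma F3_cases (x : 'F_3) : [\/ x = 0, x = 1 | x = -1].
Proof.
by case: x => -[|[|[|]]] //= hx; [apply: Or31|apply: Or32|apply: Or33]; apply: val_inj.
Qed.

Lemma int_mod3 (n : int) : exists q : int, n = lift_F3 (n%:~R) + 3 * q.
Proof.
have n3 : (3 : 'F_3) = 0 by apply: val_inj.
have h3 : 0 <= (n %% 3)%Z < 3 by rewrite modz_ge0 // ltz_pmod.
have hn := divz_eq n 3.
have e : (n%:~R : 'F_3) = ((n %% 3)%Z)%:~R.
  by rewrite {1}hn rmorphD rmorphM /= -[3%:~R]/(3 : 'F_3) n3 mulr0 add0r.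
rewrite e; move: h3 hn; set m := (n %% 3)%Z; set q := (n %/ 3)%Z.
case: m => // -[|[|[|m]]] // _ ->.
- by exists q; rewrite mulrC addrC.
- by exists q; rewrite mulrC addrC.
- by exists (q + 1); rewrite -[lift_F3 _]/(-1 : int); ring.
Qed.

Lemma eq_mod3 (m n : int) : (m%:~R = n%:~R :> 'F_3) -> exists q : int, m = n + 3 * q.
Proof.
move=> e; have [q hq] := int_mod3 (m - n); exists q.
by move: hq; rewrite rmorphB /= e subrr /= => /eqP; rewrite subr_eq addrC => /eqP ->; rewrite add0r.
Qed.

(** * Fourier analysis over F_3 *)

Section Character.
Variable R : realType.
Local Notation C := R[i].

Definition chi3 (x : 'F_3) : C := ee (3^-1 * (lift_F3 x)%:~R).

Lemma chi3_int (n : int) : ee (3^-1 * n%:~R) = chi3 n%:~R.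
Proof.
have [q hq] := int_mod3 n; rewrite {1}hq /chi3; apply: (@ee_congr _ _ _ q).
by rewrite rmorphD rmorphM /= mulrDr mulKf // pnatr_eq0.
Qed.

Lemma chi3D x y : chi3 (x + y) = chi3 x * chi3 y.
Proof. by rewrite -[RHS]eeD -mulrDr -rmorphD chi3_int rmorphD /= !lift_F3K. Qed.

Lemma chi30 : chi3 0 = 1.
Proof. by rewrite /chi3 /= mulr0 ee0. Qed.

Lemma chi31 : chi3 1 != 1.
Proof.
rewrite /chi3 /= mulr1; apply/eqP => /(congr1 (@complex.Im R)).
rewrite (_ : 3^-1 = (3^-1)%:C :> C); last by rewrite fmorphV rmorph_nat.
rewrite eeE /= mulr0 oppr0 expR0 mul1r mul0r addr0.
have p0 := @pi_gt0 R; apply/eqP; rewrite gt_eqF // sin_gt0_pi //.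
by apply/andP; split; lra.
Qed.

End Character.

Section FiniteFourier.
Variables (A : numFieldType) (chi : 'F_3 -> A).
Hypotheses (chiD : forall x y, chi (x + y) = chi x * chi y) (chi0 : chi 0 = 1).
Hypothesis chi1 : chi 1 != 1.
Local Notation V := 'rV['F_3]_5.
Implicit Types (f : V -> A).

Let chiN1 : chi (-1) = chi 1 * chi 1.
Proof. by rewrite -chiD; congr chi; apply: val_inj. Qed.

Let chi_cube : chi 1 * chi 1 * chi 1 = 1.
Proof. by rewrite -chiN1 -chiD addNr. Qed.

Lemma sum_cube_roots : 1 + chi 1 + chi (-1) = 0.
Proof.
have : (chi 1 - 1) * (1 + chi 1 + chi (-1)) = 0.
  by rewrite chiN1 -[RHS](subrr 1) -[X in _ = X - 1]chi_cube; ring.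
by move/eqP; rewrite mulf_eq0 subr_eq0 (negbTE chi1) => /eqP.
Qed.

Lemma chi_neq1 x : x != 0 -> chi x != 1.
Proof.
case: (F3_cases x) => -> //; rewrite ?eqxx // => _.
apply: contra chi1 => /eqP h; move: chi_cube.
by rewrite -chiN1 h mul1r => ->.
Qed.

(** The difference is the quadratic Gauss sum modulo 3. *)
Lemma chi_diff_sqr : (chi 1 - chi (-1)) ^+ 2 = - 3.
Proof.
have h := sum_cube_roots; have e : chi (-1) = - (1 + chi 1) by apply/eqP; rewrite -addr_eq0 addrC h.
have q : chi 1 * chi 1 = - (1 + chi 1) by rewrite -chiN1.
have -> : (chi 1 - chi (-1)) ^+ 2 = 4 * (chi 1 * chi 1) + 4 * chi 1 + 1 by rewrite e; ring.
by rewrite q; ring.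
Qed.

Lemma sum_character (y : V) : \sum_w chi (- dot w y) = if y == 0 then (3 ^ 5)%:R else 0.
Proof.
case: eqP => [->|/eqP y0].
  under eq_bigr do rewrite dotC dot0l oppr0 chi0.
  by rewrite sumr_const card_mx card_ord /= mul1n.
have [i yi] : exists i, y 0 i != 0.
  by apply/existsP; apply: contra_neqT y0 => /existsPn h; apply/rowP => i; rewrite mxE; apply/eqP/negPn/h.
set S := LHS.
have : S = chi (- y 0 i) * S.
  rewrite {1}/S (reindex_inj (addrI (delta_mx 0 i))) mulr_sumr; apply: eq_bigr => w _.
  rewrite -chiD -opprD dotDl; congr (chi (- (_ + _))).
  by rewrite dotE (bigD1 i) //= big1 ?addr0 => [|j ji]; rewrite mxE ?eqxx ?mul1r // (negbTE ji) mul0r.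
move/eqP; rewrite -subr_eq0 -{1}[S]mul1r -mulrBl mulf_eq0 subr_eq0 eq_sym.
by rewrite (negbTE (chi_neq1 _)) ?oppr_eq0 // => /eqP.
Qed.

Definition fourier f (v : V) := \sum_w chi (- dot v w) * f w.

Lemma fourierK f v : fourier (fourier f) v = (3 ^ 5)%:R * f (- v).
Proof.
transitivity (\sum_w \sum_x chi (- dot x (v + w)) * f w).
  rewrite /fourier exchange_big /=; apply: eq_bigr => x _.
  rewrite mulr_sumr; apply: eq_bigr => w _.
  by rewrite mulrA -chiD -opprD dotDr [dot v x]dotC.
transitivity (\sum_w (\sum_x chi (- dot x (v + w))) * f w).
  by apply: eq_bigr => w _; rewrite mulr_suml.
have e w : (\sum_x chi (- dot x (v + w))) * f w = if w == - v then (3 ^ 5)%:R * f w else 0.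
  by rewrite sum_character addrC addr_eq0; case: eqP => _; rewrite ?mul0r.
by under eq_bigr do rewrite e; rewrite -big_mkcond big_pred1_eq.
Qed.

Lemma sum_image (T U : finType) (h : U -> T) (F : T -> A) : injective h ->
  (forall t, F t != 0 -> exists u, t = h u) -> \sum_t F t = \sum_u F (h u).
Proof.
move=> hi hF; rewrite (bigID (mem (codom h))) /= [X in _ + X]big1 ?addr0; last first.
  by move=> t; apply: contraNeq => /hF[u ->]; exact: codom_f.
rewrite -big_uniq; last exact/injectiveP.
by rewrite big_map big_enum.
Qed.

Lemma scaleF3_sign (f : V -> A) (x : 'F_3) (v : V) : (forall v, f (- v) = - f v) ->
  f (x *: v) = (lift_F3 x)%:~R * f v.
Proof.
move=> odd; have f0 : f 0 = 0.
  have := odd 0; rewrite oppr0 => /eqP; rewrite -subr_eq0 opprK -mulr2n mulrn_eq0 /=.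
  by move/eqP.
case: (F3_cases x) => ->; rewrite ?scale0r ?scale1r ?scaleN1r ?odd ?f0 /lift_F3 /=.
- by rewrite mul0r.
- by rewrite mul1r.
- by rewrite mulN1r.
Qed.

Section HyperbolicPair.
Variables (f : V -> A) (K : A) (v0 a b : V).
Hypothesis f_transform : forall v, f v = K * \sum_w chi (dot v v - dot v w) * f w.
Hypothesis f_odd : forall v, f (- v) = - f v.
Hypothesis f_supp : forall w, f w != 0 -> dot w w = 0 /\ dot w v0 = 0.
Hypotheses (v00 : v0 != 0) (qa : dot a a = 0) (qb : dot b b = 0).
Hypotheses (av0 : dot a v0 = 0) (bv0 : dot b v0 = 0) (ab : dot a b = 1).
Hypothesis max_a : forall w, dot w w = 0 -> dot w v0 = 0 -> dot a w = 0 ->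
  exists i j, w = i *: a + j *: v0.
Hypothesis max_b : forall w, dot w w = 0 -> dot w v0 = 0 -> dot b w = 0 ->
  exists i j, w = i *: b + j *: v0.
Hypothesis gram : forall w, dot w w = 0 -> dot w v0 = 0 ->
  dot a w != 0 -> dot b w != 0 -> dot a w = dot b w.

Let fE v : f v = K * fourier f v.
Proof.
case: (eqVneq (f v) 0) => [fv|/f_supp[qv _]]; last first.
  by rewrite f_transform qv; under eq_bigr do rewrite sub0r.
rewrite fv; have := f_transform v; rewrite fv.
have -> : \sum_w chi (dot v v - dot v w) * f w = chi (dot v v) * fourier f v.
  by rewrite /fourier mulr_sumr; apply: eq_bigr => w _; rewrite chiD mulrA.
rewrite mulrCA => /esym/eqP; rewrite mulf_eq0 => /orP[/eqP h|/eqP ->] //.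
have := chiD (dot v v) (- dot v v); rewrite h subrr chi0 mul0r => /eqP.
by rewrite oner_eq0.
Qed.

Let K_sqr : (exists v, f v != 0) -> K ^+ 2 * (3 ^ 5)%:R = -1.
Proof.
case=> v fv; have : f v = - (K ^+ 2 * (3 ^ 5)%:R) * f v.
  rewrite {1}fE {1}/fourier; under eq_bigr do rewrite fE mulrCA.
  by rewrite -mulr_sumr -/(fourier (fourier f) v) fourierK f_odd; ring.
move/eqP; rewrite -subr_eq0 -{1}[f v]mul1r -mulrBl mulf_eq0 (negbTE fv) orbF opprK addrC.
by rewrite addr_eq0 => /eqP.
Qed.

(** The support of f is orthogonal to v0, and f is a multiple of its own Fourier transform. *)
Let f_v0 v j : f (v + j *: v0) = f v.
Proof.
rewrite !fE; congr (K * _); apply: eq_bigr => w _.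
case: (eqVneq (f w) 0) => [->|/f_supp[_ wv]]; first by rewrite !mulr0.
by rewrite dotDl dotZl [dot v0 w]dotC wv mulr0 addr0.
Qed.

Let t w := (chi (- dot a w) - chi (- dot b w)) * f w.

(** The vector e separates the coefficient of c from that of v0, so the plane is parametrised
    without repetition. *)
Let sum_line c (F : V -> A) : dot c v0 = 0 -> (exists e, dot c e = 1 /\ dot e v0 = 0) ->
  (forall w, F w != 0 -> exists i j, w = i *: c + j *: v0) ->
  \sum_w F w = \sum_i \sum_j F (i *: c + j *: v0).
Proof.
move=> cv0 [e [ce ev0]] hF.
rewrite pair_bigA; apply: (@sum_image _ _ (fun u => u.1 *: c + u.2 *: v0)).
  move=> [i j] [i' j'] /= h; have := congr1 (dot e) h.
  rewrite !dotDr !dotZr ev0 [dot e c]dotC ce !mulr0 !addr0 !mulr1 => ii.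
  move: h; rewrite ii => /addrI/eqP; rewrite -subr_eq0 -scalerBl scaler_eq0 (negbTE v00) orbF.
  by rewrite subr_eq0 => /eqP ->.
by move=> w /hF[i [j ->]]; exists (i, j).
Qed.

Let t_supp w : t w != 0 ->
  [/\ dot w w = 0, dot w v0 = 0 & dot a w != dot b w].
Proof.
rewrite /t mulf_eq0 negb_or subr_eq0 => /andP[h /f_supp[-> ->]]; split=> //.
by apply: contraNneq h => ->.
Qed.

Let sum3 (x : A) : \sum_(j : 'F_3) x = 3 * x.
Proof. by rewrite sum_F3; ring. Qed.

Lemma hyperbolic_pair_eq : f a = f b.
Proof.
have [/existsP fn|fz] := boolP [exists v, f v != 0]; last first.
  move: fz => /existsPn fz; have z v : f v = 0 by apply/eqP/negPn/fz.
  by rewrite !z.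
have K2 := K_sqr fn.
pose l := 3 * K * (chi 1 - chi (-1)).
have l2 : l ^+ 2 = 9^-1.
  rewrite /l !exprMn chi_diff_sqr.
  have -> : K ^+ 2 = - ((3 ^ 5)%:R)^-1.
    by apply: (mulIf (x := (3 ^ 5)%:R)); rewrite ?pnatr_eq0 // K2 mulNr mulVf ?pnatr_eq0.
  by rewrite natrX; field.
have l1 : 1 - l != 0.
  apply/eqP => h; have {h} l1 : l = 1 by apply/eqP; rewrite eq_sym -subr_eq0 h.
  move: l2; rewrite l1 expr1n => /eqP; rewrite eq_sym invr_eq1.
  by rewrite (eqr_nat _ 9 1).
suff h : f a - f b = l * (f a - f b).
  apply/eqP; rewrite -subr_eq0; move/eqP: h; rewrite -subr_eq0 -{1}[f a - f b]mul1r -mulrBl.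
  by rewrite mulf_eq0 (negbTE l1).
transitivity (K * \sum_w t w).
  rewrite !fE -mulrBr; congr (K * _); rewrite /fourier -sumrB.
  by apply: eq_bigr => w _; rewrite /t mulrBl.
(* If a.w = 0 then w lies in the plane of a and v0; otherwise [t w] nonzero forces b.w = 0, by
   [gram], and w lies in the plane of b and v0. *)
have -> : \sum_w t w = \sum_w (if dot a w == 0 then t w else 0)
    + \sum_w (if dot a w == 0 then 0 else t w).
  by rewrite -big_split /=; apply: eq_bigr => w _; case: eqP; rewrite ?addr0 ?add0r.
rewrite (sum_line (c := a)) //; last first.
- move=> w; case: (eqVneq (dot a w) 0) => [aw|]; last by rewrite eqxx.
  by case/t_supp=> qw wv _; exact: max_a.
- by exists b.
rewrite (sum_line (c := b)) //; last first.
- move=> w; case: (eqVneq (dot a w) 0) => [|aw]; first by rewrite eqxx.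
  case/t_supp=> qw wv abw; apply: max_b => //.
  by apply/eqP; apply: contraNT abw => bw; rewrite gram.
- by exists a; rewrite dotC.
have ea i j : (if dot a (i *: a + j *: v0) == 0 then t (i *: a + j *: v0) else 0) =
    (1 - chi (- i)) * (lift_F3 i)%:~R * f a.
  rewrite /t f_v0 scaleF3_sign // !dotDr !dotZr qa av0 bv0 [dot b a]dotC ab !mulr0 !addr0 eqxx.
  by rewrite mulr1 oppr0 chi0 mulrA.
have eb i j : (if dot a (i *: b + j *: v0) == 0 then 0 else t (i *: b + j *: v0)) =
    (chi (- i) - 1) * (lift_F3 i)%:~R * f b.
  rewrite /t f_v0 scaleF3_sign // !dotDr !dotZr qb av0 bv0 ab !mulr0 !addr0 mulr1.
  rewrite oppr0 chi0 mulrA; case: eqP => // ->.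
  by rewrite oppr0 chi0 subrr !mul0r.
under eq_bigr do (under eq_bigr do rewrite ea); under [X in _ + X]eq_bigr do (under eq_bigr do rewrite eb).
under eq_bigr do rewrite sum3; under [X in _ + X]eq_bigr do rewrite sum3.
rewrite !sum_F3 oppr0 opprK chi0 /l.
have [-> -> ->] : [/\ lift_F3 0 = 0, lift_F3 1 = 1 & lift_F3 (-1) = -1] by [].
by ring.
Qed.

End HyperbolicPair.

End FiniteFourier.

(** * Characteristics modulo 3 *)

Section Residues3.
Implicit Types (b d p : 'rV[int]_5).
Local Notation V := 'rV['F_3]_5.

Definition red3 (p : 'rV[int]_5) : V := map_mx intr p.

Definition root_mx : 'M['F_3]_5 := \matrix_(i, j) (rvec i 0 j)%:~R.

(** The representative is taken in the image of [beta_tilde] because coordinate sums are even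
    there. *)
Definition rep3 (v : V) : 'rV[int]_5 := beta_tilde (map_mx lift_F3 v).

Lemma red3D p d : red3 (p + d) = red3 p + red3 d. Proof. exact: map_mxD. Qed.

Lemma red3N p : red3 (- p) = - red3 p. Proof. exact: map_mxN. Qed.

Lemma red3_lift (v : V) : red3 (map_mx lift_F3 v) = v.
Proof. by apply/rowP => i; rewrite !mxE lift_F3K. Qed.

Lemma red3_beta vt : red3 (beta_tilde vt) = red3 vt *m root_mx^T.
Proof.
apply/rowP => i; rewrite !mxE dotE rmorph_sum; apply: eq_bigr => j _.
by rewrite !mxE rmorphM mulrC.
Qed.

Lemma red3_rep v : red3 (rep3 v) = v *m root_mx^T.
Proof. by rewrite red3_beta red3_lift. Qed.

(** Modulo 3 the matrix of the r_i carries the standard form to minus the form of H; this identifies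
    the phases of [hform] with characters of v.w. *)
Lemma root_mxK : root_mx^T *m Hmx _ *m root_mx = - 1%:M.
Proof.
apply/matrixP => i j; rewrite HmxE mul_mx_diag !mxE !big_ord_recl big_ord0 !mxE /hsign.
case: i => -[|[|[|[|[|i]]]]] // hi; case: j => -[|[|[|[|[|j]]]]] // hj; apply: val_inj; by vm_compute.
Qed.

Lemma root_mxKr : root_mx^T *m - (Hmx _ *m root_mx) = 1%:M.
Proof. by rewrite mulmxN mulmxA root_mxK opprK. Qed.

Lemma even_sum_beta vt : even_sum (beta_tilde vt).
Proof.
pose u i := vt 0 i.
(* The vectors r_1, ..., r_5 add up to (2, 2, 0, 0, -2). *)
exists (u ord0 + u (lift ord0 ord0) - u ord_max).
rewrite /beta_tilde.
transitivity (\sum_j (\sum_i rvec i 0 j) * vt 0 j).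
  under eq_bigr do rewrite mxE dotE.
  by rewrite exchange_big /=; apply: eq_bigr => j _; rewrite mulr_suml.
rewrite !big_ord_recl !big_ord0 /=  !mxE /=.
rewrite -!/(u _).
have -> : ord_max = lift ord0 (lift ord0 (lift ord0 (lift ord0 ord0))) :> 'I_5 by apply: val_inj.
ring.
Qed.

Lemma hform_red3 b d : (hform b d)%:~R = dot (red3 b *m Hmx _) (red3 d).
Proof.
rewrite /hform !dotE rmorph_sum; apply: eq_bigr => i _.
by rewrite rmorphM /= intr_Hmx mul_Hmx !mxE.
Qed.

Lemma dot_root (v w : V) : dot (v *m root_mx^T *m Hmx _) (w *m root_mx^T) = - dot v w.
Proof.
by rewrite [dot _ (w *m _)]dotC dot_mxl trmxK dotC -!mulmxA [root_mx^T *m _]mulmxA root_mxK mulmxN mulmx1 dotNl.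
Qed.

Lemma hform_rep3 v w : (hform (rep3 v) (rep3 w))%:~R = - dot v w.
Proof. by rewrite hform_red3 !red3_rep dot_root. Qed.

(** [root_mx] is invertible modulo 3, so the [rep3 v] represent each class of Z^5 modulo 3 once: the
    system required by the level three transform. *)
Lemma rep3_bij : bijective (fun u : V * 'rV[int]_5 => 3%:Z *: u.2 + rep3 u.1).
Proof.
have n3 : (3%:Z%:~R : 'F_3) = 0 by apply: val_inj.
have red3Z (d : 'rV[int]_5) : red3 (3%:Z *: d) = 0.
  by apply/rowP => i; rewrite !mxE rmorphM /= n3 mul0r.
pose g (p : 'rV[int]_5) : V := red3 p *m - (Hmx _ *m root_mx).
have gr v : g (rep3 v) = v by rewrite /g red3_rep -mulmxA root_mxKr mulmx1.
have gK (p : 'rV[int]_5) : red3 (rep3 (g p)) = red3 p.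
  by rewrite red3_rep /g -mulmxA (mulmx1C root_mxKr) mulmx1.
have /boolp.choice[q hq] : forall p, exists q : 'rV[int]_5, p = 3%:Z *: q + rep3 (g p).
  move=> p; have /boolp.choice[q hq] : forall i, exists x, p 0 i = rep3 (g p) 0 i + 3 * x.
    by move=> i; apply: eq_mod3; have /rowP/(_ i) := gK p; rewrite !mxE.
  by exists (\row_i q i); apply/rowP => i; rewrite rVaddE rVscaleE mxE hq addrC.
exists (fun p => (g p, q p)) => [[v d] /=|p /=]; last by rewrite [RHS]hq.
have gv : g (3%:Z *: d + rep3 v) = v by rewrite /g red3D red3Z add0r -/(g _) gr.
congr (_, _) => //; have := hq (3%:Z *: d + rep3 v).
rewrite gv => /addIr /rowP h; apply/rowP => i; have := h i; rewrite !rVscaleE.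
by move=> e; apply/esym; exact: mulfI _ e.
Qed.

End Residues3.

(** * Theta constants as functions on F_3^5 *)

Section ThetaModulo3.
Variables (R : realType) (tau : 'M[R[i]]_5).
Hypothesis tau_ball : ball4 tau.
Local Notation C := R[i].
Local Notation V := 'rV['F_3]_5.
Implicit Types (b d p : 'rV[int]_5).

Let theta_tripleE b0 b : theta_triple tau b0 b =
  theta_char tau b * theta_char tau (b + b0) * theta_char tau (b - b0).
Proof. by []. Qed.

Opaque theta_char theta_triple.

Lemma even_sumD b d : even_sum b -> even_sum d -> even_sum (b + d).
Proof.
case=> m hm [n hn]; exists (m + n); under eq_bigr do rewrite rVaddE.
by rewrite big_split /= hm hn mulrDr.
Qed.

Lemma even_sumN b : even_sum b -> even_sum (- b).
Proof.
case=> m hm; exists (- m); under eq_bigr do rewrite rVoppE.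
by rewrite sumrN hm mulrN.
Qed.

Lemma even_rep3 v : even_sum (rep3 v). Proof. exact: even_sum_beta. Qed.

(** As 3 is odd, the quotient p inherits evenness from b and d. *)
Lemma red3_eq b d : even_sum b -> even_sum d -> red3 b = red3 d ->
  exists2 p, even_sum p & b = d + 3%:Z *: p.
Proof.
move=> [m hm] [n hn] /rowP e.
have /boolp.choice[q hq] : forall i, exists x, b 0 i = d 0 i + 3 * x.
  by move=> i; apply: eq_mod3; have := e i; rewrite !mxE.
have s : \sum_i b 0 i = \sum_i d 0 i + 3 * \sum_i q i.
  by rewrite mulr_sumr -big_split /=; apply: eq_bigr.
exists (\row_i q i); last by apply/rowP => i; rewrite rVaddE rVscaleE mxE hq.
exists (m - n - \sum_i q i); under eq_bigr do rewrite mxE.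
move: s; rewrite hm hn; set Q := \sum_i _ => s; lia.
Qed.

(** Consequently the factor in [theta_char_shift] is a cube root of unity when p has an even sum;
    for odd sums the halves in [chx] would add a sign. *)
Lemma chx_dot_int b p : even_sum p ->
  exists m : int, 3 * dot (chx R b) (ivec R p) = m%:~R.
Proof.
case=> m hm; exists (3 * m - hform p b).
have e : \sum_i (p 0 i)%:~R = 2 * m%:~R :> C by rewrite -rmorph_sum hm rmorphM.
rewrite rmorphB rmorphM /= /hform !dotE rmorph_sum /= mulr_sumr.
have -> : 3%:~R * m%:~R = \sum_i (3 / 2 * (p 0 i)%:~R) :> C by rewrite -mulr_sumr e; by field.
rewrite -sumrB; apply: eq_bigr => i _.
rewrite chxE ivecE rmorphM /= intr_Hmx; by field.
Qed.

Let ee_cube (z : C) (m : int) : 3 * z = m%:~R -> ee z ^+ 3 = 1.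
Proof. by move=> h; rewrite eeX -mulr_natl h ee_int. Qed.

Lemma theta_char_cube_mod3 b d : even_sum b -> even_sum d -> red3 b = red3 d ->
  theta_char tau b ^+ 3 = theta_char tau d ^+ 3.
Proof.
move=> eb ed /(red3_eq eb ed)[p ep ->].
have [m hm] := chx_dot_int d ep.
by rewrite theta_char_shift // exprMn (ee_cube hm) mul1r.
Qed.

Lemma theta_char_eq0_mod3 b d : even_sum b -> even_sum d -> red3 b = red3 d ->
  theta_char tau b = 0 -> theta_char tau d = 0.
Proof.
move=> eb ed h e; have := theta_char_cube_mod3 eb ed h.
by rewrite e expr0n => /esym/eqP; rewrite expf_eq0 => /eqP.
Qed.

Lemma theta_triple_mod3 b0 b d : even_sum b -> even_sum d -> red3 b = red3 d ->
  theta_triple tau b0 b = theta_triple tau b0 d.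
Proof.
move=> eb ed /(red3_eq eb ed)[p ep ->].
have [m hm] := chx_dot_int d ep.
have sh x : theta_char tau (d + 3%:Z *: p + x) =
    ee (dot (chx R d) (ivec R p) - 3^-1 * dot (ivec R (x *m Hmx int)) (ivec R p)) * theta_char tau (d + x).
  by rewrite addrAC theta_char_shift // chxD dotDl dotNl dotZl.
rewrite !theta_tripleE !sh theta_char_shift // mulNmx [ivec R (- _)]map_mxN dotNl.
move: hm; move: (dot (chx R d) (ivec R p)) (dot (ivec R (b0 *m _)) (ivec R p)) => X Y hm.
have e : ee X * ee (X - 3^-1 * Y) * ee (X - 3^-1 * - Y) = 1.
  rewrite -!eeD -(ee_int R m) -hm; congr (ee _); ring.
move: (theta_char tau d) (theta_char tau (d + b0)) (theta_char tau (d - b0)) => x y z.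
move: e; move: (ee X) (ee (X - 3^-1 * Y)) (ee (X - 3^-1 * - Y)) => p1 p2 p3 e.
transitivity (p1 * p2 * p3 * (x * y * z)); first by ring.
by rewrite e mul1r.
Qed.

(** The phases of the three factors multiply to e(3 s(b)) = 1, and three minus signs remain. *)
Lemma theta_triple_opp b0 b : theta_triple tau b0 (- b) = - theta_triple tau b0 b.
Proof.
rewrite !theta_tripleE.
have -> : - b + b0 = - (b - b0) by rewrite opprB addrC.
rewrite -opprD !theta_char_opp //.
pose s (x : 'rV[int]_5) : C := 3^-1 * (\sum_i (x *m Hmx int) 0 i)%:~R.
rewrite -!/(s _).
have sD x y : s (x + y) = s x + s y.
  rewrite /s -mulrDr -rmorphD -big_split /=; congr (_ * _%:~R); apply: eq_bigr => i _.
  by rewrite mulmxDl rVaddE.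
have sN x : s (- x) = - s x.
  rewrite /s -mulrN -rmorphN -sumrN /=; congr (_ * _%:~R); apply: eq_bigr => i _.
  by rewrite mulNmx rVoppE.
have e : ee (s b) * ee (s (b - b0)) * ee (s (b + b0)) = 1.
  rewrite -!eeD !sD sN -(ee_int R (\sum_i (b *m Hmx int) 0 i)); congr (ee _).
  have -> : (\sum_i (b *m Hmx int) 0 i)%:~R = 3 * s b by rewrite /s; field.
  ring.
move: (theta_char tau b) (theta_char tau (b - b0)) (theta_char tau (b + b0)) => X Y Z.
move: e; move: (ee (s b)) (ee (s (b - b0))) (ee (s (b + b0))) => x y z e.
transitivity (- (x * y * z) * (X * Z * Y)); first by ring.
by rewrite e mulN1r.
Qed.

Definition theta_F3 (v : V) : C := theta_char tau (rep3 v).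

Lemma theta_F3E v : theta_F3 v = theta_char tau (rep3 v). Proof. by []. Qed.

Opaque rep3 red3 theta_F3.

Lemma Theta3_red vt : Theta3 vt tau = theta_F3 (red3 vt) ^+ 3.
Proof.
have e : red3 (beta_tilde vt) = red3 (rep3 (red3 vt)) by rewrite red3_beta red3_rep.
rewrite theta_F3E (Theta3E tau_ball).
exact: theta_char_cube_mod3 (even_sum_beta vt) (even_rep3 _) e.
Qed.

Lemma theta_F3N v : theta_F3 (- v) ^+ 3 = - theta_F3 v ^+ 3.
Proof.
have e : red3 (rep3 (- v)) = red3 (- rep3 v) by rewrite red3N !red3_rep mulNmx.
rewrite !theta_F3E.
transitivity (theta_char tau (- rep3 v) ^+ 3).
  exact: (theta_char_cube_mod3 (even_rep3 _) (even_sumN (even_rep3 v)) e).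
rewrite (theta_char_opp tau_ball) exprNn exprMn.
rewrite (@ee_cube _ (\sum_i (rep3 v *m Hmx int) 0 i)); last by field.
by rewrite mul1r -signr_odd /= expr1 mulN1r.
Qed.

Lemma theta_triple_cube v0 v : theta_triple tau (rep3 v0) (rep3 v) ^+ 3 =
  theta_F3 v ^+ 3 * theta_F3 (v + v0) ^+ 3 * theta_F3 (v - v0) ^+ 3.
Proof.
have ev := even_rep3 v; have e0 := even_rep3 v0.
have e1 : red3 (rep3 v + rep3 v0) = red3 (rep3 (v + v0)).
  by rewrite red3D !red3_rep mulmxDl.
have e2 : red3 (rep3 v - rep3 v0) = red3 (rep3 (v - v0)).
  by rewrite red3D red3N !red3_rep mulmxBl.
have h1 := theta_char_cube_mod3 (even_sumD ev e0) (even_rep3 _) e1.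
have h2 := theta_char_cube_mod3 (even_sumD ev (even_sumN e0)) (even_rep3 _) e2.
have E (x y z : C) : (x * y * z) ^+ 3 = x ^+ 3 * y ^+ 3 * z ^+ 3 by rewrite !exprMn.
rewrite theta_tripleE E !theta_F3E.
exact: (f_equal2 (fun x y : C => x * y) (f_equal2 (fun x y : C => x * y) erefl h1) h2).
Qed.

(** Modulo 2 each square b_i^2 equals b_i and the signs of H disappear. Hence the phase with
    denominator 6 at level one is a cube root of unity. *)
Lemma hform_even b : even_sum b -> exists m, hform b b = 2 * m.
Proof.
case=> n hn.
have /boolp.choice[q hq] : forall i, exists x, (b *m Hmx int) 0 i * b 0 i = b 0 i + 2 * x.
  move=> i; rewrite mul_Hmx.
  have [q hq] : exists q : int, b 0 i = 2 * q \/ b 0 i = 2 * q + 1 by exists (divz (b 0 i) 2); lia.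
  case: (hsign_pm int i) => ->; case: hq => ->.
  - exists (2 * q * q - q); ring.
  - exists (2 * q * q + q); ring.
  - exists (- 2 * q * q - q); ring.
  - exists (- 2 * q * q - 3 * q - 1); ring.
exists (n + \sum_i q i); rewrite /hform dotE mulrDr -hn mulr_sumr -big_split /=.
by apply: eq_bigr.
Qed.

Lemma theta_F3_dichotomy : (forall v, dot v v = 0 -> theta_F3 v = 0) \/
  (forall v, dot v v != 0 -> theta_F3 v = 0).
Proof.
have [K hK] := theta_char_level1 tau_ball.
have {}hK v : theta_F3 v = K * chi3 R (dot v v) * theta_F3 v.
  rewrite {1}theta_F3E hK; last exact: even_rep3.
  rewrite -theta_F3E; congr (_ * _ * _); have [m hm] := hform_even (even_rep3 v).
  have -> : dot v v = m%:~R.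
    have := hform_rep3 v v; rewrite hm rmorphM /=.
    have -> : 2%:~R = -1 :> 'F_3 by apply: val_inj.
    by rewrite mulN1r => /oppr_inj.
  rewrite -chi3_int hm rmorphM /=; congr (ee _); by field.
have [[v [qv tv]]|h] := pselect (exists v, dot v v = 0 /\ theta_F3 v <> 0); last first.
  by left=> v qv; apply: contrapT => tv; apply: h; exists v.
right=> w qw; have K1 : K = 1.
  have := hK v; rewrite qv chi30 mulr1 -{1}[theta_F3 v]mul1r => /(mulIf _) <- //; exact/eqP.
have := hK w; rewrite K1 mul1r => /eqP; rewrite -subr_eq0 -{1}[theta_F3 w]mul1r -mulrBl.
rewrite mulf_eq0 subr_eq0 eq_sym => /orP[|/eqP ->]; last by [].
by rewrite (negbTE (chi_neq1 (@chi3D R) (chi30 R) (chi31 R) qw)).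
Qed.

End ThetaModulo3.

Opaque theta_char theta_triple rep3 red3 theta_F3 beta_tilde.

(** * Gram determinants *)

Section GramDeterminant.
Variable A : comNzRingType.

Lemma det_nat_recl n (g : nat -> nat -> A) :
  \det (\matrix_(i < n.+1, j < n.+1) g i j) =
  \sum_(j < n.+1) g 0%N j * ((-1) ^+ j * \det (\matrix_(i < n, k < n) g i.+1 (bump j k))).
Proof.
rewrite (expand_det_row _ ord0); apply: eq_bigr => j _; rewrite mxE; congr (_ * _).
rewrite /cofactor add0n; congr (_ * \det _).
by apply/matrixP => i k; rewrite !mxE.
Qed.

(* Laplace expansion in a form that [simpl] evaluates for a concrete size. *)
Fixpoint skip (j k : nat) : nat :=
  match j, k with 0, _ => k.+1 | _.+1, 0 => 0 | j'.+1, k'.+1 => (skip j' k').+1 end.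

Fixpoint laplace n (g : nat -> nat -> A) : A :=
  if n is m.+1 then
    foldr (fun j s => g 0%N j * ((-1) ^+ j * laplace m (fun i k => g i.+1 (skip j k))) + s)
      0 (iota 0 m.+1)
  else 1.

Lemma skipE j k : skip j k = bump j k.
Proof.
by elim: j k => [|j IH] [|k] //=; rewrite IH /bump ltnS addnS.
Qed.

Lemma laplaceE n (g : nat -> nat -> A) : \det (\matrix_(i < n, j < n) g i j) = laplace n g.
Proof.
elim: n g => [|n IH] g; first by rewrite det_mx00.
rewrite det_nat_recl; have -> : laplace n.+1 g =
  foldr (fun j s => g 0%N j * ((-1) ^+ j * laplace n (fun i k => g i.+1 (skip j k))) + s)
    0 (iota 0 n.+1) by [].
rewrite -(big_mkord xpredT (fun j => g 0%N j * ((-1) ^+ j * \det (\matrix_(i < n, k < n) g i.+1 (bump j k))))).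
rewrite /index_iota subn0 unlock; elim: (iota 0 n.+1) => //= j s ->.
rewrite (IH (fun i k => g i.+1 (bump j k))).
by have -> : bump j = skip j by apply/funext => k; rewrite skipE.
Qed.

(** Five vectors in dimension five have a square as Gram determinant. The row of v0 is (0, 1, 0, 0,
    0), so the unknown products of u drop out, and what remains is -1 times the determinant of a, b,
    w, that is -2 (a.w)(b.w). *)
Lemma gram_hyperbolic (v0 u a b w : 'rV[A]_5) :
  dot v0 u = 1 -> dot v0 v0 = 0 -> dot a a = 0 -> dot b b = 0 -> dot w w = 0 ->
  dot a v0 = 0 -> dot b v0 = 0 -> dot w v0 = 0 -> dot a b = 1 ->
  exists d, d ^+ 2 = - (dot a w * dot b w) *+ 2.
Proof.
move=> uv qv qa qb qw av bv wv ab.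
pose r := nth 0 [:: v0; u; a; b; w].
pose M : 'M[A]_5 := \matrix_(i, j) r i 0 j.
exists (\det M).
have -> : \det M ^+ 2 = \det (\matrix_(i < 5, j < 5) dot (r i) (r j)).
  rewrite expr2 -{2}(det_tr M) -det_mulmx; congr (\det _); apply/matrixP => i j.
  by rewrite !mxE dotE; apply: eq_bigr => k _; rewrite !mxE.
pose g (i j : nat) := dot (r i) (r j).
have [g00 g01 g02 g03 g04] : [/\ g 0%N 0%N = 0, g 0%N 1%N = 1, g 0%N 2%N = 0, g 0%N 3%N = 0 & g 0%N 4%N = 0].
  by split; rewrite /g /= // dotC.
have [g10 g20 g30 g40] : [/\ g 1%N 0%N = 1, g 2%N 0%N = 0, g 3%N 0%N = 0 & g 4%N 0%N = 0].
  by split; rewrite /g /= // dotC.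
have [g22 g33 g44] : [/\ g 2%N 2%N = 0, g 3%N 3%N = 0 & g 4%N 4%N = 0] by [].
have [g23 g32] : g 2%N 3%N = 1 /\ g 3%N 2%N = 1 by split; rewrite /g /= // dotC.
have [g24 g42] : g 2%N 4%N = dot a w /\ g 4%N 2%N = dot a w by split; rewrite /g /= // dotC.
have [g34 g43] : g 3%N 4%N = dot b w /\ g 4%N 3%N = dot b w by split; rewrite /g /= // dotC.
rewrite (laplaceE 5 g); clearbody g; rewrite [laplace _ _]/=.
rewrite g00 g01 g02 g03 g04 g10 g20 g30 g40 g22 g33 g44 g23 g32 g24 g42 g34 g43.
ring.
Qed.

End GramDeterminant.

(** * The identity for a hyperbolic pair *)

Section PairIdentity.
Variables (R : realType) (tau : 'M[R[i]]_5).
Hypothesis tau_ball : ball4 tau.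
Local Notation C := R[i].
Local Notation V := 'rV['F_3]_5.
Variables v0 a b : V.
Hypotheses (v00 : v0 != 0) (qv0 : dot v0 v0 = 0) (qa : dot a a = 0) (qb : dot b b = 0).
Hypotheses (av0 : dot a v0 = 0) (bv0 : dot b v0 = 0) (ab : dot a b = 1).
Hypothesis max_a : forall w, dot w w = 0 -> dot w v0 = 0 -> dot a w = 0 ->
  exists i j, w = i *: a + j *: v0.
Hypothesis max_b : forall w, dot w w = 0 -> dot w v0 = 0 -> dot b w = 0 ->
  exists i j, w = i *: b + j *: v0.

Let gram w : dot w w = 0 -> dot w v0 = 0 ->
  dot a w != 0 -> dot b w != 0 -> dot a w = dot b w.
Proof.
move=> qw wv aw bw; have [i vi] : exists i, v0 0 i != 0.
  by apply/existsP; apply: contra_neqT v00 => /existsPn h; apply/rowP => i; rewrite mxE; apply/eqP/negPn/h.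
have uv : dot v0 ((v0 0 i)^-1 *: delta_mx 0 i) = 1.
  rewrite dotZr dotE (bigD1 i) //= big1 ?addr0 => [|j ji]; rewrite mxE.
    by rewrite !eqxx mulr1 mulVf.
  by rewrite eqxx (negbTE ji) mulr0.
(* In F_3 one has -2 = 1, so (a.w)(b.w) is a nonzero square, hence 1, and the two values agree. *)
have [d] := gram_hyperbolic uv qv0 qa qb qw av0 bv0 wv ab.
move: aw bw; case: (F3_cases (dot a w)) => ->; rewrite ?eqxx // => _;
  case: (F3_cases (dot b w)) => ->; rewrite ?eqxx // => _;
  by case: (F3_cases d) => -> /eqP.
Qed.

Let F v := theta_triple tau (rep3 v0) (rep3 v).

Lemma theta_triple_pair : F a = F b.
Proof.
have FE v : F v = theta_F3 tau v * theta_char tau (rep3 v + rep3 v0) * theta_char tau (rep3 v - rep3 v0).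
  by [].
have [h|h] := theta_F3_dichotomy tau_ball.
  have z v : dot v v = 0 -> F v = 0 by move=> qv; rewrite FE (h v qv) 2!mul0r.
  by rewrite (z a qa) (z b qb).
have [K hK] := theta_triple_transform tau_ball rep3_bij even_rep3.
apply: (hyperbolic_pair_eq (@chi3D R) (chi30 R) (chi31 R) (K := K)) v00 qa qb av0 bv0 ab max_a max_b gram.
- move=> v; rewrite /F hK; last exact: even_rep3.
  congr (K * _); apply: eq_bigr => w _; congr (_ * _).
  by rewrite chi3_int rmorphB /= !hform_rep3 opprK addrC.
- move=> v; have e : red3 (rep3 (- v)) = red3 (- rep3 v) by rewrite red3N !red3_rep mulNmx.
  have e1 := theta_triple_mod3 tau_ball (rep3 v0) (even_rep3 _) (even_sumN (even_rep3 v)) e.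
  have e2 := theta_triple_opp tau_ball (rep3 v0) (rep3 v).
  by rewrite /F e1 e2.
- move=> w; rewrite FE !mulf_eq0 !negb_or => /andP[/andP[w0 w1] _].
  have qw : dot w w = 0 by apply/eqP; apply: contraNT w0 => /h ->.
  (* The second factor of f(w) forces q(w + v0) = 0, and q(w + v0) = 2 w.v0 when w and v0 are
     isotropic. *)
  split=> //; have qwv : dot (w + v0) (w + v0) = 0.
    apply/eqP; apply: contraNT w1 => /h e; apply/eqP.
    have e' : red3 (rep3 (w + v0)) = red3 (rep3 w + rep3 v0) by rewrite red3D !red3_rep mulmxDl.
    exact: (theta_char_eq0_mod3 tau_ball (even_rep3 _) (even_sumD (even_rep3 w) (even_rep3 v0)) e' e).
  move: qwv; rewrite !dotDl !dotDr qw qv0 [dot v0 w]dotC add0r addr0.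
  by case: (F3_cases (dot w v0)) => -> // /eqP.
Qed.

Lemma theta_F3_pair :
  theta_F3 tau a ^+ 3 * theta_F3 tau (a + v0) ^+ 3 * theta_F3 tau (a - v0) ^+ 3 =
  theta_F3 tau b ^+ 3 * theta_F3 tau (b + v0) ^+ 3 * theta_F3 tau (b - v0) ^+ 3.
Proof.
have e v := theta_triple_cube tau_ball v0 v.
exact: etrans (esym (e a)) (etrans (congr1 (fun x => x ^+ 3) theta_triple_pair) (e b)).
Qed.

End PairIdentity.

(** * Isotropic planes *)

Section IsotropicGeometry.
Local Notation V := 'rV['F_3]_5.
Implicit Types (U W : {vspace V}) (v w a : V).

Lemma prod_F3 (A : comPzSemiRingType) (g : 'F_3 -> A) : \prod_x g x = g 0 * g 1 * g (-1).
Proof.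
rewrite (big_ord_recl 2) (big_ord_recl 1) (big_ord_recl 0) big_ord0 mulr1 mulrA.
by congr (g _ * g _ * g _); apply: val_inj.
Qed.

(** For a basis matrix X the relation X X^T = 0 bounds twice the rank by 5. *)
Lemma totally_isotropic_dim U : totally_isotropic U -> (\dim U <= 2)%N.
Proof.
move=> tU; pose X : 'M['F_3]_(\dim U, 5) := \matrix_i (vbasis U)`_i.
have rX i : row i X = (vbasis U)`_i by apply/rowP => j; rewrite !mxE.
have fX : row_free X.
  apply: inj_row_free => u; rewrite mulmx_sum_row => u0.
  have /freeP fr := basis_free (vbasisP U).
  apply/rowP => i; rewrite mxE; apply: (fr (fun i => u 0 i)).
  by rewrite -[RHS]u0; apply: eq_bigr => j _; rewrite rX.
have XX : X *m X^T = 0.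
  apply/matrixP => i j; have := tU _ _ (vbasis_mem (mem_tnth i (vbasis U))) (vbasis_mem (mem_tnth j (vbasis U))).
  rewrite !(tnth_nth 0) -!rX => h; rewrite mxE [RHS]mxE -[RHS]h dotE; apply: eq_bigr => k _.
  by rewrite !mxE.
have := mulmx0_rank_max XX; rewrite mxrank_tr; move: fX; rewrite /row_free => /eqP ->.
lia.
Qed.

(** U + <w> is again totally isotropic. *)
Lemma maximal_isotropic_mem U w : maximal_totally_isotropic U -> dot w w = 0 ->
  (forall u, u \in U -> dot u w = 0) -> w \in U.
Proof.
move=> [tU mU] qw uw; have tW : totally_isotropic (U + <[w]>)%VS.
  move=> _ _ /memv_addP[u uU [_ /vlineP[k ->] ->]] /memv_addP[u' u'U [_ /vlineP[k' ->] ->]].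
  have wu' : dot w u' = 0 by rewrite dotC uw.
  rewrite !dotDl !dotDr !dotZl !dotZr (tU u u') // (uw u) // wu' qw.
  by rewrite !mulr0 !addr0.
rewrite -(mU _ tW (addvSl _ _)).
by apply: (subvP (addvSr U <[w]>%VS)); exact: memv_line.
Qed.

Lemma isotropic_plane U v0 : totally_isotropic U -> v0 != 0 -> v0 \in U -> U <> <[v0]>%VS ->
  exists a, [/\ a \in U, a \notin <[v0]>%VS & forall w, w \in U -> exists i j, w = i *: a + j *: v0].
Proof.
move=> tU v00 v0U nU; have vU : (<[v0]> <= U)%VS by rewrite -memvE.
have /subvPn[a aU av] : ~~ (U <= <[v0]>)%VS.
  by apply/negP => h; apply: nU; apply/eqP; rewrite eqEsubv h vU.
exists a; split=> // w wU.
have sub : (<[a]> + <[v0]> <= U)%VS by rewrite subv_add -!memvE aU.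
have /eqP e : (<[a]> + <[v0]>)%VS == U.
  rewrite eqEdim sub (leq_trans (totally_isotropic_dim tU)) //.
  have : (\dim <[v0]> < \dim (<[a]> + <[v0]>))%N.
    rewrite ltn_neqAle dimvS ?addvSr // andbT; apply: contraNneq av => e.
    have /eqP -> : <[v0]>%VS == (<[a]> + <[v0]>)%VS by rewrite eqEdim addvSr e leqnn.
    by rewrite memvE addvSl.
  by rewrite dim_vline v00.
move: wU; rewrite -e => /memv_addP[_ /vlineP[i ->] [_ /vlineP[j ->] ->]].
by exists i, j.
Qed.

(** The affine line a + F_3 v0 meets each point of P(U) other than that of v0 exactly once, so a set
    of representatives amounts to a choice of three signs [sg]. *)
Lemma representatives_plane U v0 a (S : {set V}) :
  v0 != 0 -> v0 \in U -> a \in U -> a \notin <[v0]>%VS ->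
  (forall w, w \in U -> exists i j, w = i *: a + j *: v0) ->
  representatives S [predD proj_space U & proj_space <[v0]>%VS] ->
  exists sg : 'F_3 -> 'F_3, [/\ forall i, sg i != 0,
    injective (fun i => sg i *: (a + i *: v0)) &
    forall v, v \in S <-> exists i, v = sg i *: (a + i *: v0)].
Proof.
move=> v00 v0U aU av gen [Siso SX SL].
have u_out i : a + i *: v0 \notin <[v0]>%VS.
  apply: contra av => h; rewrite -[a](addrK (i *: v0)).
  by rewrite memvB // memvZ // memv_line.
have u0 i : a + i *: v0 != 0 by apply: contraNneq (u_out i) => ->; exact: mem0v.
have uU i : a + i *: v0 \in U by rewrite memvD // memvZ.
have XL i : [predD proj_space U & proj_space <[v0]>%VS] <[a + i *: v0]>%VS.
  by rewrite !inE !dim_vline u0 -!memvE u_out uU.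
have /boolp.choice[sg hsg] : forall i, exists k : 'F_3, k != 0 /\ k *: (a + i *: v0) \in S.
  move=> i; have [v [[vS vL] _]] := SL _ (XL i).
  have /vlineP[k vk] : v \in <[a + i *: v0]>%VS by rewrite -vL memv_line.
  exists k; rewrite -vk; split=> //; apply: contraTneq vS => k0.
  by apply/negP => /Siso; rewrite vk k0 scale0r inE eqxx.
have inj : injective (fun i => sg i *: (a + i *: v0)).
  move=> i j /= /eqP; rewrite !scalerDr !scalerA.
  rewrite -subr_eq0 opprD addrACA -scalerBl -scalerBl => e.
  have s0 : sg i - sg j = 0.
    apply/eqP; apply: contraNT av => s0.
    rewrite -[a]scale1r -(mulVf s0) -scalerA memvZ //.
    by move: e; rewrite addr_eq0 => /eqP ->; rewrite -scaleNr memvZ // memv_line.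
  move: e; rewrite s0 scale0r add0r scaler_eq0 (negbTE v00) orbF.
  move/eqP: s0; rewrite subr_eq0 => /eqP ->; rewrite -mulrBr mulf_eq0 (negbTE (hsg j).1) /=.
  by rewrite subr_eq0 => /eqP.
exists sg; split=> [i||v]; [by case: (hsg i)|exact: inj|split=> [vS|[i ->]]; last by case: (hsg i)].
have := SX v vS; rewrite !inE negb_and -!memvE => /andP[hv /andP[/eqP dv vU]].
move: hv; rewrite dv /= => vout.
have [i [j vE]] := gen v vU.
have i0 : i != 0.
  by apply: contraNneq vout => i0; rewrite vE i0 scale0r add0r memvZ // memv_line.
have vE' : v = i *: (a + (j / i) *: v0).
  by rewrite vE scalerDr scalerA mulrCA mulfV // mulr1.
exists (j / i); have [x [_ ux]] := SL _ (XL (j / i)).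
have line k : k != 0 -> <[k *: (a + (j / i) *: v0)]>%VS = <[a + (j / i) *: v0]>%VS.
  move=> k0; apply/eqP; rewrite eqEdim -memvE memvZ ?memv_line //= !dim_vline scaler_eq0 negb_or k0.
  by rewrite u0.
rewrite -(ux v); last by split=> //; rewrite vE' line.
by apply: ux; split; [case: (hsg (j / i))|rewrite line //; case: (hsg (j / i))].
Qed.

Lemma big_representatives (A : comNzRingType) (S : {set V}) (s : 'F_3 -> V) (g : V -> A) :
  injective s -> (forall v, v \in S <-> exists i, v = s i) ->
  \prod_(v in S) g v = \prod_i g (s i).
Proof.
move=> si hS; have -> : S = (s @: 'I_3)%SET.
  apply/setP => v; apply/idP/imsetP => [/hS[i ->]|[i _ ->]]; first by exists i.
  by apply/hS; exists i.
by rewrite big_imset //= => i j _ _; exact: si.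
Qed.

End IsotropicGeometry.

(** * Comparison of the two products *)

Lemma lift_F3_unit (x : 'F_3) : x != 0 -> lift_F3 x = 1 \/ lift_F3 x = -1.
Proof. by case: (F3_cases x) => ->; rewrite ?eqxx // => _; [left|right]. Qed.

Lemma cube_F3 (x : 'F_3) : x * x * x = x.
Proof. by case: (F3_cases x) => ->; apply: val_inj. Qed.

Opaque Theta3 theta_F3.

Theorem corollary5p12 (R : realType) (lift : 'rV['F_3]_5 -> 'rV[int]_5)
    (hlift : is_lift lift)
    (V1 V2 : {vspace 'rV['F_3]_5}) (hQ : in_Q V1 V2)
    (S1 S2 : {set 'rV['F_3]_5})
    (hS1 : representatives S1
             [predD proj_space V1 & proj_space (V1 :&: V2)%VS])
    (hS2 : representatives S2
             [predD proj_space V2 & proj_space (V1 :&: V2)%VS]) :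
  (eps_tilde S1 S2 = 1 \/ eps_tilde S1 S2 = - 1) /\
  forall tau : 'M[R[i]]_5, ball4 tau ->
    \prod_(v1 in S1) Theta3 (lift v1) tau =
    (eps_tilde S1 S2)%:~R * \prod_(v2 in S2) Theta3 (lift v2) tau.
Proof.
have [max1 max2 dcap] := hQ; have [t1 _] := max1; have [t2 _] := max2.
pose v0 := vpick (V1 :&: V2)%VS.
have v00 : v0 != 0 by rewrite vpick0 -dimv_eq0 dcap.
have capE : (V1 :&: V2)%VS = <[v0]>%VS.
  by apply/esym/eqP; rewrite eqEdim -memvE memv_pick dim_vline v00 dcap.
have v0cap : v0 \in (V1 :&: V2)%VS by exact: memv_pick.
have [v01 v02] : v0 \in V1 /\ v0 \in V2 by apply/andP; rewrite -memv_cap.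
rewrite capE in hS1 hS2.
have triv (V W : {vspace 'rV['F_3]_5}) : maximal_totally_isotropic V ->
    totally_isotropic W -> v0 \in W -> V = <[v0]>%VS -> W = <[v0]>%VS.
  by move=> [_ mV] tW vW VE; rewrite -VE; apply: mV => //; rewrite VE -memvE.
have empty (W : {vspace 'rV['F_3]_5}) (S : {set 'rV['F_3]_5}) : W = <[v0]>%VS ->
    representatives S [predD proj_space W & proj_space <[v0]>%VS] -> S = finset.set0.
  by move=> -> [_ SX _]; apply/setP => v; rewrite inE; apply/negP => /SX; rewrite !inE andNb.
(* If V1 is the line of v0, maximality makes V2 the same line, and both products are empty. *)
have [V1E|V1N] := eqVneq V1 <[v0]>%VS.
  have V2E := triv _ _ max1 t2 v02 V1E.
  rewrite (empty _ _ V1E hS1) (empty _ _ V2E hS2) /eps_tilde !big_set0.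
  split; first by left.
  by move=> tau _; rewrite !big_set0 mulr1.
have V2N : V2 <> <[v0]>%VS by move=> V2E; case/eqP: V1N; exact: triv max2 t1 v01 V2E.
have [a [aV av gen1]] := isotropic_plane t1 v00 v01 (elimN eqP V1N).
have [b' [bV' bv' gen2']] := isotropic_plane t2 v00 v02 V2N.
have qv0 : dot v0 v0 = 0 by exact: t1.
(* Otherwise b' would be orthogonal to V1, hence in V1 by maximality, hence on the line of v0. *)
have ab' : dot a b' != 0.
  apply: contraNneq bv' => ab; rewrite -capE memv_cap bV' andbT.
  apply: (maximal_isotropic_mem max1); first exact: t2.
  by move=> u /gen1[i [j ->]]; rewrite dotDl !dotZl ab (t2 v0) // !mulr0 addr0.
pose b := (dot a b')^-1 *: b'.
have ab : dot a b = 1 by rewrite /b dotZr mulVf.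
have bV : b \in V2 by rewrite memvZ.
have b'E : b' = dot a b' *: b by rewrite /b scalerA mulfV // scale1r.
clearbody b.
have bv : b \notin <[v0]>%VS by apply: contra bv' => h; rewrite b'E memvZ.
have gen2 w : w \in V2 -> exists i j, w = i *: b + j *: v0.
  by move=> /gen2'[i [j ->]]; exists (i * dot a b'), j; rewrite -scalerA -b'E.
have [qa qb] : dot a a = 0 /\ dot b b = 0 by split; [exact: t1|exact: t2].
have [av0 bv0] : dot a v0 = 0 /\ dot b v0 = 0 by split; [exact: t1|exact: t2].
have max_a w : dot w w = 0 -> dot w v0 = 0 -> dot a w = 0 -> exists i j, w = i *: a + j *: v0.
  move=> qw wv aw; apply: (gen1 w); apply: (maximal_isotropic_mem max1 qw) => u /gen1[i [j ->]].
  by rewrite dotDl !dotZl aw [dot v0 w]dotC wv !mulr0 addr0.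
have max_b w : dot w w = 0 -> dot w v0 = 0 -> dot b w = 0 -> exists i j, w = i *: b + j *: v0.
  move=> qw wv bw; apply: (gen2 w); apply: (maximal_isotropic_mem max2 qw) => u /gen2[i [j ->]].
  by rewrite dotDl !dotZl bw [dot v0 w]dotC wv !mulr0 addr0.
have [sg [sg0 sgi sgS]] := representatives_plane v00 v01 aV av gen1 hS1.
have [rh [rh0 rhi rhS]] := representatives_plane v00 v02 bV bv gen2 hS2.
pose P (s : 'F_3 -> 'F_3) := \prod_i s i.
have P0 s : (forall i, s i != 0) -> P s != 0 by move=> h; apply/prodf_neq0.
have epsE : eps_tilde S1 S2 = lift_F3 (P sg * P rh).
  rewrite /eps_tilde (big_representatives _ sgi sgS); congr lift_F3.
  transitivity (\prod_i \prod_j (sg i * rh j)).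
    apply: eq_bigr => i _; rewrite (big_representatives _ rhi rhS); apply: eq_bigr => j _.
    rewrite !dotZl !dotZr dotDl !dotDr !dotZl !dotZr ab av0 [dot v0 b]dotC bv0 qv0.
    by rewrite !mulr0 !addr0 mulr1.
  (* Each sign occurs three times in the double product, once for every element of the other set,
     and x^3 = x in F_3. *)
  rewrite -[P sg]cube_F3 -[P rh]cube_F3 /P !prod_F3; ring.
split; first by rewrite epsE; apply: lift_F3_unit; rewrite mulf_neq0 // P0.
move=> tau tau_ball; rewrite epsE.
have Theta3_lift v : v \in isotropic_vectors -> Theta3 (lift v) tau = theta_F3 tau v ^+ 3.
  by move=> /hlift h; rewrite (Theta3_red tau_ball) -[in RHS]h.
have odd v := theta_F3N tau_ball v.
have prodE (S : {set 'rV['F_3]_5}) (s : 'F_3 -> 'F_3) c : {subset S <= isotropic_vectors} ->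
    injective (fun i => s i *: (c + i *: v0)) ->
    (forall v, v \in S <-> exists i, v = s i *: (c + i *: v0)) ->
    \prod_(v in S) Theta3 (lift v) tau = (lift_F3 (P s))%:~R *
    (theta_F3 tau c ^+ 3 * theta_F3 tau (c + v0) ^+ 3 * theta_F3 tau (c - v0) ^+ 3).
  move=> Siso si hS; rewrite (eq_bigr (fun v => theta_F3 tau v ^+ 3)) => [|v /Siso/Theta3_lift //].
  rewrite (big_representatives _ si hS).
  (* The cubes form an odd function of v, so each scalar comes out as its lift. *)
  under eq_bigr do rewrite (scaleF3_sign (f := fun v => theta_F3 tau v ^+ 3)) //.
  rewrite big_split /=; congr (_ * _).
    rewrite /P !prod_F3 !lift_F3M !rmorphM //.
  by rewrite prod_F3 scale0r addr0 scale1r scaleN1r.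
have [Siso1 _ _] := hS1; have [Siso2 _ _] := hS2.
rewrite (prodE _ _ _ Siso1 sgi sgS) (prodE _ _ _ Siso2 rhi rhS).
(* [lift_F3 (P rh)] is a sign with square 1, so it can be moved to the other side. *)
have epsM : lift_F3 (P sg) = lift_F3 (P sg * P rh) * lift_F3 (P rh).
  rewrite lift_F3M -mulrA.
  by case: (lift_F3_unit (P0 _ rh0)) => ->; rewrite ?mulrNN !mulr1.
rewrite epsM [X in X * _]rmorphM -[LHS]mulrA; apply: (congr1 (fun x => _ * (_ * x))).
exact: theta_F3_pair.
Qed.
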